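(* Let $\Omega$ be a hyperbolic domain in $\mathbb C$ with $z=0$ as an isolated boundary point and let $\lambda(z)\,|dz|$ be a conformal pseudometric with curvature $\kappa_\lambda\le-4$ on $\Omega$. Then either $\lambda\equiv\lambda_\Omega$ or $$\limsup_{z\to0}\left(\log\frac{\lambda(z)}{\lambda_\Omega(z)}\right)\cdot\log\frac1{|z|}<0.$$
   Context: A hyperbolic domain $\Omega$ in $\mathbb C$ is a non-empty, open, connected subset of $\mathbb C$ such that $\hat{\mathbb C}\setminus\Omega$ contains at least three distinct points, where $\hat{\mathbb C}=\mathbb C\cup\{\infty\}$. A conformal pseudometric $\lambda(z)\,|dz|$ on a domain $G\subseteq\mathbb C$ is a continuous function $\lambda:G\to[0,\infty)$; it is assumed throughout to be of class $C^2$ on the open set $G_\lambda=\{z\in G:\lambda(z)>0\}$. Its Gauss curvature is $\kappa_\lambda(z)=-\Delta(\log\lambda)(z)/\lambda(z)^2$ for $z\in G_\lambda$, and ''$\kappa_\lambda\le-4$'' means $\kappa_\lambda(z)\le-4$ for all $z\in G_\lambda$. Convention: $\log0=-\infty$, and the limsup may be $-\infty$. The hyperbolic metric of the unit disk $\mathbb D$ is $\lambda_{\mathbb D}(z)\,|dz|=|dz|/(1-|z|^2)$ (curvature $-4$). The hyperbolic metric $\lambda_\Omega(z)\,|dz|$ of $\Omega$ is defined by $\lambda_\Omega(\pi(z))|\pi'(z)|=\lambda_{\mathbb D}(z)$ for a holomorphic universal covering $\pi:\mathbb D\to\Omega$. *)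

(* Defs.v *)
(** Stdlib real numbers and Coquelicot; the plane is Coquelicot's [C = R * R]. *)
From Stdlib Require Import Reals.
From Coquelicot Require Import Coquelicot.
Open Scope R_scope.

(** * Domains *)

(** The Riemann sphere is [option C], with [None] the point at infinity. *)
Definition sphere : Type := option C.

Definition in_sphere (E : C -> Prop) (p : sphere) : Prop :=
  match p with Some z => E z | None => False end.

Definition connected (E : C -> Prop) : Prop :=
  forall A B : C -> Prop, open A -> open B ->
    (forall z, E z -> A z \/ B z) ->
    (exists z, E z /\ A z) -> (exists z, E z /\ B z) ->
    exists z, E z /\ A z /\ B z.

Definition hyperbolic_domain (Omega : C -> Prop) : Prop :=
  (exists z, Omega z) /\ open Omega /\ connected Omega /\
  exists p q r : sphere,
    p <> q /\ p <> r /\ q <> r /\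
    ~ in_sphere Omega p /\ ~ in_sphere Omega q /\ ~ in_sphere Omega r.

Definition boundary (E : C -> Prop) (z : C) : Prop :=
  forall U : C -> Prop, locally z U ->
    (exists w, U w /\ E w) /\ (exists w, U w /\ ~ E w).

Definition isolated_boundary_point (E : C -> Prop) (z : C) : Prop :=
  boundary E z /\ locally' z (fun w => ~ boundary E w).

(** * Conformal pseudometrics *)

Definition d_dx (f : C -> R) (z : C) : R := Derive (fun x => f (x, Im z)) (Re z).
Definition d_dy (f : C -> R) (z : C) : R := Derive (fun y => f (Re z, y)) (Im z).

(** Real differentiability class [C^n] on an open set [U]: [Derive] is a total
    function, hence the explicit existence of the partial derivatives. *)
Fixpoint class_C (n : nat) (U : C -> Prop) (f : C -> R) : Prop :=
  match n with
  | O => forall z, U z -> continuous f z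
  | S m =>
      (forall z, U z -> ex_derive (fun x => f (x, Im z)) (Re z) /\
                        ex_derive (fun y => f (Re z, y)) (Im z)) /\
      class_C m U (d_dx f) /\ class_C m U (d_dy f)
  end.

Definition laplacian (f : C -> R) (z : C) : R := d_dx (d_dx f) z + d_dy (d_dy f) z.

Definition positive_part (G : C -> Prop) (lam : C -> R) (z : C) : Prop :=
  G z /\ 0 < lam z.

(** A pseudometric on [G] is represented by a function on all of [C], whose
    values outside the open set [G] are irrelevant. *)
Definition conformal_pseudometric (G : C -> Prop) (lam : C -> R) : Prop :=
  (forall z, G z -> 0 <= lam z) /\
  (forall z, G z -> continuous lam z) /\
  class_C 2 (positive_part G lam) lam.

Definition gauss_curvature (lam : C -> R) (z : C) : R :=
  - laplacian (fun w => ln (lam w)) z / (lam z) ^ 2.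

Definition curvature_le (G : C -> Prop) (lam : C -> R) (k : R) : Prop :=
  forall z, positive_part G lam z -> gauss_curvature lam z <= k.

(** * The hyperbolic metric *)

Definition unit_disk (z : C) : Prop := Cmod z < 1.

Definition lambda_disk (z : C) : R := / (1 - Cmod z ^ 2).

Definition holomorphic_on (U : C -> Prop) (f : C -> C) : Prop :=
  forall z, U z -> ex_derive (K := C_AbsRing) (V := C_NormedModule) f z.

Definition homeomorphism_on (V U : C -> Prop) (f : C -> C) : Prop :=
  (forall z, V z -> U (f z) /\ continuous f z) /\
  exists g : C -> C,
    (forall w, U w -> V (g w) /\ continuous g w) /\
    (forall z, V z -> g (f z) = z) /\ (forall w, U w -> f (g w) = w).

(** Covering map between open sets [X] and [Y]: [p] is a continuous surjection
    and each point of [Y] has an evenly covered neighbourhood [U], the sheets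
    over [U] being the members of the family [V]. *)
Definition covering_map (X Y : C -> Prop) (p : C -> C) : Prop :=
  (forall z, X z -> Y (p z) /\ continuous p z) /\
  (forall w, Y w -> exists z, X z /\ p z = w) /\
  (forall w, Y w ->
    exists U : C -> Prop, open U /\ U w /\ (forall v, U v -> Y v) /\
    exists (I : Type) (V : I -> C -> Prop),
      (forall i, open (V i)) /\
      (forall z, (X z /\ U (p z)) <-> exists i, V i z) /\
      (forall i j z, V i z -> V j z -> i = j) /\
      (forall i, homeomorphism_on (V i) U p)).

(** A covering by the disk is universal, the disk being simply connected. *)
Definition holomorphic_universal_covering (Omega : C -> Prop) (pi : C -> C) : Prop :=
  holomorphic_on unit_disk pi /\ covering_map unit_disk Omega pi.

(** [lamO] is the hyperbolic metric of [Omega]; its values outside [Omega] are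
    irrelevant. *)
Definition hyperbolic_metric (Omega : C -> Prop) (lamO : C -> R) : Prop :=
  exists pi : C -> C, holomorphic_universal_covering Omega pi /\
    forall z, unit_disk z -> lamO (pi z) * Cmod (C_derive pi z) = lambda_disk z.

(** * Extended real logarithm and upper limit *)

(** Only applied to [x >= 0], with [log 0 = -oo]. *)
Definition Rbar_ln (x : R) : Rbar :=
  if Rlt_dec 0 x then Finite (ln x) else m_infty.

(** Upper limit of [f] along the filter [F]: the infimum over [V] in [F] of the
    supremum of [f] on [V]. *)
Definition limsup {T : Type} (F : (T -> Prop) -> Prop) (f : T -> Rbar) : Rbar :=
  Rbar_glb (fun s => exists V : T -> Prop,
    F V /\ s = Rbar_lub (fun y => exists z, V z /\ y = f z)).

(* Main.v *)
Require Import Defs.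
From Stdlib Require Import Reals Lra Lia Psatz Classical ClassicalEpsilon IndefiniteDescription.
From Coquelicot Require Import Coquelicot.
Open Scope R_scope.

(** Let w = ln (lamO / lam), which takes the value +oo where lam vanishes. The hyperbolic density satisfies
    Lap (ln lamO) = 4 lamO^2, and the curvature bound on lam reads Lap (ln lam) >= 4 lam^2. Ahlfors'
    lemma ([ahlfors_lemma]) gives w >= 0, and then
    Lap w <= 4 lamO^2 (1 - exp (- 2 w)) <= 8 lamO^2 w, so w is a nonnegative supersolution of a linear
    equation. By the maximum principle ([comparison_principle]) it dominates every subsolution that it
    dominates on the boundary of a compact set. Two choices of subsolution finish the proof.

    A Gaussian barrier on annuli around interior points shows that w > 0 spreads to neighbouring
    points; as Omega is connected, w is identically 0 or positive everywhere ([ahlfors_dichotomy]).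

    Assume the latter. Near the isolated boundary point, Omega contains a punctured disk of radius r. Let
    s = ln (r / |z|). Comparing lamO with the density of the punctured disk gives lamO <= 1 / (2 |z| s)
    ([hyperbolic_upper_punctured]), hence 8 lamO^2 <= 2 / (|z|^2 s^2). In the coordinate ln z the
    radial form of the resulting equation is b'' = 2 b / s^2, whose decaying solution is 1 / s. Since w is
    bounded below by some c > 0 on the circle s = 1, we get w >= c / s near 0 ([puncture_decay]). As s and
    ln (1 / |z|) have quotient tending to 1, ln (lam / lamO) * ln (1 / |z|) stays below a negative constant.

    The equation for lamO is obtained from lamO (pi z) |pi' z| = 1 / (1 - |z|^2) in the disk, where it
    requires ln |pi'| to be harmonic. Complex differentiability of pi alone must therefore yield second-order
    expansions of pi and of pi'. This is [cderiv_cderiv], proved by Goursat's lemma for triangles and a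
    Cauchy formula on squares, with a nonzero constant in place of 2 pi i.

    Laplacians are read off from second-order expansions ([has_lap]). Such expansions are additive, behave
    well under holomorphic substitution, and decide the sign of the Laplacian at a maximum, which is all
    that the maximum principles need; in this way the metric lamO only enters after composition with pi. *)

(** * Complex derivatives *)

Lemma Cmod_sub_sym (x y : C) : Cmod (x - y) = Cmod (y - x).
Proof. rewrite <- (Cmod_opp (x - y)). f_equal. ring. Qed.

Lemma Cmod_sub_le (x y : C) : Cmod (x - y) <= Cmod x + Cmod y.
Proof.
  rewrite <- (Cmod_opp y). apply Cmod_triangle.
Qed.

Lemma Cmod_rev_triangle (x y : C) : Cmod x - Cmod (x - y) <= Cmod y.
Proof.
  replace x with ((x - y) + y)%C at 1 by ring.
  generalize (Cmod_triangle (x - y) y). lra.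
Qed.

Lemma im_le_Cmod (z : C) : Rabs (Im z) <= Cmod z.
Proof. apply Rle_trans with (2 := Rmax_Cmod z). apply Rmax_r. Qed.

Lemma Cmod_le_sum (z : C) : Cmod z <= Rabs (Re z) + Rabs (Im z).
Proof.
  unfold Cmod. apply Rsqr_incr_0_var.
  - rewrite Rsqr_sqrt.
    + unfold Rsqr. generalize (Rabs_pos (Re z)) (Rabs_pos (Im z)).
      assert (H := pow2_abs (Re z)). assert (H' := pow2_abs (Im z)).
      unfold Re, Im in *. nra.
    + nra.
  - generalize (Rabs_pos (Re z)) (Rabs_pos (Im z)). lra.
Qed.

Lemma Cmod_convex (p a b : C) (t r : R) : 0 <= t <= 1 ->
  Cmod (a - p) <= r -> Cmod (b - p) <= r -> Cmod (a + t * (b - a) - p) <= r.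
Proof.
  intros Ht Ha Hb.
  replace (a + t * (b - a) - p)%C with (RtoC (1 - t) * (a - p) + RtoC t * (b - p))%C
    by (rewrite RtoC_minus; ring).
  apply Rle_trans with (1 := Cmod_triangle _ _). rewrite !Cmod_mult, !Cmod_R.
  rewrite !Rabs_pos_eq by lra. nra.
Qed.

Lemma Cmod_eq_0_small (x : C) (K d : R) : 0 < d ->
  (forall t, 0 < t < d -> Cmod x <= K * t) -> x = 0.
Proof.
  intros Hd H. apply Cmod_eq_0, Rle_antisym; [|apply Cmod_ge_0].
  apply le_epsilon. intros eps He. assert (HK := Rabs_pos K).
  set (t := Rmin (d / 2) (eps / (Rabs K + 1))).
  assert (Ht : 0 < t) by (apply Rmin_pos; [lra|]; apply Rdiv_lt_0_compat; lra).
  assert (Ht1 : t <= d / 2) by apply Rmin_l.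
  assert (Ht2 : t * (Rabs K + 1) <= eps).
  { replace eps with (eps / (Rabs K + 1) * (Rabs K + 1)) by (field; lra).
    apply Rmult_le_compat_r; [lra | apply Rmin_r]. }
  specialize (H t ltac:(lra)). assert (L := Rle_abs K). nra.
Qed.

(** Here r is meant to be the remainder of an expansion at a point, as a function of the complex
    increment. Complex derivatives and second-order expansions in the plane are expressed through
    it. *)
Definition little_o (n : nat) (r : C -> R) : Prop :=
  forall eps, 0 < eps -> exists del, 0 < del /\
    forall h, Cmod h < del -> Rabs (r h) <= eps * Cmod h ^ n.

Lemma little_o_dom (n : nat) (r s : C -> R) (K d : R) :
  0 < d -> (forall h, Cmod h < d -> Rabs (r h) <= K * Rabs (s h)) ->
  little_o n s -> little_o n r.
Proof.
  intros Hd H Hs eps He.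
  set (K' := Rabs K + 1).
  assert (HK : 0 < K') by (unfold K'; generalize (Rabs_pos K); lra).
  destruct (Hs (eps / K')) as [e [He1 He2]].
  { now apply Rdiv_lt_0_compat. }
  exists (Rmin d e). split. { now apply Rmin_pos. }
  intros h Hh.
  apply Rle_trans with (1 := H h (Rlt_le_trans _ _ _ Hh (Rmin_l _ _))).
  specialize (He2 h (Rlt_le_trans _ _ _ Hh (Rmin_r _ _))).
  apply Rle_trans with (K' * Rabs (s h)).
  { apply Rmult_le_compat_r. apply Rabs_pos. unfold K'. generalize (Rle_abs K). lra. }
  apply Rle_trans with (K' * (eps / K' * Cmod h ^ n)).
  { apply Rmult_le_compat_l. lra. exact He2. }
  right. field. lra.
Qed.

Lemma little_o_ext (n : nat) (r s : C -> R) (d : R) :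
  0 < d -> (forall h, Cmod h < d -> r h = s h) -> little_o n s -> little_o n r.
Proof.
  intros Hd H. apply (little_o_dom n r s 1 d Hd).
  intros h Hh. rewrite (H h Hh). lra.
Qed.

Lemma little_o_plus (n : nat) (r s : C -> R) :
  little_o n r -> little_o n s -> little_o n (fun h => r h + s h).
Proof.
  intros Hr Hs eps He.
  destruct (Hr (eps / 2)) as [d [Hd1 Hd2]]; [lra|].
  destruct (Hs (eps / 2)) as [e [He1 He2]]; [lra|].
  exists (Rmin d e). split. { now apply Rmin_pos. }
  intros h Hh.
  specialize (Hd2 h (Rlt_le_trans _ _ _ Hh (Rmin_l _ _))).
  specialize (He2 h (Rlt_le_trans _ _ _ Hh (Rmin_r _ _))).
  generalize (Rabs_triang (r h) (s h)). lra.
Qed.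

Lemma little_o_bigO (n : nat) (r : C -> R) (K d : R) :
  0 < d -> (forall h, Cmod h < d -> Rabs (r h) <= K * Cmod h ^ S n) -> little_o n r.
Proof.
  intros Hd H.
  apply (little_o_dom n r (fun h => Cmod h ^ S n) K d Hd).
  { intros h Hh. rewrite (Rabs_pos_eq (Cmod h ^ S n)). now apply H.
    apply pow_le, Cmod_ge_0. }
  intros eps He. exists eps. split; [exact He|]. intros h Hh.
  rewrite Rabs_pos_eq by (apply pow_le, Cmod_ge_0).
  simpl. apply Rmult_le_compat_r; [apply pow_le, Cmod_ge_0 | lra].
Qed.

Lemma little_o_zero (n : nat) : little_o n (fun _ => 0).
Proof.
  apply (little_o_bigO n _ 0 1); [lra|]. intros h _. rewrite Rabs_R0. lra.
Qed.

(** Complex derivative in terms of moduli. The two normed-module structures on C used for complex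
    derivatives have different balls but the same norm, and this form is common to both. *)
Definition cderiv (f : C -> C) (z l : C) : Prop :=
  little_o 1 (fun h => Cmod (f (z + h)%C - f z - l * h)).

Lemma cderiv_lip (f : C -> C) (z l : C) : cderiv f z l ->
  exists d, 0 < d /\
    forall h, Cmod h < d -> Cmod (f (z + h)%C - f z) <= (Cmod l + 1) * Cmod h.
Proof.
  intros H. destruct (H 1 Rlt_0_1) as [d [Hd1 Hd2]].
  exists d. split; [exact Hd1|]. intros h Hh. specialize (Hd2 h Hh).
  rewrite Rabs_pos_eq in Hd2 by apply Cmod_ge_0.
  replace (f (z + h)%C - f z)%C with ((f (z + h)%C - f z - l * h) + l * h)%C by ring.
  apply Rle_trans with (1 := Cmod_triangle _ _).
  rewrite Cmod_mult. simpl in Hd2. lra.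
Qed.

Lemma cderiv_ext (f g : C -> C) (z l : C) (d : R) : 0 < d ->
  (forall h, Cmod h < d -> f (z + h)%C = g (z + h)%C) ->
  cderiv g z l -> cderiv f z l.
Proof.
  intros Hd H. apply (little_o_ext 1 _ _ d Hd). intros h Hh.
  assert (H0 := H (RtoC 0)). rewrite Cmod_0, Cplus_0_r in H0.
  rewrite (H h Hh), (H0 Hd). reflexivity.
Qed.

Lemma cderiv_const (c z : C) : cderiv (fun _ => c) z 0.
Proof.
  apply (little_o_ext 1 _ (fun _ => 0) 1 Rlt_0_1); [|apply little_o_zero].
  intros h _. replace (c - c - 0 * h)%C with (RtoC 0) by ring. apply Cmod_0.
Qed.

Lemma cderiv_id (z : C) : cderiv (fun z => z) z 1.
Proof.
  apply (little_o_ext 1 _ (fun _ => 0) 1 Rlt_0_1); [|apply little_o_zero].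
  intros h _. replace (z + h - z - 1 * h)%C with (RtoC 0) by ring. apply Cmod_0.
Qed.

(** Only the norm of the target enters, so the statement for one normed-module structure on C is
    transported to the other by [is_derive_ring_cderiv]; the calculus rules are then inherited
    from those over an arbitrary absolute-value ring. *)
Lemma is_derive_cderiv (f : C -> C) (z l : C) :
  is_derive (K := C_AbsRing) (V := C_NormedModule) f z l -> cderiv f z l.
Proof.
  intros [_ H] eps He.
  specialize (H z (fun P H => H) (mkposreal eps He)).
  destruct H as [d Hd]. exists d. split; [apply cond_pos|].
  intros h Hh. specialize (Hd (z + h)%C).
  rewrite Rabs_pos_eq by apply Cmod_ge_0.
  assert (Hb : ball (M := AbsRing_UniformSpace C_AbsRing) z d (z + h)%C).
  { unfold ball; simpl. unfold AbsRing_ball. unfold abs, minus, plus, opp; simpl.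
    replace (z + h + - z)%C with h by ring. exact Hh. }
  specialize (Hd Hb). unfold norm, scal, minus, plus, opp in Hd; simpl in Hd.
  unfold abs, scal, mult in Hd; simpl in Hd.
  replace (z + h + - z)%C with h in Hd by ring.
  replace (f (z + h)%C - f z - l * h)%C with (f (z + h)%C + - f z + - (h * l))%C by ring.
  rewrite pow_1. exact Hd.
Qed.

Lemma is_derive_ring_cderiv (f : C -> C) (z l : C) :
  is_derive (K := C_AbsRing) (V := AbsRing_NormedModule C_AbsRing) f z l -> cderiv f z l.
Proof.
  intros [[L1 L2 L3] H]. apply is_derive_cderiv. split; [split; assumption | exact H].
Qed.

Lemma cderiv_is_derive (f : C -> C) (z l : C) :
  cderiv f z l -> is_derive (K := C_AbsRing) (V := AbsRing_NormedModule C_AbsRing) f z l.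
Proof.
  intros H. split; [apply is_linear_scal_l|]. intros x Hx.
  apply (is_filter_lim_locally_unique (V := AbsRing_NormedModule C_AbsRing) z) in Hx. subst x. intros [eps He].
  destruct (H eps He) as [d [Hd1 Hd2]]. exists (mkposreal d Hd1). intros y' Hy. set (y := y' : C).
  assert (Hy0 : Cmod (y - z) < d) by exact Hy.
  specialize (Hd2 (y - z)%C Hy0). rewrite Rabs_pos_eq, pow_1 in Hd2 by apply Cmod_ge_0.
  replace (z + (y - z))%C with y in Hd2 by ring.
  change (Cmod (f y - f z - (y - z) * l) <= eps * Cmod (y - z)).
  replace ((y - z) * l)%C with (l * (y - z))%C by ring. exact Hd2.
Qed.

Lemma cderiv_plus (f g : C -> C) (z l m : C) :
  cderiv f z l -> cderiv g z m -> cderiv (fun z => f z + g z)%C z (l + m).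
Proof.
  intros Hf Hg. apply is_derive_ring_cderiv.
  exact (is_derive_plus _ _ z _ _ (cderiv_is_derive _ _ _ Hf) (cderiv_is_derive _ _ _ Hg)).
Qed.

Lemma cderiv_mult (f g : C -> C) (z l m : C) :
  cderiv f z l -> cderiv g z m ->
  cderiv (fun z => f z * g z)%C z (l * g z + f z * m).
Proof.
  intros Hf Hg. apply is_derive_ring_cderiv.
  exact (is_derive_mult f g z _ _ (cderiv_is_derive _ _ _ Hf) (cderiv_is_derive _ _ _ Hg) Cmult_comm).
Qed.

Lemma Cmod_ge_neq0 (x : C) (d : R) : 0 < d -> d <= Cmod x -> x <> 0.
Proof. intros Hd H. apply Cmod_gt_0. lra. Qed.

Lemma inv_bounds (x h : C) (d : R) : 0 < d -> d <= Cmod x -> Cmod h < d / 2 ->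
  x <> 0 /\ (x - h)%C <> 0 /\ Cmod (/ x) <= / d /\ Cmod (/ (x - h)) <= 2 / d.
Proof.
  intros Hd Hx Hh.
  assert (Q : d / 2 <= Cmod (x - h)).
  { generalize (Cmod_rev_triangle x (x - h)). replace (x - (x - h))%C with h by ring. lra. }
  assert (N : x <> 0) by (apply Cmod_ge_neq0 with d; lra).
  assert (N2 : (x - h)%C <> 0) by (apply Cmod_ge_neq0 with (d / 2); lra).
  repeat split; try assumption; rewrite Cmod_inv by assumption.
  - apply Rinv_le_contravar; lra.
  - replace (2 / d) with (/ (d / 2)) by (field; lra). apply Rinv_le_contravar; lra.
Qed.

Lemma cderiv_Cinv (w : C) : w <> 0 -> cderiv Cinv w (- RtoC 1 / (w * w)).
Proof.
  intros Hw. assert (Hp : 0 < Cmod w) by now apply Cmod_gt_0. set (p := Cmod w) in *.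
  apply (little_o_bigO 1 _ (2 / (p * p * p)) (p / 2)); [lra|]. intros h Hh.
  destruct (inv_bounds w (- h) p Hp (Rle_refl _)) as (_ & N & Q1 & Q2); [now rewrite Cmod_opp|].
  replace (w - - h)%C with (w + h)%C in * by ring.
  rewrite Rabs_pos_eq by apply Cmod_ge_0.
  replace (/ (w + h) - / w - - RtoC 1 / (w * w) * h)%C with (h * h * (/ w * / w * / (w + h)))%C
    by (field; split; assumption).
  rewrite !(Cmod_mult (_ * _)), !Cmod_mult.
  replace (2 / (p * p * p) * Cmod h ^ 2) with (Cmod h * Cmod h * (/ p * / p * (2 / p))) by (field; lra).
  apply Rmult_le_compat_l; [apply Rle_0_sqr|].
  repeat (apply Rmult_le_compat; auto using Cmod_ge_0, Rmult_le_pos).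
Qed.

Lemma cderiv_inv (f : C -> C) (z l : C) :
  cderiv f z l -> f z <> 0 -> cderiv (fun z => / f z)%C z (- l / (f z * f z)).
Proof.
  intros Hf Hz. replace (- l / (f z * f z))%C with (l * (- RtoC 1 / (f z * f z)))%C by (field; exact Hz).
  apply is_derive_ring_cderiv.
  exact (is_derive_comp (V := AbsRing_NormedModule C_AbsRing) Cinv f z _ _ (cderiv_is_derive _ _ _ (cderiv_Cinv _ Hz)) (cderiv_is_derive _ _ _ Hf)).
Qed.

Lemma locally_Cmod (z : C) (P : C -> Prop) :
  locally z P <-> exists d, 0 < d /\ forall h, Cmod h < d -> P (z + h)%C.
Proof.
  split.
  - intros [d Hd]. exists d. split; [apply cond_pos|]. intros h Hh. apply Hd.
    apply C_NormedModule_mixin_compat1. unfold minus, plus, opp; simpl.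
    replace (z + h + - z)%C with h by ring. exact Hh.
  - intros [d [Hd H]].
    assert (Hs : 0 < d / sqrt 2) by (apply Rdiv_lt_0_compat; [lra | apply sqrt_lt_R0; lra]).
    exists (mkposreal _ Hs). intros y Hy.
    apply C_NormedModule_mixin_compat2 in Hy. simpl in Hy.
    replace y with (z + minus y z)%C by (unfold minus, plus, opp; simpl; ring).
    apply H. replace d with (sqrt 2 * (d / sqrt 2)); [exact Hy|].
    field. apply Rgt_not_eq, sqrt_lt_R0; lra.
Qed.

(** * Integrals along segments *)

Lemma continuous_C_iff (f : C -> C) (z : C) :
  continuous f z <-> forall eps, 0 < eps -> exists d, 0 < d /\
    forall h, Cmod h < d -> Cmod (f (z + h)%C - f z) < eps.
Proof.
  split.
  - intros H eps He.
    assert (L := proj2 (locally_Cmod (f z) (fun y => Cmod (y - f z)%C < eps))).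
    refine (proj1 (locally_Cmod z (fun x => Cmod (f x - f z)%C < eps)) (H _ (L _))).
    exists eps. split; [exact He|]. intros h Hh.
    now replace (f z + h - f z)%C with h by ring.
  - intros H P HP. destruct (proj1 (locally_Cmod (f z) P) HP) as [e [He HP']].
    destruct (H e He) as [d [Hd H']].
    refine (proj2 (locally_Cmod z (fun x => P (f x))) _). exists d. split; [exact Hd|]. intros h Hh.
    replace (f (z + h)%C) with (f z + (f (z + h)%C - f z))%C by ring.
    apply HP', H', Hh.
Qed.

Lemma cderiv_continuous (f : C -> C) (z l : C) : cderiv f z l -> continuous f z.
Proof.
  intros H. apply continuous_C_iff. intros eps He.
  destruct (cderiv_lip _ _ _ H) as [d [Hd1 Hd2]].
  assert (HL : 0 < Cmod l + 1) by (generalize (Cmod_ge_0 l); lra).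
  exists (Rmin d (eps / (Cmod l + 1))). split.
  { apply Rmin_pos; [exact Hd1|]. now apply Rdiv_lt_0_compat. }
  intros h Hh. apply Rle_lt_trans with (1 := Hd2 h (Rlt_le_trans _ _ _ Hh (Rmin_l _ _))).
  apply Rlt_le_trans with ((Cmod l + 1) * (eps / (Cmod l + 1))).
  - apply Rmult_lt_compat_l; [exact HL|]. apply Rlt_le_trans with (1 := Hh). apply Rmin_r.
  - right. field. lra.
Qed.

Lemma continuous_pair (T : UniformSpace) (f g : T -> R) (t : T) :
  continuous f t -> continuous g t -> continuous (fun t => (f t, g t) : C) t.
Proof.
  intros Hf Hg P [e He].
  assert (H1 : locally t (fun x => ball (f t) e (f x))) by exact (Hf _ (locally_ball (f t) e)).
  assert (H2 : locally t (fun x => ball (g t) e (g x))) by exact (Hg _ (locally_ball (g t) e)).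
  generalize (filter_and _ _ H1 H2). unfold filtermap. apply filter_imp.
  intros x [H3 H4]. apply He. split; assumption.
Qed.

Lemma continuous_Re (T : UniformSpace) (g : T -> C) (t : T) :
  continuous g t -> continuous (fun t => Re (g t)) t.
Proof. intros H. apply (continuous_comp g fst). exact H. apply continuous_fst. Qed.

Lemma continuous_Im (T : UniformSpace) (g : T -> C) (t : T) :
  continuous g t -> continuous (fun t => Im (g t)) t.
Proof. intros H. apply (continuous_comp g snd). exact H. apply continuous_snd. Qed.

Lemma continuous_Cmod (z : C) : continuous Cmod z.
Proof.
  apply (continuous_ext (norm (V := C_NormedModule))). reflexivity.
  apply (filterlim_norm (V := C_NormedModule)).
Qed.

Definition cint (g : R -> C) : C :=
  (RInt (fun t => Re (g t)) 0 1, RInt (fun t => Im (g t)) 0 1).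

Definition cont01 (g : R -> C) : Prop := forall t, 0 <= t <= 1 -> continuous g t.

Lemma cont01_ex_RInt (f : R -> R) (a b : R) : 0 <= a -> a <= b -> b <= 1 ->
  (forall t, 0 <= t <= 1 -> continuous f t) -> ex_RInt f a b.
Proof.
  intros Ha Hab Hb H. apply (ex_RInt_continuous (V := R_CompleteNormedModule)).
  intros z Hz. rewrite Rmin_left, Rmax_right in Hz by exact Hab. apply H. lra.
Qed.

Lemma cont01_Re (g : R -> C) (a b : R) : cont01 g -> 0 <= a -> a <= b -> b <= 1 ->
  ex_RInt (fun t => Re (g t)) a b.
Proof.
  intros H Ha Hab Hb. apply cont01_ex_RInt; try assumption.
  intros t Ht. apply continuous_Re, H, Ht.
Qed.

Lemma cont01_Im (g : R -> C) (a b : R) : cont01 g -> 0 <= a -> a <= b -> b <= 1 ->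
  ex_RInt (fun t => Im (g t)) a b.
Proof.
  intros H Ha Hab Hb. apply cont01_ex_RInt; try assumption.
  intros t Ht. apply continuous_Im, H, Ht.
Qed.

Lemma cint_ext (f g : R -> C) : (forall t, 0 <= t <= 1 -> f t = g t) -> cint f = cint g.
Proof.
  intros H. unfold cint. f_equal; apply RInt_ext; intros t Ht;
  rewrite Rmin_left, Rmax_right in Ht by lra; rewrite H by lra; reflexivity.
Qed.

Lemma cint_plus (f g : R -> C) : cont01 f -> cont01 g ->
  cint (fun t => f t + g t)%C = (cint f + cint g)%C.
Proof.
  intros Hf Hg. unfold cint, Cplus; simpl. f_equal.
  - apply (RInt_plus (V := R_CompleteNormedModule) (fun t => Re (f t)) (fun t => Re (g t)));
      apply cont01_Re; auto; lra.
  - apply (RInt_plus (V := R_CompleteNormedModule) (fun t => Im (f t)) (fun t => Im (g t)));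
      apply cont01_Im; auto; lra.
Qed.

Lemma cint_scal (c : C) (g : R -> C) : cont01 g -> cint (fun t => c * g t)%C = (c * cint g)%C.
Proof.
  intros Hg. unfold cint, Cmult; simpl.
  assert (H1 := cont01_Re g 0 1 Hg ltac:(lra) ltac:(lra) ltac:(lra)).
  assert (H2 := cont01_Im g 0 1 Hg ltac:(lra) ltac:(lra) ltac:(lra)).
  assert (S1 : forall k, ex_RInt (fun t => k * Re (g t)) 0 1)
    by (intros k; exact (ex_RInt_scal _ _ _ k H1)).
  assert (S2 : forall k, ex_RInt (fun t => k * Im (g t)) 0 1)
    by (intros k; exact (ex_RInt_scal _ _ _ k H2)).
  assert (E1 : forall k, RInt (fun t => k * Re (g t)) 0 1 = k * RInt (fun t => Re (g t)) 0 1)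
    by (intros k; exact (RInt_scal (V := R_CompleteNormedModule) _ 0 1 k H1)).
  assert (E2 : forall k, RInt (fun t => k * Im (g t)) 0 1 = k * RInt (fun t => Im (g t)) 0 1)
    by (intros k; exact (RInt_scal (V := R_CompleteNormedModule) _ 0 1 k H2)).
  f_equal.
  - rewrite <- E1, <- E2.
    exact (RInt_minus (V := R_CompleteNormedModule) _ _ 0 1 (S1 (fst c)) (S2 (snd c))).
  - rewrite <- E1, <- E2.
    exact (RInt_plus (V := R_CompleteNormedModule) _ _ 0 1 (S2 (fst c)) (S1 (snd c))).
Qed.

(** The factor 2 comes from bounding real and imaginary part separately. *)
Lemma cint_bound (g : R -> C) (M : R) : cont01 g ->
  (forall t, 0 <= t <= 1 -> Cmod (g t) <= M) -> Cmod (cint g) <= 2 * M.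
Proof.
  intros Hg HM. apply Rle_trans with (1 := Cmod_le_sum _).
  assert (HR : Rabs (Re (cint g)) <= (1 - 0) * M).
  { apply abs_RInt_le_const. lra. apply cont01_Re; auto; lra.
    intros t Ht. apply Rle_trans with (1 := re_le_Cmod _). now apply HM. }
  assert (HI : Rabs (Im (cint g)) <= (1 - 0) * M).
  { apply abs_RInt_le_const. lra. apply cont01_Im; auto; lra.
    intros t Ht. apply Rle_trans with (1 := im_le_Cmod _). now apply HM. }
  lra.
Qed.

Lemma RInt_lin (f : R -> R) (u v : R) : u <> 0 ->
  ex_RInt f v (u + v) ->
  RInt (fun t => f (u * t + v)) 0 1 = / u * RInt f v (u + v).
Proof.
  intros Hu H.
  assert (E : RInt (fun y => u * f (u * y + v)) 0 1 = RInt f v (u + v)).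
  { transitivity (RInt f (u * 0 + v) (u * 1 + v)); [|f_equal; ring].
    apply (RInt_comp_lin (V := R_CompleteNormedModule) f u v 0 1).
    replace (u * 0 + v) with v by ring. replace (u * 1 + v) with (u + v) by ring. exact H. }
  assert (X : ex_RInt (fun y => f (u * y + v)) 0 1).
  { apply ex_RInt_ext with (fun y => / u * (u * f (u * y + v))).
    - intros x _. change (/ u * (u * f (u * x + v)) = f (u * x + v)). field. exact Hu.
    - apply (ex_RInt_scal (V := R_NormedModule) (fun y => u * f (u * y + v))).
      apply (ex_RInt_comp_lin (V := R_NormedModule) f u v 0 1).
      replace (u * 0 + v) with v by ring. replace (u * 1 + v) with (u + v) by ring. exact H. }
  assert (E' : RInt (fun y => u * f (u * y + v)) 0 1 = u * RInt (fun y => f (u * y + v)) 0 1)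
    by exact (RInt_scal (V := R_CompleteNormedModule) _ 0 1 u X).
  apply (Rmult_eq_reg_l u); [|exact Hu]. rewrite <- Rmult_assoc, Rinv_r, Rmult_1_l by exact Hu.
  exact (eq_trans (eq_sym E') E).
Qed.

Lemma cint_rev (g : R -> C) : cont01 g -> cint (fun t => g (1 - t)) = cint g.
Proof.
  intros Hg.
  assert (R : forall f : R -> R, ex_RInt f 0 1 ->
            RInt (fun t => f (1 - t)) 0 1 = RInt f 0 1).
  { intros f Hf.
    rewrite (RInt_ext _ (fun t => f (-1 * t + 1))) by (intros t _; f_equal; ring).
    rewrite RInt_lin; [|lra|].
    - replace (-1 + 1) with 0 by ring.
      assert (E : RInt f 1 0 = - RInt f 0 1)
        by exact (eq_sym (opp_RInt_swap (V := R_CompleteNormedModule) f 0 1 Hf)).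
      rewrite E. change (/ -1 * - RInt f 0 1 = RInt f 0 1). field.
    - replace (-1 + 1) with 0 by ring. now apply ex_RInt_swap. }
  unfold cint. f_equal.
  - apply (R (fun t => Re (g t))). apply cont01_Re; auto; lra.
  - apply (R (fun t => Im (g t))). apply cont01_Im; auto; lra.
Qed.

Lemma cint_split (g : R -> C) : cont01 g ->
  cint g = ((cint (fun t => g (t / 2)%R) + cint (fun t => g ((1 + t) / 2)%R)) / 2)%C.
Proof.
  intros Hg.
  assert (S : forall f : R -> R, ex_RInt f 0 (1/2) -> ex_RInt f (1/2) 1 ->
    RInt (fun t => f (t / 2)) 0 1 = 2 * RInt f 0 (1/2) /\
    RInt (fun t => f ((1 + t) / 2)) 0 1 = 2 * RInt f (1/2) 1 /\
    RInt f 0 1 = RInt f 0 (1/2) + RInt f (1/2) 1).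
  { intros f H1 H2. split; [|split].
    - rewrite (RInt_ext _ (fun t => f (1/2 * t + 0))) by (intros t _; f_equal; lra).
      rewrite RInt_lin; [|lra|]; replace (1/2 + 0) with (1/2) by ring.
      + f_equal. field.
      + exact H1.
    - rewrite (RInt_ext _ (fun t => f (1/2 * t + 1/2))) by (intros t _; f_equal; lra).
      rewrite RInt_lin; [|lra|]; replace (1/2 + 1/2) with 1 by field.
      + f_equal. field.
      + exact H2.
    - symmetry. apply (RInt_Chasles (V := R_CompleteNormedModule) f 0 (1/2) 1 H1 H2). }
  destruct (S (fun t => Re (g t))) as [A1 [A2 A3]]; try (apply cont01_Re; auto; lra).
  destruct (S (fun t => Im (g t))) as [B1 [B2 B3]]; try (apply cont01_Im; auto; lra).
  unfold cint. cbv beta in *. rewrite A1, A2, A3, B1, B2, B3.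
  unfold Cdiv, Cinv, Cmult, Cplus; simpl. f_equal; field.
Qed.

Lemma cont01_line (a b : C) (t : R) : continuous (fun t : R => a + t * b)%C t.
Proof.
  apply (continuous_ext (fun t => (fst a + t * fst b, snd a + t * snd b) : C)).
  { intros x. unfold Cplus, Cmult, RtoC; simpl. f_equal; ring. }
  apply continuous_pair.
  - apply (continuous_plus (V := R_NormedModule) (fun _ => fst a) (fun t => t * fst b)).
    apply continuous_const.
    apply (continuous_mult (K := R_AbsRing)). apply continuous_id. apply continuous_const.
  - apply (continuous_plus (V := R_NormedModule) (fun _ => snd a) (fun t => t * snd b)).
    apply continuous_const.
    apply (continuous_mult (K := R_AbsRing)). apply continuous_id. apply continuous_const.
Qed.

Lemma cint_affine (a b : C) : cint (fun t => a + t * b)%C = (a + b / 2)%C.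
Proof.
  assert (A : forall x y : R, RInt (fun t => x + t * y) 0 1 = x + y / 2).
  { intros x y. apply is_RInt_unique.
    replace (x + y / 2) with (minus (x * 1 + 1 ^ 2 / 2 * y) (x * 0 + 0 ^ 2 / 2 * y))
      by (unfold minus, plus, opp; simpl; field).
    apply (is_RInt_derive (fun t => x * t + t ^ 2 / 2 * y)).
    - intros t _. auto_derive; [exact I | field].
    - intros t _. apply (continuous_plus (V := R_NormedModule)). apply continuous_const.
      apply (continuous_mult (K := R_AbsRing)). apply continuous_id. apply continuous_const. }
  unfold cint. rewrite (RInt_ext _ (fun t => fst a + t * fst b)).
  2:{ intros t _. unfold Re, Cplus, Cmult, RtoC; simpl. ring. }
  rewrite (RInt_ext (fun t => Im _) (fun t => snd a + t * snd b)).
  2:{ intros t _. unfold Im, Cplus, Cmult, RtoC; simpl. ring. }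
  rewrite !A. unfold Cdiv, Cinv, Cmult, Cplus; simpl. f_equal; field.
Qed.

Definition seg_int (f : C -> C) (a b : C) : C :=
  ((b - a) * cint (fun t => f (a + t * (b - a))%C))%C.

Definition contseg (f : C -> C) (a b : C) : Prop :=
  forall t, 0 <= t <= 1 -> continuous f (a + RtoC t * (b - a))%C.

Lemma contseg_cont01 (f : C -> C) (a b : C) : contseg f a b ->
  cont01 (fun t => f (a + t * (b - a))%C).
Proof.
  intros H t Ht. apply (continuous_comp (fun t : R => a + t * (b - a))%C f).
  apply cont01_line. apply H, Ht.
Qed.

Lemma seg_int_plus (f g : C -> C) (a b : C) : contseg f a b -> contseg g a b ->
  seg_int (fun z => f z + g z)%C a b = (seg_int f a b + seg_int g a b)%C.
Proof.
  intros Hf Hg. unfold seg_int. rewrite cint_plus by now apply contseg_cont01. ring.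
Qed.

Lemma seg_int_scal (c : C) (f : C -> C) (a b : C) : contseg f a b ->
  seg_int (fun z => c * f z)%C a b = (c * seg_int f a b)%C.
Proof.
  intros Hf. unfold seg_int. rewrite cint_scal by now apply contseg_cont01. ring.
Qed.

Lemma seg_int_ext (f g : C -> C) (a b : C) :
  (forall t, 0 <= t <= 1 -> f (a + RtoC t * (b - a))%C = g (a + RtoC t * (b - a))%C) ->
  seg_int f a b = seg_int g a b.
Proof. intros H. unfold seg_int. f_equal. now apply cint_ext. Qed.

Lemma seg_int_bound (f : C -> C) (a b : C) (M : R) : contseg f a b ->
  (forall t, 0 <= t <= 1 -> Cmod (f (a + RtoC t * (b - a))%C) <= M) ->
  Cmod (seg_int f a b) <= 2 * M * Cmod (b - a).
Proof.
  intros Hf HM. unfold seg_int. rewrite Cmod_mult, Rmult_comm.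
  apply Rmult_le_compat_r. apply Cmod_ge_0.
  apply cint_bound. now apply contseg_cont01. exact HM.
Qed.

Lemma seg_int_swap (f : C -> C) (a b : C) : contseg f a b -> seg_int f b a = (- seg_int f a b)%C.
Proof.
  intros Hf. unfold seg_int. rewrite <- (cint_rev (fun t => f (a + t * (b - a))%C)).
  2: now apply contseg_cont01.
  rewrite (cint_ext (fun t => f (b + t * (a - b))%C) (fun t => f (a + RtoC (1 - t) * (b - a))%C)).
  - ring.
  - intros t _. f_equal. rewrite RtoC_minus. ring.
Qed.

Definition mid (a b : C) : C := ((a + b) / 2)%C.

Lemma seg_int_mid (f : C -> C) (a b : C) : contseg f a b ->
  seg_int f a b = (seg_int f a (mid a b) + seg_int f (mid a b) b)%C.
Proof.
  intros Hf. unfold seg_int. rewrite (cint_split (fun t => f (a + t * (b - a))%C)).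
  2: now apply contseg_cont01.
  rewrite (cint_ext (fun t => f (a + RtoC (t / 2) * (b - a))%C)
                  (fun t => f (a + t * (mid a b - a))%C)).
  2:{ intros t _. f_equal. rewrite RtoC_div by lra. unfold mid. field. }
  rewrite (cint_ext (fun t => f (a + RtoC ((1 + t) / 2) * (b - a))%C)
                  (fun t => f (mid a b + t * (b - mid a b))%C)).
  2:{ intros t _. f_equal. rewrite RtoC_div, RtoC_plus by lra. unfold mid. field. }
  unfold mid. field.
Qed.

Lemma seg_int_affine (p q a b : C) :
  seg_int (fun z => p + q * z)%C a b = (p * (b - a) + q * (b * b - a * a) / 2)%C.
Proof.
  unfold seg_int. rewrite (cint_ext _ (fun t => (p + q * a) + t * (q * (b - a)))%C).
  2:{ intros t _. ring. }
  rewrite cint_affine. field.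
Qed.

(** * Goursat's lemma for triangles *)

Definition tri_int (f : C -> C) (a b c : C) : C := (seg_int f a b + seg_int f b c + seg_int f c a)%C.

Definition convexC (P : C -> Prop) : Prop := forall a b t,
  P a -> P b -> 0 <= t <= 1 -> P (a + RtoC t * (b - a))%C.

(** Closedness through approximating points, the form in which limits of nested triangles and
    accumulation arguments deliver it. *)
Definition closedC (P : C -> Prop) : Prop := forall z,
  (forall eps, 0 < eps -> exists y, P y /\ Cmod (y - z) < eps) -> P z.

Lemma mid_convex (P : C -> Prop) (a b : C) : convexC P -> P a -> P b -> P (mid a b).
Proof.
  intros HP Ha Hb. replace (mid a b) with (a + RtoC (/ 2) * (b - a))%C.
  apply HP; auto; lra. rewrite RtoC_inv. unfold mid. field. lra.
Qed.

(** Each side is cut at its midpoint, and the sides of the inner triangle are run through in both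
    directions, so they cancel. *)
Lemma tri_int_split (f : C -> C) (a b c : C) (P : C -> Prop) :
  convexC P -> (forall z, P z -> continuous f z) -> P a -> P b -> P c ->
  tri_int f a b c = (tri_int f a (mid a b) (mid c a) + tri_int f (mid a b) b (mid b c) +
                 tri_int f (mid c a) (mid b c) c + tri_int f (mid a b) (mid b c) (mid c a))%C.
Proof.
  intros HP Hf Ha Hb Hc.
  assert (Hs : forall x y, P x -> P y -> contseg f x y).
  { intros x y Hx Hy t Ht. apply Hf, HP; assumption. }
  assert (M1 := mid_convex P a b HP Ha Hb). assert (M2 := mid_convex P b c HP Hb Hc).
  assert (M3 := mid_convex P c a HP Hc Ha).
  unfold tri_int.
  rewrite (seg_int_mid f a b), (seg_int_mid f b c), (seg_int_mid f c a) by auto.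
  rewrite (seg_int_swap f (mid a b) (mid c a)), (seg_int_swap f (mid a b) (mid b c)),
    (seg_int_swap f (mid b c) (mid c a)) by auto.
  rewrite (seg_int_swap f (mid c a) (mid a b)) by auto.
  ring.
Qed.

Record triangle := Tri { ta : C; tb : C; tc : C }.

Definition triangle_int (f : C -> C) (T : triangle) : C := tri_int f (ta T) (tb T) (tc T).

Definition subtriangles (T : triangle) : list triangle :=
  let '(Tri a b c) := T in
  (Tri a (mid a b) (mid c a) :: Tri (mid a b) b (mid b c) ::
   Tri (mid c a) (mid b c) c :: Tri (mid a b) (mid b c) (mid c a) :: nil)%list.

(** The first subtriangle carrying at least a quarter of the integral. Picking it by a decision on
    reals makes the sequence of nested triangles an iteration. *)
Definition heavy_subtriangle (f : C -> C) (T : triangle) : triangle :=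
  match List.find (fun T' => if Rle_dec (Cmod (triangle_int f T) / 4) (Cmod (triangle_int f T')) then true else false)
    (subtriangles T) with Some T' => T' | None => T end.

Definition vertices_in (P : C -> Prop) (T : triangle) : Prop := P (ta T) /\ P (tb T) /\ P (tc T).

Definition sides_le (T : triangle) (d : R) : Prop :=
  Cmod (tb T - ta T) <= d /\ Cmod (tc T - tb T) <= d /\ Cmod (ta T - tc T) <= d.

Lemma Cmod_half (z : C) : Cmod (z / 2) = Cmod z / 2.
Proof.
  rewrite Cmod_div by (intros H; apply RtoC_inj in H; lra).
  rewrite Cmod_R, Rabs_pos_eq by lra. reflexivity.
Qed.

Lemma subtriangles_small (T T' : triangle) (P : C -> Prop) (d : R) :
  convexC P -> List.In T' (subtriangles T) -> vertices_in P T -> sides_le T d ->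
  vertices_in P T' /\ sides_le T' (d / 2) /\ Cmod (ta T' - ta T) <= d.
Proof.
  intros HP Hin [Pa [Pb Pc]] [D1 [D2 D3]]. destruct T as [a b c]; simpl in *.
  assert (M1 := mid_convex P a b HP Pa Pb). assert (M2 := mid_convex P b c HP Pb Pc).
  assert (M3 := mid_convex P c a HP Pc Pa).
  assert (Q1 : Cmod ((b - a) / 2) <= d / 2) by (rewrite Cmod_half; lra).
  assert (Q2 : Cmod ((c - b) / 2) <= d / 2) by (rewrite Cmod_half; lra).
  assert (Q3 : Cmod ((a - c) / 2) <= d / 2) by (rewrite Cmod_half; lra).
  assert (Hd : 0 <= d) by (generalize (Cmod_ge_0 (b - a)); lra).
  assert (N : forall z w, Cmod z <= d / 2 -> w = z \/ w = (- z)%C -> Cmod w <= d / 2).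
  { intros z w Hz [-> | ->]; [|rewrite Cmod_opp]; exact Hz. }
  assert (N0 : Cmod (a - a) <= d).
  { replace (a - a)%C with (RtoC 0) by ring. rewrite Cmod_0. exact Hd. }
  assert (N1 : Cmod (mid a b - a) <= d).
  { replace (mid a b - a)%C with ((b - a) / 2)%C by (unfold mid; field). lra. }
  assert (N2 : Cmod (mid c a - a) <= d).
  { replace (mid c a - a)%C with (- ((a - c) / 2))%C by (unfold mid; field).
    rewrite Cmod_opp. lra. }
  unfold vertices_in, sides_le.
  destruct Hin as [<- | [<- | [<- | [<- | []]]]]; simpl; (split; [tauto|]); (split; [|assumption]);
  repeat split; first
  [ apply (N _ _ Q1); left; unfold mid; field
  | apply (N _ _ Q1); right; unfold mid; field
  | apply (N _ _ Q2); left; unfold mid; field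
  | apply (N _ _ Q2); right; unfold mid; field
  | apply (N _ _ Q3); left; unfold mid; field
  | apply (N _ _ Q3); right; unfold mid; field ].
Qed.

(** If all four pieces carried less than a quarter, their sum would fall short of the whole. *)
Lemma heavy_subtriangle_ge (f : C -> C) (P : C -> Prop) (T : triangle) :
  convexC P -> (forall z, P z -> continuous f z) -> vertices_in P T ->
  List.In (heavy_subtriangle f T) (subtriangles T) /\ Cmod (triangle_int f T) / 4 <= Cmod (triangle_int f (heavy_subtriangle f T)).
Proof.
  intros HP Hf [Pa [Pb Pc]]. unfold heavy_subtriangle.
  destruct (List.find _ _) as [T'|] eqn:E.
  - apply List.find_some in E. destruct E as [E1 E2]. split; [exact E1|].
    destruct (Rle_dec _ _); [assumption|discriminate].
  - exfalso.
    assert (H : forall T', List.In T' (subtriangles T) -> Cmod (triangle_int f T') < Cmod (triangle_int f T) / 4).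
    { intros T' HT'. generalize (List.find_none _ _ E T' HT').
      destruct (Rle_dec _ _); [discriminate|lra]. }
    destruct T as [a b c]; simpl in *. unfold triangle_int in H; simpl in *.
    assert (S := tri_int_split f a b c P HP Hf Pa Pb Pc).
    assert (H1 := H _ (or_introl eq_refl)).
    assert (H2 := H _ (or_intror (or_introl eq_refl))).
    assert (H3 := H _ (or_intror (or_intror (or_introl eq_refl)))).
    assert (H4 := H _ (or_intror (or_intror (or_intror (or_introl eq_refl))))).
    simpl in *.
    set (x1 := tri_int f a (mid a b) (mid c a)) in *. set (x2 := tri_int f (mid a b) b (mid b c)) in *.
    set (x3 := tri_int f (mid c a) (mid b c) c) in *. set (x4 := tri_int f (mid a b) (mid b c) (mid c a)) in *.
    assert (K1 := Cmod_triangle (x1 + x2 + x3) x4).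
    assert (K2 := Cmod_triangle (x1 + x2) x3).
    assert (K3 := Cmod_triangle x1 x2). rewrite <- S in K1. lra.
Qed.

Lemma small_half_pow (D e : R) : 0 <= D -> 0 < e -> exists n, D / 2 ^ n < e.
Proof.
  intros HD He. destruct (pow_lt_1_zero (/ 2)) with (y := e / (D + 1)) as [N HN].
  - rewrite Rabs_pos_eq; lra.
  - apply Rdiv_lt_0_compat; lra.
  - exists N. specialize (HN N (le_n N)).
    rewrite Rabs_pos_eq, pow_inv in HN by (apply pow_le; lra).
    assert (P : 0 < / 2 ^ N) by (apply Rinv_0_lt_compat, pow_lt; lra).
    apply Rle_lt_trans with ((D + 1) * / 2 ^ N).
    + unfold Rdiv. apply Rmult_le_compat_r; lra.
    + apply Rlt_le_trans with ((D + 1) * (e / (D + 1))).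
      apply Rmult_lt_compat_l; [lra | exact HN]. right. field. lra.
Qed.

Lemma dyadic_cauchy_limit (u : nat -> R) (D : R) :
  (forall n, Rabs (u (S n) - u n) <= D / 2 ^ n) ->
  exists l, forall n, Rabs (u n - l) <= 2 * D / 2 ^ n.
Proof.
  intros H.
  assert (HD : 0 <= D).
  { generalize (H O) (Rabs_pos (u 1%nat - u O)). simpl. lra. }
  assert (P2 : forall n, 0 < 2 ^ n) by (intros n; apply pow_lt; lra).
  assert (A : forall n k, Rabs (u (n + k)%nat - u n) <= 2 * D / 2 ^ n * (1 - / 2 ^ k)).
  { intros n. induction k as [|k IH].
    - rewrite Nat.add_0_r. replace (u n - u n) with 0 by ring. rewrite Rabs_R0. simpl. right. field.
      apply Rgt_not_eq, P2.
    - replace (n + S k)%nat with (S (n + k)) by lia.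
      replace (u (S (n + k)) - u n) with ((u (S (n + k)) - u (n + k)%nat) + (u (n + k)%nat - u n)) by ring.
      apply Rle_trans with (1 := Rabs_triang _ _).
      apply Rle_trans with (D / 2 ^ (n + k) + 2 * D / 2 ^ n * (1 - / 2 ^ k)).
      + apply Rplus_le_compat. apply H. exact IH.
      + right. rewrite pow_add. simpl. field. split; apply Rgt_not_eq, P2. }
  assert (A' : forall n m, (n <= m)%nat -> Rabs (u m - u n) <= 2 * D / 2 ^ n).
  { intros n m Hnm. replace m with (n + (m - n))%nat by lia.
    apply Rle_trans with (1 := A n _).
    rewrite <- (Rmult_1_r (2 * D / 2 ^ n)) at 2. apply Rmult_le_compat_l.
    - apply Rmult_le_pos; [lra|]. left. apply Rinv_0_lt_compat, P2.
    - assert (0 < / 2 ^ (m - n)) by apply Rinv_0_lt_compat, P2. lra. }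
  assert (Hc : ex_finite_lim_seq u).
  { apply ex_lim_seq_cauchy_corr. intros eps.
    destruct (small_half_pow (4 * D) eps ltac:(lra) (cond_pos eps)) as [N HN]. exists N. intros n m Hn Hm.
    replace (u n - u m) with ((u n - u N) - (u m - u N)) by ring.
    apply Rle_lt_trans with (1 := Rabs_triang _ _). rewrite Rabs_Ropp.
    generalize (A' N n Hn) (A' N m Hm). replace (4 * D / 2 ^ N) with (2 * D / 2 ^ N + 2 * D / 2 ^ N) in HN.
    lra. field. apply Rgt_not_eq, P2. }
  destruct Hc as [l Hl]. exists l. intros n.
  apply Rnot_lt_le. intros Hlt.
  apply is_lim_seq_spec in Hl.
  destruct (Hl (mkposreal (Rabs (u n - l) - 2 * D / 2 ^ n) ltac:(lra))) as [N HN]. simpl in HN.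
  specialize (HN (max n N) (Nat.le_max_r _ _)).
  specialize (A' n (max n N) (Nat.le_max_l _ _)).
  replace (u n - l) with (- (u (max n N) - u n) + (u (max n N) - l)) in HN by ring.
  generalize (Rabs_triang (- (u (max n N) - u n)) (u (max n N) - l)). rewrite Rabs_Ropp. lra.
Qed.

(** A nonzero integral m over the triangle propagates to nested triangles shrinking to a point p
    of P, of size D / 2^n and with integrals at least m / 4^n. At p the function is affine up to
    an error eps |z - p|; affine functions integrate to zero over closed polygons, and the error
    contributes at most a multiple of eps D^2 / 4^n. Hence m is at most a fixed multiple of eps
    D^2, for every eps. *)
Lemma goursat (P : C -> Prop) (f f' : C -> C) (a b c : C) :
  convexC P -> closedC P -> (forall z, P z -> cderiv f z (f' z)) ->
  P a -> P b -> P c -> tri_int f a b c = 0.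
Proof.
  intros HP HC Hf Pa Pb Pc.
  assert (Hcont : forall z, P z -> continuous f z).
  { intros z Hz. exact (cderiv_continuous _ _ _ (Hf z Hz)). }
  set (T0 := Tri a b c).
  set (D := Cmod (b - a) + Cmod (c - b) + Cmod (a - c)).
  assert (G1 := Cmod_ge_0 (b - a)). assert (G2 := Cmod_ge_0 (c - b)). assert (G3 := Cmod_ge_0 (a - c)).
  assert (HD : 0 <= D) by (unfold D; lra).
  set (T := fun n => Nat.iter n (heavy_subtriangle f) T0).
  assert (P2 : forall n, 0 < 2 ^ n) by (intros n; apply pow_lt; lra).
  assert (P4 : forall n, 0 < 4 ^ n) by (intros n; apply pow_lt; lra).
  set (m := Cmod (tri_int f a b c)).
  assert (I : forall n, vertices_in P (T n) /\ sides_le (T n) (D / 2 ^ n) /\ m / 4 ^ n <= Cmod (triangle_int f (T n))).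
  { induction n as [|n [I1 [I2 I3]]].
    - simpl. unfold vertices_in, sides_le, triangle_int, m; simpl. rewrite !Rdiv_1_r. unfold D.
      repeat split; try assumption; lra.
    - destruct (heavy_subtriangle_ge f P (T n) HP Hcont I1) as [S1 S2].
      destruct (subtriangles_small _ _ P _ HP S1 I1 I2) as [S3 [S4 S5]].
      change (T (S n)) with (heavy_subtriangle f (T n)). split; [exact S3|]. split.
      + replace (D / 2 ^ S n) with (D / 2 ^ n / 2); [exact S4|].
        simpl. field. apply Rgt_not_eq, P2.
      + apply Rle_trans with (2 := S2). replace (m / 4 ^ S n) with (m / 4 ^ n / 4). lra.
        simpl. field. apply Rgt_not_eq, P4. }
  assert (J : forall n, Cmod (ta (T (S n)) - ta (T n)) <= D / 2 ^ n).
  { intros n. destruct (I n) as [I1 [I2 I3]].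
    destruct (heavy_subtriangle_ge f P (T n) HP Hcont I1) as [S1 S2].
    exact (proj2 (proj2 (subtriangles_small _ _ P _ HP S1 I1 I2))). }
  destruct (dyadic_cauchy_limit (fun n => Re (ta (T n))) D) as [x Hx].
  { intros n. apply Rle_trans with (2 := J n).
    apply Rle_trans with (2 := re_le_Cmod _). right. reflexivity. }
  destruct (dyadic_cauchy_limit (fun n => Im (ta (T n))) D) as [y Hy].
  { intros n. apply Rle_trans with (2 := J n).
    apply Rle_trans with (2 := im_le_Cmod _). right. reflexivity. }
  set (p := (x, y) : C).
  assert (Hp : forall n, Cmod (ta (T n) - p) <= 4 * D / 2 ^ n).
  { intros n. apply Rle_trans with (1 := Cmod_le_sum _).
    specialize (Hx n). specialize (Hy n).
    replace (4 * D / 2 ^ n) with (2 * D / 2 ^ n + 2 * D / 2 ^ n) by (field; apply Rgt_not_eq, P2).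
    apply Rplus_le_compat; [exact Hx | exact Hy]. }
  assert (Hsmall : forall e, 0 < e -> exists n, 5 * D / 2 ^ n < e).
  { intros e He. apply small_half_pow; lra. }
  assert (Pp : P p).
  { apply HC. intros e He. destruct (Hsmall e He) as [n Hn]. exists (ta (T n)).
    split. apply (I n). apply Rle_lt_trans with (1 := Hp n). apply Rle_lt_trans with (2 := Hn).
    unfold Rdiv. apply Rmult_le_compat_r. left. apply Rinv_0_lt_compat, P2. lra. }
  assert (Key : forall eps, 0 < eps -> m <= 30 * D * D * eps).
  { intros eps He. destruct (Hf p Pp eps He) as [d [Hd1 Hd2]].
    destruct (Hsmall d Hd1) as [n Hn]. destruct (I n) as [[Qa [Qb Qc]] [[D1 [D2 D3]] I3]].
    specialize (Hp n). unfold triangle_int in I3.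
    set (a' := ta (T n)) in *. set (b' := tb (T n)) in *. set (c' := tc (T n)) in *.
    set (dn := D / 2 ^ n) in *.
    assert (Hdn : 0 <= dn) by (unfold dn; apply Rmult_le_pos; [lra|]; left; apply Rinv_0_lt_compat, P2).
    replace (4 * D / 2 ^ n) with (4 * dn) in Hp by (unfold dn; field; apply Rgt_not_eq, P2).
    replace (5 * D / 2 ^ n) with (5 * dn) in Hn by (unfold dn; field; apply Rgt_not_eq, P2).
    set (r := fun z => (f z - (f p - f' p * p + f' p * z))%C).
    set (af := fun z => (f p - f' p * p + f' p * z)%C).
    assert (Caf : forall z, continuous af z).
    { intros z. apply (cderiv_continuous _ _ (0 + (0 * z + f' p * 1))%C). unfold af.
      apply (cderiv_plus (fun _ => (f p - f' p * p)%C)). apply cderiv_const.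
      apply (cderiv_mult (fun _ => f' p)). apply cderiv_const. apply cderiv_id. }
    assert (Cr : forall z, P z -> continuous r z).
    { intros z Hz. apply (cderiv_continuous _ _ (f' z + (-1) * (0 + (0 * z + f' p * 1)))%C).
      apply (cderiv_ext _ (fun z => f z + (-1) * af z)%C z _ 1 Rlt_0_1).
      { intros h _. unfold r, af. ring. }
      apply cderiv_plus; [now apply Hf|].
      replace (-1 * (0 + (0 * z + f' p * 1)))%C with (0 * af z + (-1) * (0 + (0 * z + f' p * 1)))%C by ring.
      apply (cderiv_mult (fun _ => RtoC (-1))). apply cderiv_const. unfold af.
      apply (cderiv_plus (fun _ => (f p - f' p * p)%C)). apply cderiv_const.
      apply (cderiv_mult (fun _ => f' p)). apply cderiv_const. apply cderiv_id. }
    (* the first vertex is within 4 dn of p, and the sides have length at most dn *)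
    assert (B : forall z, Cmod (z - p) <= 5 * dn -> Cmod (r z) <= eps * (5 * dn)).
    { intros z Hz. specialize (Hd2 (z - p)%C (Rle_lt_trans _ _ _ Hz Hn)).
      rewrite Rabs_pos_eq in Hd2 by apply Cmod_ge_0. simpl in Hd2.
      replace (r z) with (f (p + (z - p))%C - f p - f' p * (z - p))%C.
      2:{ unfold r. replace (p + (z - p))%C with z by ring. ring. }
      apply Rle_trans with (1 := Hd2). rewrite Rmult_1_r. apply Rmult_le_compat_l; lra. }
    assert (Bs : forall u v, P u -> P v -> Cmod (u - p) <= 5 * dn -> Cmod (v - p) <= 5 * dn ->
      Cmod (v - u) <= dn -> Cmod (seg_int r u v) <= 2 * (eps * (5 * dn)) * dn).
    { intros u v Pu Pv Hu Hv Huv.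
      apply Rle_trans with (2 * (eps * (5 * dn)) * Cmod (v - u)).
      2:{ apply Rmult_le_compat_l; [|exact Huv].
          assert (0 <= eps * (5 * dn)) by (apply Rmult_le_pos; lra). lra. }
      apply seg_int_bound.
      - intros t Ht. apply Cr, HP; assumption.
      - intros t Ht. apply B.
        now apply Cmod_convex. }
    assert (Ka : Cmod (a' - p) <= 5 * dn) by lra.
    assert (Kb : Cmod (b' - p) <= 5 * dn).
    { replace (b' - p)%C with ((b' - a') + (a' - p))%C by ring.
      apply Rle_trans with (1 := Cmod_triangle _ _). lra. }
    assert (Kc : Cmod (c' - p) <= 5 * dn).
    { replace (c' - p)%C with (- (a' - c') + (a' - p))%C by ring.
      apply Rle_trans with (1 := Cmod_triangle _ _). rewrite Cmod_opp. lra. }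
    assert (E : tri_int f a' b' c' = tri_int r a' b' c').
    { assert (Es : forall u v, P u -> P v -> seg_int f u v = (seg_int r u v + seg_int af u v)%C).
      { intros u v Pu Pv. rewrite <- seg_int_plus.
        - apply seg_int_ext. intros t _. unfold r, af. ring.
        - intros t Ht. apply Cr, HP; assumption.
        - intros t Ht. apply Caf. }
      unfold tri_int. rewrite !Es by assumption. unfold af at 1 2 3. rewrite !seg_int_affine. field. }
    rewrite E in I3.
    assert (L : Cmod (tri_int r a' b' c') <= 3 * (2 * (eps * (5 * dn)) * dn)).
    { unfold tri_int. apply Rle_trans with (1 := Cmod_triangle _ _).
      generalize (Cmod_triangle (seg_int r a' b') (seg_int r b' c')).
      generalize (Bs a' b' Qa Qb Ka Kb D1) (Bs b' c' Qb Qc Kb Kc D2) (Bs c' a' Qc Qa Kc Ka D3). lra. }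
    assert (L2 : m / 4 ^ n <= 30 * D * D * eps / 4 ^ n).
    { apply Rle_trans with (1 := I3). apply Rle_trans with (1 := L). right.
      unfold dn. replace 4 with (2 * 2) by ring. rewrite Rpow_mult_distr. field. apply Rgt_not_eq, P2. }
    apply Rmult_le_reg_r with (/ 4 ^ n). apply Rinv_0_lt_compat, P4. exact L2. }
  apply (Cmod_eq_0_small _ (30 * D * D) 1); [lra|]. intros eps He. now apply Key.
Qed.

(** * Cauchy-type integrals depend differentiably on their parameter *)

Lemma cderiv_unique (f : C -> C) (z l m : C) : cderiv f z l -> cderiv f z m -> l = m.
Proof.
  intros Hl Hm. assert (E : (l - m)%C = 0).
  { apply (Cmod_eq_0_small _ 1 1); [lra|]. intros eps [He _].
    destruct (little_o_plus 1 _ _ Hl Hm eps He) as [d [Hd1 Hd2]].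
    set (h := RtoC (d / 2)). assert (Hc : Cmod h = d / 2) by (unfold h; rewrite Cmod_R, Rabs_pos_eq; lra).
    specialize (Hd2 h). rewrite Hc in Hd2. specialize (Hd2 ltac:(lra)).
    apply Rmult_le_reg_r with (Cmod h); [lra|]. rewrite <- Cmod_mult.
    replace ((l - m) * h)%C with ((f (z + h)%C - f z - m * h) - (f (z + h)%C - f z - l * h))%C by ring.
    apply Rle_trans with (1 := Cmod_sub_le _ _). rewrite Rmult_1_l, Hc, Rplus_comm. rewrite pow_1 in Hd2.
    exact (Rle_trans _ _ _ (Rle_abs _) Hd2). }
  replace l with (l - m + m)%C by ring. rewrite E. ring.
Qed.

Lemma contseg_bounded (g : C -> C) (a b : C) : contseg g a b ->
  exists M, 0 <= M /\ forall t, 0 <= t <= 1 -> Cmod (g (a + RtoC t * (b - a))%C) <= M.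
Proof.
  intros Hg.
  destruct (continuity_ab_maj (fun t => Cmod (g (a + RtoC t * (b - a))%C)) 0 1) as [x [Hx _]].
  - lra.
  - intros t Ht. apply continuity_pt_filterlim.
    apply (continuous_comp (fun t : R => g (a + RtoC t * (b - a))%C) Cmod t).
    + now apply contseg_cont01.
    + apply continuous_Cmod.
  - exists (Cmod (g (a + RtoC x * (b - a))%C)). split. apply Cmod_ge_0.
    intros t Ht. apply Hx. lra.
Qed.

Lemma continuous_Cplus (f g : C -> C) (z : C) :
  continuous f z -> continuous g z -> continuous (fun z => f z + g z)%C z.
Proof. apply (continuous_plus (V := C_NormedModule)). Qed.

Lemma continuous_Cmult (f g : C -> C) (z : C) :
  continuous f z -> continuous g z -> continuous (fun z => f z * g z)%C z.
Proof.
  intros Hf Hg.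
  apply (continuous_pair C_UniformSpace (fun z => Re (f z) * Re (g z) - Im (f z) * Im (g z))
           (fun z => Re (f z) * Im (g z) + Im (f z) * Re (g z))).
  - apply (continuous_minus (V := R_NormedModule) (fun z => Re (f z) * Re (g z))
      (fun z => Im (f z) * Im (g z))); apply (continuous_mult (K := R_AbsRing));
      apply continuous_Re || apply continuous_Im; assumption.
  - apply (continuous_plus (V := R_NormedModule) (fun z => Re (f z) * Im (g z))
      (fun z => Im (f z) * Re (g z))); apply (continuous_mult (K := R_AbsRing));
      apply continuous_Re || apply continuous_Im; assumption.
Qed.

(** Differentiation under the integral sign, for kernels whose first-order remainder in the
    parameter is uniformly quadratic along the segment. *)
Lemma seg_kernel (g : C -> C) (K K' : C -> C -> C) (a b w : C) (M d : R) :
  0 < d -> contseg g a b ->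
  (forall h, Cmod h < d -> contseg (fun z => K z (w + h)%C) a b) ->
  contseg (fun z => K' z w) a b ->
  (forall t h, 0 <= t <= 1 -> Cmod h < d ->
    let z := (a + RtoC t * (b - a))%C in
    Cmod (K z (w + h)%C - K z w - K' z w * h) <= M * Cmod h ^ 2) ->
  cderiv (fun w => seg_int (fun z => g z * K z w)%C a b) w (seg_int (fun z => g z * K' z w)%C a b).
Proof.
  intros Hd Hg HK HK' HB.
  destruct (contseg_bounded g a b Hg) as [N [HN1 HN2]].
  assert (HK0 : contseg (fun z => K z w) a b).
  { assert (X := HK (RtoC 0)). rewrite Cplus_0_r, Cmod_0 in X. exact (X Hd). }
  apply (little_o_bigO 1 _ (2 * (N * M) * Cmod (b - a)) d Hd).
  intros h Hh. rewrite Rabs_pos_eq by apply Cmod_ge_0.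
  assert (C1 : contseg (fun z => g z * K z (w + h))%C a b).
  { intros t Ht. apply continuous_Cmult. now apply Hg. now apply HK. }
  assert (C2 : contseg (fun z => g z * K z w)%C a b).
  { intros t Ht. apply continuous_Cmult. now apply Hg. now apply HK0. }
  assert (C3 : contseg (fun z => g z * K' z w)%C a b).
  { intros t Ht. apply continuous_Cmult. now apply Hg. now apply HK'. }
  assert (C2' : contseg (fun z => (-1) * (g z * K z w))%C a b).
  { intros t Ht. apply (continuous_Cmult (fun _ => RtoC (-1))). apply continuous_const. now apply C2. }
  assert (C3' : contseg (fun z => (- h) * (g z * K' z w))%C a b).
  { intros t Ht. apply (continuous_Cmult (fun _ => (- h)%C)). apply continuous_const. now apply C3. }
  assert (C12 : contseg (fun z => g z * K z (w + h) + (-1) * (g z * K z w))%C a b).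
  { intros t Ht. apply continuous_Cplus. now apply C1. now apply C2'. }
  replace (seg_int (fun z => g z * K z (w + h))%C a b - seg_int (fun z => g z * K z w)%C a b
     - seg_int (fun z => g z * K' z w)%C a b * h)%C
  with (seg_int (fun z => (g z * K z (w + h) + (-1) * (g z * K z w)) + (- h) * (g z * K' z w))%C a b).
  2:{ rewrite (seg_int_plus (fun z => g z * K z (w + h) + (-1) * (g z * K z w))%C) by assumption.
      rewrite seg_int_plus by assumption. rewrite !seg_int_scal by assumption. ring. }
  replace (2 * (N * M) * Cmod (b - a) * Cmod h ^ 2)
    with (2 * (N * (M * Cmod h ^ 2)) * Cmod (b - a)) by ring.
  apply seg_int_bound.
  - intros t Ht. apply continuous_Cplus. now apply C12. now apply C3'.
  - intros t Ht. specialize (HB t h Ht Hh). cbv zeta in HB. specialize (HN2 t Ht).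
    set (z := (a + RtoC t * (b - a))%C) in *.
    replace (g z * K z (w + h) + -1 * (g z * K z w) + - h * (g z * K' z w))%C
      with (g z * (K z (w + h)%C - K z w - K' z w * h))%C by ring.
    rewrite Cmod_mult. apply Rmult_le_compat; auto using Cmod_ge_0.
Qed.

Lemma cderiv_cauchy1 (w z : C) : (z - w)%C <> 0 ->
  cderiv (fun z => / (z - w))%C z (- RtoC 1 / ((z - w) * (z - w))).
Proof.
  intros H. apply (cderiv_inv (fun z => z - w)%C). 2: exact H.
  apply (cderiv_ext _ (fun z => z + - w)%C z _ 1 Rlt_0_1). reflexivity.
  replace (RtoC 1) with (1 + 0)%C by ring.
  apply cderiv_plus. apply cderiv_id. apply cderiv_const.
Qed.

Lemma contseg_cauchy (a b w h : C) (d : R) : 0 < d ->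
  (forall t, 0 <= t <= 1 -> d <= Cmod (a + RtoC t * (b - a) - w)) -> Cmod h < d ->
  contseg (fun z => / (z - (w + h)))%C a b.
Proof.
  intros Hd Hw Hh t Ht. specialize (Hw t Ht). set (z := (a + RtoC t * (b - a))%C) in *.
  refine (cderiv_continuous _ _ _ (cderiv_cauchy1 _ _ _)).
  intros E. generalize (Cmod_rev_triangle (z - w) (z - (w + h))).
  replace (z - w - (z - (w + h)))%C with h by ring. rewrite E, Cmod_0. lra.
Qed.

Lemma seg_kernel1 (g : C -> C) (a b w : C) (d : R) : 0 < d -> contseg g a b ->
  (forall t, 0 <= t <= 1 -> d <= Cmod (a + RtoC t * (b - a) - w)) ->
  cderiv (fun w => seg_int (fun z => g z * / (z - w))%C a b) w
         (seg_int (fun z => g z * (/ (z - w) * / (z - w)))%C a b).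
Proof.
  intros Hd Hg Hw.
  apply (seg_kernel g (fun z w => / (z - w))%C (fun z w => / (z - w) * / (z - w))%C
           a b w (2 / (d * d * d)) (d / 2)); try assumption; [lra| | |].
  - intros h Hh. apply (contseg_cauchy a b w h d Hd Hw). lra.
  - assert (Q := contseg_cauchy a b w 0 d Hd Hw). rewrite Cplus_0_r, Cmod_0 in Q. specialize (Q Hd).
    intros t Ht. apply continuous_Cmult; now apply Q.
  - intros t h Ht Hh z. specialize (Hw t Ht). fold z in Hw. set (x := (z - w)%C) in *.
    destruct (inv_bounds x h d Hd Hw ltac:(lra)) as (N & N2 & Q1 & Q2).
    replace (z - (w + h))%C with (x - h)%C by (unfold x; ring).
    replace (/ (x - h) - / x - / x * / x * h)%C with (h * h * (/ x * / x * / (x - h)))%C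
      by (field; split; assumption).
    rewrite !(Cmod_mult (_ * _)), !Cmod_mult.
    replace (2 / (d * d * d) * Cmod h ^ 2) with (Cmod h * Cmod h * (/ d * / d * (2 / d))) by (field; lra).
    apply Rmult_le_compat_l; [apply Rle_0_sqr|].
    repeat (apply Rmult_le_compat; auto using Cmod_ge_0, Rmult_le_pos).
Qed.

Lemma seg_kernel2 (g : C -> C) (a b w : C) (d : R) : 0 < d -> contseg g a b ->
  (forall t, 0 <= t <= 1 -> d <= Cmod (a + RtoC t * (b - a) - w)) ->
  cderiv (fun w => seg_int (fun z => g z * (/ (z - w) * / (z - w)))%C a b) w
         (seg_int (fun z => g z * (2 * (/ (z - w) * (/ (z - w) * / (z - w)))))%C a b).
Proof.
  intros Hd Hg Hw.
  apply (seg_kernel g (fun z w => / (z - w) * / (z - w))%C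
           (fun z w => 2 * (/ (z - w) * (/ (z - w) * / (z - w))))%C
           a b w (16 / (d * d * d * d)) (d / 2)); try assumption; [lra| | |].
  - intros h Hh t Ht. apply continuous_Cmult; apply (contseg_cauchy a b w h d Hd Hw); lra.
  - assert (Q := contseg_cauchy a b w 0 d Hd Hw). rewrite Cplus_0_r, Cmod_0 in Q. specialize (Q Hd).
    intros t Ht. apply (continuous_Cmult (fun _ => RtoC 2)). apply continuous_const.
    apply continuous_Cmult; [now apply Q|]. apply continuous_Cmult; now apply Q.
  - intros t h Ht Hh z. specialize (Hw t Ht). fold z in Hw. set (x := (z - w)%C) in *.
    destruct (inv_bounds x h d Hd Hw ltac:(lra)) as (N & N2 & Q1 & Q2).
    replace (z - (w + h))%C with (x - h)%C by (unfold x; ring).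
    replace (/ (x - h) * / (x - h) - / x * / x - 2 * (/ x * (/ x * / x)) * h)%C
      with (h * h * ((3 - 2 * h * / x) * (/ x * / x) * (/ (x - h) * / (x - h))))%C
      by (field; split; assumption).
    assert (HT : Cmod (3 - 2 * h * / x) <= 4).
    { apply Rle_trans with (1 := Cmod_sub_le _ _). rewrite !Cmod_mult, !Cmod_R, !Rabs_pos_eq by lra.
      assert (Cmod h * Cmod (/ x) <= d / 2 * / d) by (apply Rmult_le_compat; auto using Cmod_ge_0; lra).
      replace (d / 2 * / d) with (/ 2) in H by (field; lra). lra. }
    rewrite (Cmod_mult (h * h)), (Cmod_mult h), !(Cmod_mult (_ * _)), !Cmod_mult.
    replace (16 / (d * d * d * d) * Cmod h ^ 2)
      with (Cmod h * Cmod h * (4 * (/ d * / d) * (2 / d * (2 / d)))) by (field; lra).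
    apply Rmult_le_compat_l; [apply Rle_0_sqr|].
    repeat (apply Rmult_le_compat; auto using Cmod_ge_0, Rmult_le_pos).
Qed.

(** * Contour integrals over a square *)

Definition inner (u z : C) : R := Re u * Re z + Im u * Im z.

Lemma inner_comb (u a b : C) (t : R) :
  inner u (a + RtoC t * (b - a))%C = (1 - t) * inner u a + t * inner u b.
Proof. unfold inner, RtoC, Cplus, Cmult, Cminus, Copp, Re, Im; simpl. ring. Qed.

Lemma inner_minus (u a b : C) : inner u (a - b)%C = inner u a - inner u b.
Proof. unfold inner, Cplus, Cminus, Copp, Re, Im; simpl. ring. Qed.

Lemma inner_le (u z : C) : Cmod u = 1 -> Rabs (inner u z) <= Cmod z.
Proof.
  intros Hu. assert (H := Cmod2_alt u). rewrite Hu in H. assert (H' := Cmod2_alt z).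
  apply Rsqr_incr_0_var; [|apply Cmod_ge_0]. rewrite <- Rsqr_abs. unfold Rsqr, inner.
  replace (Cmod z * Cmod z) with (Cmod z ^ 2) by ring. rewrite H'.
  assert (0 <= (Re u * Im z - Im u * Re z) ^ 2) by apply pow2_ge_0.
  nra.
Qed.

(** A disk cut by a half-plane with inner normal u. For a unit vector u and s > 0 it is convex,
    closed and avoids w: this is where Goursat's lemma is applied to functions singular at w. *)
Definition half_disk (z0 w u : C) (r s : R) (z : C) : Prop :=
  Cmod (z - z0) <= r /\ s <= inner u (z - w)%C.

Lemma half_disk_convex (z0 w u : C) (r s : R) : convexC (half_disk z0 w u r s).
Proof.
  intros a b t [Ha1 Ha2] [Hb1 Hb2] Ht. split.
  - now apply Cmod_convex.
  - rewrite inner_minus in *. rewrite inner_comb. nra.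
Qed.

Lemma half_disk_closed (z0 w u : C) (r s : R) : Cmod u = 1 -> closedC (half_disk z0 w u r s).
Proof.
  intros Hu z H. split; apply Rnot_lt_le; intros Hlt.
  - destruct (H (Cmod (z - z0) - r)) as [y [[Hy1 Hy2] Hy3]]; [lra|].
    generalize (Cmod_rev_triangle (z - z0) (y - z0)).
    replace (z - z0 - (y - z0))%C with (z - y)%C by ring. rewrite (Cmod_sub_sym z y). lra.
  - destruct (H (s - inner u (z - w)%C)) as [y [[Hy1 Hy2] Hy3]]; [lra|].
    assert (X := inner_le u (y - z)%C Hu). rewrite inner_minus in *.
    generalize (Rle_abs (inner u y - inner u z)). lra.
Qed.

(** For u running through 1, i, -1, -i these are the vertices of the square with centre z0 and
    half side rho; the side from u to i u is the one with outer normal u. *)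
Definition corner (z0 : C) (rho : R) (u : C) : C := (z0 + RtoC rho * u * (1 - Ci))%C.

Lemma Cmod_1mi : Cmod (1 - Ci) <= 2.
Proof.
  apply Rle_trans with (1 := Cmod_sub_le _ _). rewrite Cmod_1, Cmod_Ci. lra.
Qed.

Lemma corner_dist (z0 u : C) (rho : R) : 0 < rho -> Cmod u = 1 ->
  Cmod (corner z0 rho u - z0) <= 2 * rho.
Proof.
  intros Hr Hu. unfold corner.
  replace (z0 + rho * u * (1 - Ci) - z0)%C with (rho * u * (1 - Ci))%C by ring.
  rewrite !Cmod_mult, Cmod_R, Hu, Rabs_pos_eq by lra. generalize Cmod_1mi. nra.
Qed.

Lemma inner_corner (z0 u : C) (rho : R) : Cmod u = 1 ->
  inner u (corner z0 rho u - z0)%C = rho /\ inner u (corner z0 rho (Ci * u) - z0)%C = rho.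
Proof.
  intros Hu. assert (H := Cmod2_alt u). rewrite Hu in H. unfold Re, Im in H.
  unfold corner, inner, RtoC, Ci, Cplus, Cmult, Cminus, Copp, Re, Im; simpl. split.
  - transitivity (rho * (fst u ^ 2 + snd u ^ 2)). ring. rewrite <- H. ring.
  - transitivity (rho * (fst u ^ 2 + snd u ^ 2)). ring. rewrite <- H. ring.
Qed.

Lemma Cmod_Ciu (u : C) : Cmod u = 1 -> Cmod (Ci * u) = 1.
Proof. intros H. rewrite Cmod_mult, Cmod_Ci, H. ring. Qed.

(** Between a side of the square and its image under the homothety with centre w and ratio t lies
    a quadrilateral, made of two triangles, that a half-plane separates from w. By Goursat's lemma
    its boundary integral vanishes. *)
Lemma square_side_shift (h h' : C -> C) (z0 w u : C) (rho t : R) :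
  0 < rho -> Cmod u = 1 -> Cmod (w - z0) <= rho / 2 -> 0 < t <= 1 ->
  (forall z, Cmod (z - z0) <= 2 * rho -> z <> w -> cderiv h z (h' z)) ->
  let A := corner z0 rho in
  let S := fun v => (w + RtoC t * (A v - w))%C in
  (seg_int h (A u) (A (Ci * u)) + seg_int h (A (Ci * u)) (S (Ci * u)) =
   seg_int h (S u) (S (Ci * u)) + seg_int h (A u) (S u))%C.
Proof.
  intros Hr Hu Hw Ht Hh A S.
  set (P := half_disk z0 w u (2 * rho) (t * (rho / 2))).
  assert (HP : convexC P) by apply half_disk_convex.
  assert (HC : closedC P) by now apply half_disk_closed.
  assert (Hd : forall z, P z -> cderiv h z (h' z)).
  { intros z [Hz1 Hz2]. apply Hh. exact Hz1. intros ->.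
    replace (w - w)%C with (RtoC 0) in Hz2 by ring. unfold inner, RtoC, Re, Im in Hz2; simpl in Hz2.
    assert (0 < t * (rho / 2)) by (apply Rmult_lt_0_compat; lra). lra. }
  assert (Hcont : forall z, P z -> continuous h z).
  { intros z Hz. exact (cderiv_continuous _ _ _ (Hd z Hz)). }
  assert (Hs : forall x y, P x -> P y -> contseg h x y).
  { intros x y Hx Hy s Hs. apply Hcont, HP; assumption. }
  assert (Q : forall v, Cmod v = 1 -> inner u (A v - z0)%C = rho -> P (A v) /\ P (S v)).
  { intros v Hv Hip.
    assert (X := inner_le u (w - z0)%C Hu). assert (Y := Rle_abs (inner u (w - z0))).
    assert (Z : rho / 2 <= inner u (A v - w)).
    { rewrite inner_minus in *. lra. }
    assert (D := corner_dist z0 v rho Hr Hv). fold (A v) in D.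
    split; split.
    - exact D.
    - apply Rle_trans with (2 := Z). nra.
    - apply Cmod_convex; lra.
    - unfold S. rewrite inner_minus in *. rewrite inner_comb. nra. }
  destruct (inner_corner z0 u rho Hu) as [I1 I2].
  destruct (Q u Hu I1) as [Pa Pa']. destruct (Q (Ci * u)%C (Cmod_Ciu u Hu) I2) as [Pb Pb'].
  assert (T1 := goursat P h h' _ _ _ HP HC Hd Pa Pb Pb').
  assert (T2 := goursat P h h' _ _ _ HP HC Hd Pa Pb' Pa').
  unfold tri_int in T1, T2.
  rewrite (seg_int_swap h (A u) (S (Ci * u)%C)) in T1 by auto.
  rewrite (seg_int_swap h (S u) (S (Ci * u)%C)) in T2 by auto.
  rewrite (seg_int_swap h (A u) (S u)) in T2 by auto.
  set (x1 := seg_int h (A u) (A (Ci * u)%C)) in *.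
  set (x2 := seg_int h (A (Ci * u)%C) (S (Ci * u)%C)) in *.
  set (x3 := seg_int h (S u) (S (Ci * u)%C)) in *. set (x4 := seg_int h (A u) (S u)) in *.
  set (x5 := seg_int h (A u) (S (Ci * u)%C)) in *.
  transitivity ((x1 + x2 + - x5) + (x5 + - x3 + - x4) + x3 + x4)%C. ring.
  rewrite T1, T2. ring.
Qed.

Lemma four_units (P : C -> Prop) : (forall u, Cmod u = 1 -> P u) ->
  P 1 /\ P (Ci * 1)%C /\ P (Ci * (Ci * 1))%C /\ P (Ci * (Ci * (Ci * 1)))%C.
Proof. intros H. repeat split; apply H; repeat apply Cmod_Ciu; apply Cmod_1. Qed.

(** The vertices are left as a function of the unit so that the same expression serves for the
    square and for its homothetic images. Products by i are not evaluated, which keeps the end of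
    a side syntactically equal to the start of the next one. *)
Definition square_int (h : C -> C) (A : C -> C) : C :=
  (seg_int h (A 1) (A (Ci * 1)) + seg_int h (A (Ci * 1)) (A (Ci * (Ci * 1))) +
   seg_int h (A (Ci * (Ci * 1))) (A (Ci * (Ci * (Ci * 1)))) +
   seg_int h (A (Ci * (Ci * (Ci * 1)))) (A (Ci * (Ci * (Ci * (Ci * 1))))))%C.

Lemma Ci_pow4 : (Ci * (Ci * (Ci * (Ci * 1))))%C = 1.
Proof. unfold Ci, RtoC, Cmult; simpl. f_equal; ring. Qed.

(** Summing [square_side_shift] over the sides, the connecting segments cancel: the contour can be
    contracted towards the singularity w. *)
Lemma square_shift (h h' : C -> C) (z0 w : C) (rho t : R) :
  0 < rho -> Cmod (w - z0) <= rho / 2 -> 0 < t <= 1 ->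
  (forall z, Cmod (z - z0) <= 2 * rho -> z <> w -> cderiv h z (h' z)) ->
  square_int h (corner z0 rho) =
  square_int h (fun v => (w + RtoC t * (corner z0 rho v - w))%C).
Proof.
  intros Hr Hw Ht Hh.
  destruct (four_units _ (fun u Hu => square_side_shift h h' z0 w u rho t Hr Hu Hw Ht Hh))
    as (S0 & S1 & S2 & S3).
  cbv beta zeta in S0, S1, S2, S3. unfold square_int. rewrite Ci_pow4 in *.
  set (A := corner z0 rho) in *. set (B := fun v => (w + RtoC t * (A v - w))%C) in *.
  change (w + RtoC t * (A 1 - w))%C with (B 1) in *.
  change (w + RtoC t * (A (Ci * 1) - w))%C with (B (Ci * 1)%C) in *.
  change (w + RtoC t * (A (Ci * (Ci * 1)) - w))%C with (B (Ci * (Ci * 1))%C) in *.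
  change (w + RtoC t * (A (Ci * (Ci * (Ci * 1))) - w))%C with (B (Ci * (Ci * (Ci * 1)))%C) in *.
  set (u0 := RtoC 1) in *. set (u1 := (Ci * u0)%C) in *. set (u2 := (Ci * u1)%C) in *. set (u3 := (Ci * u2)%C) in *.
  set (r0 := seg_int h (A u0) (B u0)) in *. set (r1 := seg_int h (A u1) (B u1)) in *.
  set (r2 := seg_int h (A u2) (B u2)) in *. set (r3 := seg_int h (A u3) (B u3)) in *.
  transitivity ((seg_int h (A u0) (A u1) + r1) + (seg_int h (A u1) (A u2) + r2) +
                (seg_int h (A u2) (A u3) + r3) + (seg_int h (A u3) (A u0) + r0) - r0 - r1 - r2 - r3)%C.
  ring. rewrite S0, S1, S2, S3. ring.
Qed.

Lemma square_int_bound (h : C -> C) (A : C -> C) (M : R) :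
  (forall u, Cmod u = 1 -> Cmod (seg_int h (A u) (A (Ci * u)%C)) <= M) ->
  Cmod (square_int h A) <= 4 * M.
Proof.
  intros H. destruct (four_units _ H) as (H0 & H1 & H2 & H3).
  unfold square_int. apply Rle_trans with (1 := Cmod_triangle _ _).
  set (x0 := seg_int h (A 1) (A (Ci * 1)%C)) in *.
  set (x1 := seg_int h (A (Ci * 1)%C) (A (Ci * (Ci * 1))%C)) in *.
  set (x2 := seg_int h (A (Ci * (Ci * 1))%C) (A (Ci * (Ci * (Ci * 1)))%C)) in *.
  generalize (Cmod_triangle (x0 + x1) x2) (Cmod_triangle x0 x1). lra.
Qed.

Lemma square_int_plus (g h : C -> C) (A : C -> C) :
  (forall u, Cmod u = 1 -> contseg g (A u) (A (Ci * u)%C) /\ contseg h (A u) (A (Ci * u)%C)) ->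
  square_int (fun z => g z + h z)%C A = (square_int g A + square_int h A)%C.
Proof.
  intros H. destruct (four_units _ H) as ([? ?] & [? ?] & [? ?] & [? ?]).
  unfold square_int. do 4 (rewrite (seg_int_plus g h) by assumption). ring.
Qed.

Lemma square_int_scal (c : C) (g : C -> C) (A : C -> C) :
  (forall u, Cmod u = 1 -> contseg g (A u) (A (Ci * u)%C)) ->
  square_int (fun z => c * g z)%C A = (c * square_int g A)%C.
Proof.
  intros H. destruct (four_units _ H) as (? & ? & ? & ?).
  unfold square_int. do 4 (rewrite (seg_int_scal c g) by assumption). ring.
Qed.

Lemma square_int_ext (g h : C -> C) (A : C -> C) :
  (forall u t, Cmod u = 1 -> 0 <= t <= 1 ->
     let z := (A u + RtoC t * (A (Ci * u) - A u))%C in g z = h z) ->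
  square_int g A = square_int h A.
Proof.
  intros H.
  destruct (four_units _ (fun u Hu => seg_int_ext g h (A u) (A (Ci * u)%C) (fun t => H u t Hu)))
    as (E0 & E1 & E2 & E3).
  unfold square_int. now rewrite E0, E1, E2, E3.
Qed.

Lemma square_int_cderiv (k k' : C -> C -> C) (A : C -> C) (w : C) :
  (forall u, Cmod u = 1 -> cderiv (fun w => seg_int (k w) (A u) (A (Ci * u)%C)) w
                            (seg_int (k' w) (A u) (A (Ci * u)%C))) ->
  cderiv (fun w => square_int (k w) A) w (square_int (k' w) A).
Proof.
  intros H. destruct (four_units _ H) as (? & ? & ? & ?).
  unfold square_int. do 2 (apply (cderiv_plus (fun w => _ + _)%C); [|assumption]).
  apply cderiv_plus; assumption.
Qed.

Lemma corner_side (z0 w u : C) (rho t : R) : 0 < rho -> Cmod u = 1 -> 0 <= t <= 1 ->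
  Cmod (w - z0) <= rho / 2 ->
  let z := (corner z0 rho u + RtoC t * (corner z0 rho (Ci * u) - corner z0 rho u))%C in
  rho / 2 <= inner u (z - w)%C /\ rho / 2 <= Cmod (z - w) /\ Cmod (z - z0) <= 2 * rho.
Proof.
  intros Hr Hu Ht Hw z.
  destruct (inner_corner z0 u rho Hu) as [I1 I2].
  assert (X := inner_le u (w - z0)%C Hu). assert (Y := Rle_abs (inner u (w - z0))).
  assert (Z : rho / 2 <= inner u (z - w)).
  { unfold z. rewrite inner_minus in *. rewrite inner_comb.
    replace (inner u (corner z0 rho u)) with (rho + inner u z0) by lra.
    replace (inner u (corner z0 rho (Ci * u)%C)) with (rho + inner u z0) by lra. lra. }
  split; [exact Z|]. split.
  - generalize (inner_le u (z - w)%C Hu) (Rle_abs (inner u (z - w))). lra.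
  - apply Cmod_convex; try assumption; apply corner_dist; auto using Cmod_Ciu.
Qed.

Lemma cint_Im_pos (g : R -> C) : cont01 g -> (forall t, 0 <= t <= 1 -> 0 < Im (g t)) -> 0 < Im (cint g).
Proof.
  intros Hg H. change (0 < RInt (fun t => Im (g t)) 0 1). apply RInt_gt_0; [lra| |].
  - intros t Ht. apply H. lra.
  - intros t Ht. apply continuous_Im, Hg, Ht.
Qed.

(** Seen from w, every side is described with increasing argument, so the integral of 1 / (z - w)
    over it has positive imaginary part. This replaces the evaluation 2 pi i: Cauchy's formula is
    only used up to this nonzero factor. *)
Lemma cauchy_one_neq0 (z0 w : C) (rho : R) : 0 < rho -> Cmod (w - z0) <= rho / 2 ->
  square_int (fun z => / (z - w))%C (corner z0 rho) <> 0.
Proof.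
  intros Hr Hw.
  assert (H : forall u, Cmod u = 1 ->
    0 < Im (seg_int (fun z => / (z - w))%C (corner z0 rho u) (corner z0 rho (Ci * u)%C))).
  { intros u Hu. unfold seg_int.
    assert (N : contseg (fun z => / (z - w))%C (corner z0 rho u) (corner z0 rho (Ci * u)%C)).
    { intros t Ht. destruct (corner_side z0 w u rho t Hr Hu Ht Hw) as [_ [N _]].
      refine (cderiv_continuous _ _ _ (cderiv_cauchy1 _ _ _)).
      apply Cmod_ge_neq0 with (rho / 2); lra. }
    rewrite <- cint_scal by exact (contseg_cont01 (fun z => / (z - w))%C _ _ N).
    assert (Nc : cont01 (fun t => (corner z0 rho (Ci * u) - corner z0 rho u) *
              / (corner z0 rho u + t * (corner z0 rho (Ci * u) - corner z0 rho u) - w))%C).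
    { intros t Ht. assert (Y := contseg_cont01 (fun z => / (z - w))%C _ _ N t Ht).
      apply (continuous_comp (fun t : R => / (corner z0 rho u + t * (corner z0 rho (Ci * u) - corner z0 rho u) - w))%C
        (fun z => (corner z0 rho (Ci * u) - corner z0 rho u) * z)%C t Y).
      apply (continuous_Cmult (fun _ => (corner z0 rho (Ci * u) - corner z0 rho u)%C)).
      apply continuous_const. apply continuous_id. }
    apply cint_Im_pos; [exact Nc|].
    intros t Ht. destruct (corner_side z0 w u rho t Hr Hu Ht Hw) as [Z [N' _]].
    set (z := (corner z0 rho u + t * (corner z0 rho (Ci * u) - corner z0 rho u))%C) in *.
    assert (E : (corner z0 rho (Ci * u) - corner z0 rho u)%C = (RtoC (2 * rho) * (Ci * u))%C).
    { unfold corner, Ci, RtoC, Cplus, Cmult, Cminus, Copp; simpl. apply injective_projections; simpl; ring. }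
    rewrite E. unfold inner in Z.
    assert (Hx := Cmod2_alt (z - w)%C). assert (Hx1 : 0 < Cmod (z - w) ^ 2) by (apply pow_lt; lra).
    set (x := (z - w)%C) in *. unfold Re, Im in *.
    match goal with |- 0 < ?X => replace X with (2 * rho * (fst u * fst x + snd u * snd x) / (fst x ^ 2 + snd x ^ 2)) end.
    - apply Rdiv_lt_0_compat; [|rewrite <- Hx; exact Hx1]. apply Rmult_lt_0_compat; lra.
    - unfold Im, Ci, RtoC, Cinv, Cplus, Cmult, Cminus, Copp; simpl. field. rewrite Hx in Hx1. simpl in Hx1. lra. }
  destruct (four_units _ H) as (H0 & H1 & H2 & H3).
  intros E. apply (f_equal Im) in E. unfold square_int in E.
  rewrite !im_plus in E. change (Im (RtoC 0)) with 0 in E. lra.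
Qed.

(** * Cauchy's formula, and differentiability of the derivative *)

(** The difference quotient (f z - f w) / (z - w) is bounded near w, and by [square_shift] its
    integral does not change when the square is shrunk to w; so that integral vanishes. *)
Lemma cauchy_formula (f f' : C -> C) (z0 w : C) (rho : R) :
  0 < rho -> Cmod (w - z0) <= rho / 2 ->
  (forall z, Cmod (z - z0) <= 2 * rho -> cderiv f z (f' z)) ->
  square_int (fun z => f z * / (z - w))%C (corner z0 rho) =
  (f w * square_int (fun z => / (z - w))%C (corner z0 rho))%C.
Proof.
  intros Hr Hw Hf.
  set (h := fun z => ((f z + (- f w)) * / (z - w))%C).
  assert (Hh : exists h', forall z, Cmod (z - z0) <= 2 * rho -> z <> w -> cderiv h z (h' z)).
  { exists (fun z => ((f' z + 0) * / (z - w) + (f z + - f w) * (- RtoC 1 / ((z - w) * (z - w))))%C).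
    intros z Hz Hzw. unfold h. apply (cderiv_mult (fun z => f z + - f w)%C (fun z => / (z - w))%C).
    - apply cderiv_plus. now apply Hf. apply cderiv_const.
    - apply cderiv_cauchy1. intros E. apply Hzw. replace z with (z - w + w)%C by ring. rewrite E. ring. }
  destruct Hh as [h' Hh].
  assert (side : forall u t, Cmod u = 1 -> 0 <= t <= 1 ->
     let z := (corner z0 rho u + RtoC t * (corner z0 rho (Ci * u) - corner z0 rho u))%C in
     (z - w)%C <> 0 /\ Cmod (z - z0) <= 2 * rho).
  { intros u t Hu Ht z. destruct (corner_side z0 w u rho t Hr Hu Ht Hw) as [_ [N D]].
    split; [|exact D]. apply Cmod_ge_neq0 with (rho / 2); [lra | exact N]. }
  assert (Q : square_int h (corner z0 rho) = 0).
  { assert (Hw2 : Cmod (w - z0) <= 2 * rho) by lra.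
    destruct (cderiv_lip _ _ _ (Hf w Hw2)) as [d [Hd1 Hd2]].
    set (L := Cmod (f' w) + 1) in *.
    assert (HL : 0 < L) by (unfold L; generalize (Cmod_ge_0 (f' w)); lra).
    (* four sides of length at most 4 rho t, the bound L for h, and the factor 2 of seg_int_bound *)
    apply Cmod_eq_0_small with (32 * L * rho) (Rmin 1 (d / (3 * rho))).
    { apply Rmin_pos; [lra|]. apply Rdiv_lt_0_compat; lra. }
    intros t [Ht0 Ht].
    assert (Ht1 : t < 1) by (apply Rlt_le_trans with (1 := Ht); apply Rmin_l).
    assert (Ht2 : 3 * rho * t < d).
    { apply Rlt_le_trans with (3 * rho * (d / (3 * rho))).
      - apply Rmult_lt_compat_l; [lra|]. apply Rlt_le_trans with (1 := Ht). apply Rmin_r.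
      - right. field. lra. }
    rewrite (square_shift h h' z0 w rho t) by (auto; lra).
    replace (32 * L * rho * t) with (4 * (2 * L * (4 * rho * t))) by ring.
    apply square_int_bound. intros u Hu.
    set (S := fun v => (w + t * (corner z0 rho v - w))%C).
    assert (E : forall s, (S u + s * (S (Ci * u) - S u))%C =
      (w + t * (corner z0 rho u + s * (corner z0 rho (Ci * u) - corner z0 rho u) - w))%C).
    { intros s. unfold S. ring. }
    assert (B : Cmod (S (Ci * u)%C - S u) <= 4 * rho * t).
    { unfold S. replace (w + t * (corner z0 rho (Ci * u) - w) - (w + t * (corner z0 rho u - w)))%C
        with (t * ((corner z0 rho (Ci * u) - z0) - (corner z0 rho u - z0)))%C by ring.
      rewrite Cmod_mult, Cmod_R, Rabs_pos_eq by lra.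
      assert (X := Cmod_sub_le (corner z0 rho (Ci * u) - z0) (corner z0 rho u - z0)).
      assert (X1 := corner_dist z0 u rho Hr Hu).
      assert (X2 := corner_dist z0 _ rho Hr (Cmod_Ciu u Hu)). nra. }
    apply Rle_trans with (2 * L * Cmod (S (Ci * u)%C - S u)).
    2:{ apply Rmult_le_compat_l; lra. }
    apply seg_int_bound.
    - intros s Hs.  rewrite E.
      destruct (side u s Hu Hs) as [N D].
      set (y := (corner z0 rho u + s * (corner z0 rho (Ci * u) - corner z0 rho u))%C) in *.
      refine (cderiv_continuous _ _ _ (Hh _ _ _)).
      + apply Cmod_convex; lra.
      + intros E'. assert (Z : (t * (y - w))%C = 0).
        { replace (t * (y - w))%C with ((w + t * (y - w)) - w)%C by ring. rewrite E'. ring. }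
        revert Z. apply Cmult_neq_0; [|exact N]. intros Z. apply RtoC_inj in Z. lra.
    - intros s Hs. rewrite E. destruct (side u s Hu Hs) as [N D].
      set (y := (corner z0 rho u + s * (corner z0 rho (Ci * u) - corner z0 rho u))%C) in *.
      set (k := (t * (y - w))%C).
      assert (Hk0 : k <> 0). { apply Cmult_neq_0; [|exact N]. intros Z. apply RtoC_inj in Z. lra. }
      assert (Hk : Cmod k <= 3 * rho * t).
      { unfold k. rewrite Cmod_mult, Cmod_R, Rabs_pos_eq by lra.
        assert (X := Cmod_sub_le (y - z0) (w - z0)). replace (y - z0 - (w - z0))%C with (y - w)%C in X by ring.
        nra. }
      specialize (Hd2 k (Rle_lt_trans _ _ _ Hk Ht2)).
      unfold h. replace (w + k - w)%C with k by ring.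
      change ((f (w + k) + - f w) * / k)%C with ((f (w + k)%C - f w) / k)%C.
      rewrite Cmod_div by exact Hk0.
      apply Cmod_gt_0 in Hk0. apply Rmult_le_reg_r with (Cmod k); [exact Hk0|].
      unfold Rdiv. rewrite Rmult_assoc, Rinv_l by lra. lra. }
  assert (Cinv' : forall u, Cmod u = 1 ->
     contseg (fun z => / (z - w))%C (corner z0 rho u) (corner z0 rho (Ci * u)%C)).
  { intros u Hu t Ht. destruct (side u t Hu Ht) as [N _].
    exact (cderiv_continuous _ _ _ (cderiv_cauchy1 _ _ N)). }
  assert (Cf : forall u, Cmod u = 1 ->
     contseg (fun z => f z * / (z - w))%C (corner z0 rho u) (corner z0 rho (Ci * u)%C)).
  { intros u Hu t Ht. destruct (side u t Hu Ht) as [_ D].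
    apply continuous_Cmult. exact (cderiv_continuous _ _ _ (Hf _ D)). now apply Cinv'. }
  assert (E : square_int h (corner z0 rho) =
    (square_int (fun z => f z * / (z - w))%C (corner z0 rho) +
     (- f w) * square_int (fun z => / (z - w))%C (corner z0 rho))%C).
  { rewrite <- square_int_scal by exact Cinv'. rewrite <- square_int_plus.
    - apply square_int_ext. intros u t Hu Ht z. unfold h. ring.
    - intros u Hu. split; [now apply Cf|]. intros t Ht.
      apply (continuous_Cmult (fun _ => (- f w)%C)). apply continuous_const. now apply Cinv'. }
  rewrite E in Q.
  transitivity (square_int (fun z => f z * / (z - w))%C (corner z0 rho) +
     (- f w) * square_int (fun z => / (z - w))%C (corner z0 rho) +
     f w * square_int (fun z => / (z - w))%C (corner z0 rho))%C. ring. rewrite Q. ring.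
Qed.

Lemma square_kernel1 (g : C -> C) (z0 w : C) (rho : R) : 0 < rho -> Cmod (w - z0) <= rho / 2 ->
  (forall z, Cmod (z - z0) <= 2 * rho -> continuous g z) ->
  cderiv (fun w => square_int (fun z => g z * / (z - w))%C (corner z0 rho)) w
         (square_int (fun z => g z * (/ (z - w) * / (z - w)))%C (corner z0 rho)).
Proof.
  intros Hr Hw Hg.
  apply (square_int_cderiv (fun w z => g z * / (z - w))%C
           (fun w z => g z * (/ (z - w) * / (z - w)))%C).
  intros u Hu. apply (seg_kernel1 g _ _ w (rho / 2)). lra.
  - intros t Ht. apply Hg. apply (corner_side z0 w u rho t Hr Hu Ht Hw).
  - intros t Ht. apply (corner_side z0 w u rho t Hr Hu Ht Hw).
Qed.

Lemma square_kernel2 (g : C -> C) (z0 w : C) (rho : R) : 0 < rho -> Cmod (w - z0) <= rho / 2 ->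
  (forall z, Cmod (z - z0) <= 2 * rho -> continuous g z) ->
  cderiv (fun w => square_int (fun z => g z * (/ (z - w) * / (z - w)))%C (corner z0 rho)) w
         (square_int (fun z => g z * (2 * (/ (z - w) * (/ (z - w) * / (z - w)))))%C (corner z0 rho)).
Proof.
  intros Hr Hw Hg.
  apply (square_int_cderiv (fun w z => g z * (/ (z - w) * / (z - w)))%C
           (fun w z => g z * (2 * (/ (z - w) * (/ (z - w) * / (z - w)))))%C).
  intros u Hu. apply (seg_kernel2 g _ _ w (rho / 2)). lra.
  - intros t Ht. apply Hg. apply (corner_side z0 w u rho t Hr Hu Ht Hw).
  - intros t Ht. apply (corner_side z0 w u rho t Hr Hu Ht Hw).
Qed.

(** By Cauchy's formula f is a quotient of two Cauchy-type integrals near z0, and these are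
    differentiable as often as needed because the parameter occurs only in the kernel. *)
Theorem cderiv_cderiv (f f' : C -> C) (z0 : C) (r : R) : 0 < r ->
  (forall z, Cmod (z - z0) < r -> cderiv f z (f' z)) -> exists l, cderiv f' z0 l.
Proof.
  intros Hr Hf. set (rho := r / 4).
  assert (Hrho : 0 < rho) by (unfold rho; lra).
  assert (Hf2 : forall z, Cmod (z - z0) <= 2 * rho -> cderiv f z (f' z)).
  { intros z Hz. apply Hf. unfold rho in Hz. lra. }
  assert (Hc : forall z, Cmod (z - z0) <= 2 * rho -> continuous f z).
  { intros z Hz. exact (cderiv_continuous _ _ _ (Hf2 z Hz)). }
  assert (H1 : forall z, Cmod (z - z0) <= 2 * rho -> continuous (fun _ : C => RtoC 1) z)
    by (intros; apply continuous_const).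
  set (F1 := fun w => square_int (fun z => f z * / (z - w))%C (corner z0 rho)).
  set (F2 := fun w => square_int (fun z => f z * (/ (z - w) * / (z - w)))%C (corner z0 rho)).
  set (F3 := square_int (fun z => f z * (2 * (/ (z - z0) * (/ (z - z0) * / (z - z0)))))%C (corner z0 rho)).
  set (G1 := fun w => square_int (fun z => 1 * / (z - w))%C (corner z0 rho)).
  set (G2 := fun w => square_int (fun z => 1 * (/ (z - w) * / (z - w)))%C (corner z0 rho)).
  set (G3 := square_int (fun z => 1 * (2 * (/ (z - z0) * (/ (z - z0) * / (z - z0)))))%C (corner z0 rho)).
  assert (GE : forall w, G1 w = square_int (fun z => / (z - w))%C (corner z0 rho)).
  { intros w. apply square_int_ext. intros. ring. }
  assert (GN : forall w, Cmod (w - z0) <= rho / 2 -> G1 w <> 0).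
  { intros w Hw. rewrite GE. now apply cauchy_one_neq0. }
  assert (E : forall w, Cmod (w - z0) <= rho / 2 -> f w = (F1 w * / G1 w)%C).
  { intros w Hw. unfold F1. rewrite (cauchy_formula f f' z0 w rho Hrho Hw Hf2), <- GE.
    field. now apply GN. }
  set (D := fun w => (F2 w * / G1 w + F1 w * (- G2 w / (G1 w * G1 w)))%C).
  assert (HD : forall w, Cmod (w - z0) <= rho / 2 -> cderiv (fun w => F1 w * / G1 w)%C w (D w)).
  { intros w Hw. apply (cderiv_mult F1 (fun w => / G1 w)%C).
    - now apply square_kernel1.
    - apply (cderiv_inv G1); [|now apply GN]. now apply (square_kernel1 (fun _ => RtoC 1)). }
  assert (Z0 : Cmod (z0 - z0) <= rho / 2).
  { replace (z0 - z0)%C with (RtoC 0) by ring. rewrite Cmod_0. lra. }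
  assert (E' : forall h, Cmod h < rho / 4 -> f' (z0 + h)%C = D (z0 + h)%C).
  { intros h Hh. set (w := (z0 + h)%C).
    assert (Hw : Cmod (w - z0) < rho / 4) by (unfold w; replace (z0 + h - z0)%C with h by ring; exact Hh).
    apply (cderiv_unique f w).
    - apply Hf2. lra.
    - apply (cderiv_ext _ (fun w => F1 w * / G1 w)%C w _ (rho / 4)); [lra| |apply HD; lra].
      intros k Hk. apply E. replace (w + k - z0)%C with ((w - z0) + k)%C by ring.
      apply Rle_trans with (1 := Cmod_triangle _ _). lra. }
  eexists. apply (cderiv_ext f' D z0 _ (rho / 4)); [lra | exact E' |].
  assert (dF1 := square_kernel1 f z0 z0 rho Hrho Z0 Hc).
  assert (dG1 := square_kernel1 (fun _ => RtoC 1) z0 z0 rho Hrho Z0 H1).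
  assert (dF2 := square_kernel2 f z0 z0 rho Hrho Z0 Hc).
  assert (dG2 := square_kernel2 (fun _ => RtoC 1) z0 z0 rho Hrho Z0 H1).
  fold F1 F2 F3 G1 G2 G3 in dF1, dG1, dF2, dG2.
  unfold D. apply (cderiv_plus (fun w => F2 w * / G1 w)%C).
  - apply (cderiv_mult F2 (fun w => / G1 w)%C). exact dF2.
    apply (cderiv_inv G1). exact dG1. now apply GN.
  - apply (cderiv_mult F1 (fun w => - G2 w / (G1 w * G1 w))%C). exact dF1.
    apply (cderiv_mult (fun w => - G2 w)%C (fun w => / (G1 w * G1 w))%C).
    + apply (cderiv_ext _ (fun w => RtoC (-1) * G2 w)%C z0 _ 1 Rlt_0_1). intros; ring.
      apply (cderiv_mult (fun _ => RtoC (-1))). apply cderiv_const. exact dG2.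
    + apply (cderiv_inv (fun w => G1 w * G1 w)%C). apply (cderiv_mult G1 G1); exact dG1.
      apply Cmult_neq_0; now apply GN.
Qed.

(** * Laplacians from second-order expansions *)

(** Second-order expansion with the quadratic part split into Re (b h^2) and l |h|^2 / 4. The
    first is harmonic, so l is the Laplacian; and under a substitution h -> A h + B h^2 the first
    two terms stay harmonic, which makes the conformal behaviour of l visible. *)
Definition taylor2 (phi : C -> R) (z a b : C) (l : R) : Prop :=
  little_o 2 (fun h => phi (z + h)%C - phi z - Re (a * h)%C - Re (b * (h * h))%C - l / 4 * Cmod h ^ 2).

Definition has_lap (phi : C -> R) (z : C) (l : R) : Prop := exists a b, taylor2 phi z a b l.

Lemma re_minus (x y : C) : Re (x - y)%C = Re x - Re y.
Proof. reflexivity. Qed.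

Lemma re_mult_le (x y : C) : Rabs (Re (x * y)%C) <= Cmod x * Cmod y.
Proof. rewrite <- Cmod_mult. apply re_le_Cmod. Qed.

Lemma Rabs_mult_le (x y X Y : R) : Rabs x <= X -> Rabs y <= Y -> Rabs (x * y) <= X * Y.
Proof. intros Hx Hy. rewrite Rabs_mult. apply Rmult_le_compat; auto using Rabs_pos. Qed.

Lemma has_lap_plus (f g : C -> R) (z : C) (l m : R) :
  has_lap f z l -> has_lap g z m -> has_lap (fun z => f z + g z) z (l + m).
Proof.
  intros (a & b & Hf) (a' & b' & Hg). exists (a + a')%C, (b + b')%C.
  apply (little_o_ext 2 _ _ 1 Rlt_0_1) with (2 := little_o_plus 2 _ _ Hf Hg).
  intros h _. rewrite !Cmult_plus_distr_r, !re_plus. field.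
Qed.

Lemma has_lap_scal (c : R) (f : C -> R) (z : C) (l : R) :
  has_lap f z l -> has_lap (fun z => c * f z) z (c * l).
Proof.
  intros (a & b & Hf). exists (c * a)%C, (c * b)%C.
  apply (little_o_dom 2 _ _ (Rabs c) 1 Rlt_0_1) with (2 := Hf).
  intros h _. rewrite <- Rabs_mult, <- !Cmult_assoc, !re_scal_l. right. f_equal. field.
Qed.

Lemma has_lap_ext (f g : C -> R) (z : C) (l d : R) : 0 < d ->
  (forall h, Cmod h < d -> f (z + h)%C = g (z + h)%C) -> has_lap g z l -> has_lap f z l.
Proof.
  intros Hd H (a & b & Hf). exists a, b.
  apply (little_o_ext 2 _ _ d Hd) with (2 := Hf). intros h Hh.
  assert (H0 := H (RtoC 0)). rewrite Cmod_0, Cplus_0_r in H0.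
  rewrite (H h Hh), (H0 Hd). reflexivity.
Qed.

(** Summing the expansion over the increments s, i s, -s, -i s cancels the linear term and Re (b
    h^2). *)
Lemma has_lap_max (f : C -> R) (z : C) (l d : R) : 0 < d ->
  (forall h, Cmod h < d -> f (z + h)%C <= f z) -> has_lap f z l -> l <= 0.
Proof.
  intros Hd Hmax (a & b & Hf). apply Rnot_lt_le. intros Hl.
  destruct (Hf (l / 8)) as [e [He1 He2]]; [lra|].
  set (s := Rmin d e / 2).
  assert (Hs : 0 < s < Rmin d e) by (unfold s; generalize (Rmin_pos d e Hd He1); lra).
  destruct (Rmin_Rgt_l d e s (proj2 Hs)) as [Hsd Hse].
  assert (M : forall u, Cmod u = 1 ->
    Re (a * (s * u))%C + Re (b * (s * u * (s * u)))%C + l / 4 * s ^ 2 <= l / 8 * s ^ 2).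
  { intros u Hu. assert (Hh : Cmod (s * u) = s).
    { rewrite Cmod_mult, Cmod_R, Hu, Rabs_pos_eq; lra. }
    specialize (Hmax (s * u)%C). specialize (He2 (s * u)%C). rewrite Hh in Hmax, He2.
    specialize (Hmax Hsd). specialize (He2 Hse). apply Rabs_le_between in He2. lra. }
  destruct (four_units _ M) as (M0 & M1 & M2 & M3).
  assert (0 < l * (s * s)) by (apply Rmult_lt_0_compat; nra).
  unfold Ci, RtoC, Re in M0, M1, M2, M3; simpl in M0, M1, M2, M3. nra.
Qed.

Lemma taylor2_lip (f : C -> R) (z a b : C) (l : R) : taylor2 f z a b l ->
  exists K d, 0 <= K /\ 0 < d /\ forall h, Cmod h < d ->
    Rabs (f (z + h)%C - f z) <= K * Cmod h /\
    Rabs (f (z + h)%C - f z - Re (a * h)%C) <= K * Cmod h ^ 2.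
Proof.
  intros H. destruct (H 1 Rlt_0_1) as [d [Hd1 Hd2]].
  assert (Ka := Cmod_ge_0 a). assert (Kb := Cmod_ge_0 b). assert (Kl := Rabs_pos (l / 4)).
  exists (Cmod a + (Cmod b + Rabs (l / 4) + 1)), (Rmin 1 d).
  split; [lra|]. split; [apply Rmin_pos; lra|]. intros h Hh.
  destruct (Rmin_Rgt_l _ _ _ Hh) as [Hh1 Hh2]. specialize (Hd2 h Hh2).
  assert (Hh0 := Cmod_ge_0 h). assert (S0 := pow2_ge_0 (Cmod h)).
  assert (S : Cmod h ^ 2 <= Cmod h) by nra.
  set (x := f (z + h)%C - f z) in *.
  assert (E : Rabs (x - Re (a * h)%C) <= (Cmod b + Rabs (l / 4) + 1) * Cmod h ^ 2).
  { replace (x - Re (a * h)%C) with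
      ((x - Re (a * h)%C - Re (b * (h * h))%C - l / 4 * Cmod h ^ 2) + Re (b * (h * h))%C + l / 4 * Cmod h ^ 2)
      by ring.
    apply Rle_trans with (1 := Rabs_triang _ _). rewrite (Rabs_mult (l / 4)), (Rabs_pos_eq (Cmod h ^ 2)) by lra.
    assert (Q := re_mult_le b (h * h)). rewrite Cmod_mult in Q.
    assert (Q' := Rabs_triang (x - Re (a * h)%C - Re (b * (h * h))%C - l / 4 * Cmod h ^ 2) (Re (b * (h * h))%C)).
    nra. }
  split; [|nra].
  replace x with ((x - Re (a * h)%C) + Re (a * h)%C) by ring.
  apply Rle_trans with (1 := Rabs_triang _ _). assert (Q := re_mult_le a h). nra.
Qed.

(** Substituting a Lipschitz increment into a second-order remainder. The domain is left abstract
    because it is applied to real as well as to complex increments. *)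
Lemma little_o_subst (T : Type) (N psi : T -> R) (P : C -> T) (K d : R) :
  (forall eps, 0 < eps -> exists del, 0 < del /\
     forall k, N k < del -> Rabs (psi k) <= eps * N k ^ 2) ->
  0 <= K -> 0 < d -> (forall h, Cmod h < d -> 0 <= N (P h) <= K * Cmod h) ->
  little_o 2 (fun h => psi (P h)).
Proof.
  intros Hpsi HK Hd HP eps He.
  assert (HK2 : 0 < (K + 1) ^ 2) by (apply pow_lt; lra).
  destruct (Hpsi (eps / (K + 1) ^ 2)) as [e [He1 He2]]; [now apply Rdiv_lt_0_compat|].
  exists (Rmin d (e / (K + 1))). split; [apply Rmin_pos; [exact Hd|]; apply Rdiv_lt_0_compat; lra|].
  intros h Hh. destruct (Rmin_Rgt_l _ _ _ Hh) as [Hh1 Hh2]. specialize (HP h Hh1).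
  assert (Hh0 := Cmod_ge_0 h).
  assert (H2 : (K + 1) * Cmod h < e).
  { apply Rlt_le_trans with ((K + 1) * (e / (K + 1))). apply Rmult_lt_compat_l; lra. right; field; lra. }
  apply Rle_trans with (1 := He2 (P h) ltac:(nra)).
  apply Rle_trans with (eps / (K + 1) ^ 2 * ((K + 1) * Cmod h) ^ 2).
  - apply Rmult_le_compat_l; [left; now apply Rdiv_lt_0_compat|]. apply pow_incr. nra.
  - right. field. lra.
Qed.

Definition taylor2_R (beta : R -> R) (t0 b1 b2 : R) : Prop :=
  forall eps, 0 < eps -> exists del, 0 < del /\ forall t, Rabs t < del ->
    Rabs (beta (t0 + t) - beta t0 - b1 * t - b2 / 2 * t ^ 2) <= eps * t ^ 2.

(** The square of a linear form has a harmonic part and a multiple of |h|^2. *)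
Lemma re_sq (x : C) : Re x ^ 2 = (Cmod x ^ 2 + Re (x * x)%C) / 2.
Proof. rewrite Cmod2_alt. unfold Re, Im; simpl. field. Qed.

Lemma taylor2_comp1 (beta : R -> R) (f : C -> R) (z : C) (b1 b2 : R) (a b : C) (l : R) :
  taylor2_R beta (f z) b1 b2 -> taylor2 f z a b l ->
  taylor2 (fun z => beta (f z)) z (b1 * a) (b1 * b + RtoC (b2 / 4) * (a * a)) (b1 * l + b2 * Cmod a ^ 2).
Proof.
  intros Hb Hf. destruct (taylor2_lip _ _ _ _ _ Hf) as (K & d & HK & Hd & HL).
  assert (O1 : little_o 2 (fun h => beta (f (z + h)%C) - beta (f z) - b1 * (f (z + h)%C - f z)
                              - b2 / 2 * (f (z + h)%C - f z) ^ 2)).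
  { apply (little_o_subst R Rabs (fun t => beta (f z + t) - beta (f z) - b1 * t - b2 / 2 * t ^ 2)
      (fun h => f (z + h)%C - f z) K d) in HK; auto.
    - apply (little_o_ext 2 _ _ d Hd) with (2 := HK). intros h _.
      now replace (f z + (f (z + h)%C - f z)) with (f (z + h)%C) by ring.
    - intros eps He. destruct (Hb eps He) as [e [He1 He2]]. exists e. split; [exact He1|].
      intros t Ht. rewrite pow2_abs. now apply He2.
    - intros h Hh. split; [apply Rabs_pos | now apply HL]. }
  assert (O2 : little_o 2 (fun h => b2 / 2 * ((f (z + h)%C - f z) ^ 2 - Re (a * h)%C ^ 2))).
  { apply (little_o_bigO 2 _ (Rabs (b2 / 2) * (K * (K + Cmod a))) d Hd).
    intros h Hh. destruct (HL h Hh) as [H1 H2]. assert (H3 := re_mult_le a h).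
    set (x := f (z + h)%C - f z) in *. set (y := Re (a * h)%C) in *.
    replace (x ^ 2 - y ^ 2) with ((x - y) * (x + y)) by ring.
    replace (Rabs (b2 / 2) * (K * (K + Cmod a)) * Cmod h ^ 3)
      with (Rabs (b2 / 2) * ((K * Cmod h ^ 2) * (K * Cmod h + Cmod a * Cmod h))) by ring.
    apply Rabs_mult_le; [lra|]. apply Rabs_mult_le; [exact H2|].
    apply Rle_trans with (1 := Rabs_triang _ _). lra. }
  assert (O3 : little_o 2 (fun h => b1 * (f (z + h)%C - f z - Re (a * h)%C - Re (b * (h * h))%C - l / 4 * Cmod h ^ 2))).
  { apply (little_o_dom 2 _ _ (Rabs b1) 1 Rlt_0_1) with (2 := Hf). intros h _. rewrite Rabs_mult. lra. }
  apply (little_o_ext 2 _ _ 1 Rlt_0_1) with (2 := little_o_plus 2 _ _ O1 (little_o_plus 2 _ _ O2 O3)).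
  intros h _. rewrite (re_sq (a * h)), Cmod_mult.
  replace (a * h * (a * h))%C with (a * a * (h * h))%C by ring.
  rewrite Cmult_plus_distr_r, re_plus, <- !Cmult_assoc, !re_scal_l. field.
Qed.

Lemma has_lap_radial (beta : R -> R) (q z : C) (b1 b2 : R) :
  taylor2_R beta (Cmod (z - q) ^ 2) b1 b2 ->
  has_lap (fun z => beta (Cmod (z - q) ^ 2)) z (4 * b1 + 4 * b2 * Cmod (z - q) ^ 2).
Proof.
  intros H.
  assert (T : taylor2 (fun z => Cmod (z - q) ^ 2) z (2 * Cconj (z - q)) 0 4).
  { apply (little_o_ext 2 _ (fun _ => 0) 1 Rlt_0_1); [|apply little_o_zero].
    intros h _. rewrite !Cmod2_alt. unfold Re, Im; simpl. field. }
  do 2 eexists. replace (4 * b1 + 4 * b2 * Cmod (z - q) ^ 2)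
    with (b1 * 4 + b2 * Cmod (2 * Cconj (z - q)) ^ 2).
  - exact (taylor2_comp1 beta _ _ _ _ _ _ _ H T).
  - rewrite Cmod_mult, Cmod_R, Cmod_conj, Rabs_pos_eq by lra. ring.
Qed.

Definition ctaylor2 (f : C -> C) (z A B : C) : Prop :=
  little_o 2 (fun h => Cmod (f (z + h)%C - f z - A * h - B * (h * h))).

Lemma ctaylor2_lip (f : C -> C) (z A B : C) : ctaylor2 f z A B ->
  exists K d, 0 <= K /\ 0 < d /\ forall h, Cmod h < d ->
    Cmod (f (z + h)%C - f z) <= K * Cmod h /\
    Cmod (f (z + h)%C - f z - A * h) <= K * Cmod h ^ 2.
Proof.
  intros H. destruct (H 1 Rlt_0_1) as [d [Hd1 Hd2]].
  assert (HA := Cmod_ge_0 A). assert (HB := Cmod_ge_0 B).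
  exists (Cmod A + Cmod B + 1), (Rmin 1 d).
  split; [lra|]. split; [apply Rmin_pos; lra|]. intros h Hh.
  assert (Hh1 : Cmod h < 1) by (apply Rlt_le_trans with (1 := Hh); apply Rmin_l).
  specialize (Hd2 h (Rlt_le_trans _ _ _ Hh (Rmin_r _ _))).
  rewrite Rabs_pos_eq in Hd2 by apply Cmod_ge_0.
  assert (Hh0 := Cmod_ge_0 h).
  set (x := (f (z + h)%C - f z)%C) in *.
  assert (E : Cmod (x - A * h) <= (Cmod B + 1) * Cmod h ^ 2).
  { replace (x - A * h)%C with ((x - A * h - B * (h * h)) + B * (h * h))%C by ring.
    apply Rle_trans with (1 := Cmod_triangle _ _). rewrite !(Cmod_mult B), (Cmod_mult h).
    simpl in *. lra. }
  assert (S0 : 0 <= Cmod h ^ 2) by apply pow2_ge_0.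
  assert (S : Cmod h ^ 2 <= Cmod h) by nra.
  split.
  - replace x with ((x - A * h) + A * h)%C by ring.
    apply Rle_trans with (1 := Cmod_triangle _ _). rewrite Cmod_mult. nra.
  - nra.
Qed.

(** Under the substitution the linear and the harmonic term of the expansion stay harmonic, and |A
    h|^2 = |A|^2 |h|^2. *)
Lemma has_lap_comp (phi : C -> R) (f : C -> C) (z A B : C) (l : R) :
  ctaylor2 f z A B -> has_lap phi (f z) l -> has_lap (fun z => phi (f z)) z (Cmod A ^ 2 * l).
Proof.
  intros Hf (a & b & Hphi).
  destruct (ctaylor2_lip _ _ _ _ Hf) as (K & d & HK & Hd & HL).
  set (P := fun h => (f (z + h)%C - f z)%C) in *.
  assert (O1 : little_o 2 (fun h => phi (f (z + h)%C) - phi (f z) - Re (a * P h)%C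
                              - Re (b * (P h * P h))%C - l / 4 * Cmod (P h) ^ 2)).
  { apply (little_o_subst C Cmod (fun k => phi (f z + k)%C - phi (f z) - Re (a * k)%C
      - Re (b * (k * k))%C - l / 4 * Cmod k ^ 2) P K d) in HK; auto.
    - apply (little_o_ext 2 _ _ d Hd) with (2 := HK). intros h _.
      now replace (f z + P h)%C with (f (z + h)%C) by (unfold P; ring).
    - intros h Hh. split; [apply Cmod_ge_0 | now apply HL]. }
  assert (O2 : little_o 2 (fun h => Re (a * (P h - A * h - B * (h * h)))%C)).
  { apply (little_o_dom 2 _ _ (Cmod a) 1 Rlt_0_1) with (2 := Hf). intros h _.
    rewrite (Rabs_pos_eq (Cmod _)) by apply Cmod_ge_0. apply re_mult_le. }
  assert (O3 : little_o 2 (fun h => Re (b * (P h * P h - A * h * (A * h)))%C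
                              + l / 4 * (Cmod (P h) ^ 2 - Cmod (A * h) ^ 2))).
  { apply (little_o_bigO 2 _ ((Cmod b + Rabs (l / 4)) * (K * (K + Cmod A))) d Hd). intros h Hh.
    destruct (HL h Hh) as [H1 H2]. fold (P h) in H1, H2.
    assert (H3 : Cmod (P h - A * h) * (Cmod (P h) + Cmod (A * h)) <= K * (K + Cmod A) * Cmod h ^ 3).
    { replace (K * (K + Cmod A) * Cmod h ^ 3) with ((K * Cmod h ^ 2) * (K * Cmod h + Cmod A * Cmod h)) by ring.
      apply Rmult_le_compat; [apply Cmod_ge_0 | | exact H2 |].
      - apply Rplus_le_le_0_compat; apply Cmod_ge_0.
      - rewrite Cmod_mult. lra. }
    set (u := P h) in *. set (v := (A * h)%C) in *.
    apply Rle_trans with (1 := Rabs_triang _ _). rewrite Rmult_assoc, Rmult_plus_distr_r.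
    apply Rplus_le_compat.
    - apply Rle_trans with (1 := re_mult_le _ _). apply Rmult_le_compat_l; [apply Cmod_ge_0|].
      apply Rle_trans with (2 := H3). replace (u * u - v * v)%C with ((u - v) * (u + v))%C by ring.
      rewrite Cmod_mult. apply Rmult_le_compat_l; [apply Cmod_ge_0 | apply Cmod_triangle].
    - apply Rabs_mult_le; [lra|]. apply Rle_trans with (2 := H3).
      replace (Cmod u ^ 2 - Cmod v ^ 2) with ((Cmod u - Cmod v) * (Cmod u + Cmod v)) by ring.
      assert (Pu := Cmod_ge_0 u). assert (Pv := Cmod_ge_0 v).
      apply Rabs_mult_le; [|rewrite Rabs_pos_eq; lra].
      assert (T1 := Cmod_rev_triangle u v). assert (T2 := Cmod_rev_triangle v u).
      rewrite (Cmod_sub_sym v u) in T2. apply Rabs_le. lra. }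
  exists (a * A)%C, (a * B + b * (A * A))%C.
  apply (little_o_ext 2 _ _ 1 Rlt_0_1) with (2 := little_o_plus 2 _ _ O1 (little_o_plus 2 _ _ O2 O3)).
  intros h _. rewrite Cmod_mult.
  replace (a * (P h - A * h - B * (h * h)))%C with (a * P h - a * A * h - a * B * (h * h))%C by ring.
  replace (b * (P h * P h - A * h * (A * h)))%C with (b * (P h * P h) - b * (A * A) * (h * h))%C by ring.
  rewrite Cmult_plus_distr_r, re_plus, !re_minus. field.
Qed.

Lemma is_derive_cpath (g : C -> C) (c z h l : C) (t : R) : cderiv g (z + RtoC t * h)%C l ->
  is_derive (fun t => Re (c * g (z + RtoC t * h))%C) t (Re (c * (l * h))%C).
Proof.
  intros H. apply is_derive_Reals. intros eps He.
  set (m := Cmod c * Cmod h + 1).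
  assert (Hm0 : 0 <= Cmod c * Cmod h) by (apply Rmult_le_pos; apply Cmod_ge_0).
  destruct (H (eps / (2 * m))) as [d [Hd1 Hd2]]. { apply Rdiv_lt_0_compat; unfold m; lra. }
  assert (Hh := Cmod_ge_0 h).
  assert (Hdp : 0 < d / (Cmod h + 1)) by (apply Rdiv_lt_0_compat; lra).
  exists (mkposreal _ Hdp). intros k Hk0 Hk. change (Rabs k < d / (Cmod h + 1)) in Hk. cbv beta.
  assert (Hk1 : 0 < Rabs k) by now apply Rabs_pos_lt.
  assert (B : Cmod (k * h) < d).
  { rewrite Cmod_mult, Cmod_R. apply Rle_lt_trans with (Rabs k * (Cmod h + 1)).
    - apply Rmult_le_compat_l; lra.
    - apply Rlt_le_trans with (d / (Cmod h + 1) * (Cmod h + 1)).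
      apply Rmult_lt_compat_r; lra. right. field. lra. }
  specialize (Hd2 (k * h)%C B). rewrite Rabs_pos_eq in Hd2 by apply Cmod_ge_0.
  replace (z + RtoC (t + k) * h)%C with (z + t * h + k * h)%C by (rewrite RtoC_plus; ring).
  set (w := (z + t * h)%C) in *.
  replace ((Re (c * g (w + k * h))%C - Re (c * g w)%C) / k - Re (c * (l * h))%C)
    with (Re (c * (g (w + k * h) - g w - l * (k * h)))%C / k).
  - apply Rmult_lt_reg_r with (Rabs k); [exact Hk1|].
    rewrite <- Rabs_mult. unfold Rdiv. rewrite Rmult_assoc, Rinv_l, Rmult_1_r by exact Hk0.
    apply Rle_lt_trans with (1 := re_mult_le _ _).
    apply Rle_lt_trans with (Cmod c * (eps / (2 * m) * Cmod (k * h) ^ 1)).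
    + apply Rmult_le_compat_l; [apply Cmod_ge_0 | exact Hd2].
    + rewrite pow_1, Cmod_mult, Cmod_R.
      replace (Cmod c * (eps / (2 * m) * (Rabs k * Cmod h))) with (eps * Rabs k * ((m - 1) / m) / 2)
        by (unfold m; field; lra).
      assert (0 < eps * Rabs k) by (apply Rmult_lt_0_compat; lra).
      assert ((m - 1) / m <= 1).
      { apply Rmult_le_reg_r with m; [unfold m; lra|]. unfold Rdiv. rewrite Rmult_assoc, Rinv_l; unfold m; lra. }
      nra.
  - replace (c * (g (w + k * h) - g w - l * (k * h)))%C
      with (c * g (w + k * h) - c * g w - k * (c * (l * h)))%C by ring.
    rewrite !re_minus, re_scal_l. field. exact Hk0.
Qed.

Lemma mvt_bound (g dg : R -> R) (M : R) :
  (forall t, 0 <= t <= 1 -> is_derive g t (dg t)) ->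
  (forall t, 0 <= t <= 1 -> Rabs (dg t) <= M) -> Rabs (g 1 - g 0) <= M.
Proof.
  intros Hg HM. destruct (MVT_gen g 0 1 dg) as [c [Hc E]].
  - intros x Hx. rewrite Rmin_left, Rmax_right in Hx by lra. apply Hg. lra.
  - intros x Hx. rewrite Rmin_left, Rmax_right in Hx by lra.
    apply continuity_pt_filterlim. apply (ex_derive_continuous (V := R_NormedModule)).
    eexists. apply Hg. lra.
  - rewrite Rmin_left, Rmax_right in Hc by lra. rewrite E.
    replace (dg c * (1 - 0)) with (dg c) by ring. apply HM. lra.
Qed.

(** Apply the real mean value theorem to the real part of conj D * g along the segment, where D is
    the increment of g: its increment is |D|^2. *)
Lemma complex_mvt (g g' : C -> C) (z h : C) (M : R) :
  (forall t, 0 <= t <= 1 -> cderiv g (z + RtoC t * h)%C (g' (z + RtoC t * h)%C)) ->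
  (forall t, 0 <= t <= 1 -> Cmod (g' (z + RtoC t * h)%C) <= M) ->
  Cmod (g (z + h)%C - g z) <= M * Cmod h.
Proof.
  intros Hg HM. set (D := (g (z + h)%C - g z)%C).
  assert (X := mvt_bound (fun t => Re (Cconj D * g (z + RtoC t * h))%C)
    (fun t => Re (Cconj D * (g' (z + RtoC t * h) * h))%C) (Cmod D * (M * Cmod h))).
  cbv beta in X. replace (z + 1 * h)%C with (z + h)%C in X by ring.
  replace (z + 0 * h)%C with z in X by ring.
  assert (Y : Rabs (Re (Cconj D * g (z + h))%C - Re (Cconj D * g z)%C) <= Cmod D * (M * Cmod h)).
  { apply X; intros t Ht. now apply is_derive_cpath, Hg.
    apply Rle_trans with (1 := re_mult_le _ _). rewrite Cmod_conj, Cmod_mult.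
    apply Rmult_le_compat_l; [apply Cmod_ge_0|]. apply Rmult_le_compat_r; [apply Cmod_ge_0 | now apply HM]. }
  replace (Re (Cconj D * g (z + h))%C - Re (Cconj D * g z)%C) with (Cmod D * Cmod D) in Y.
  - rewrite Rabs_pos_eq in Y by (apply Rmult_le_pos; apply Cmod_ge_0).
    destruct (Req_dec (Cmod D) 0) as [E | N].
    + rewrite E. apply Rmult_le_pos; [|apply Cmod_ge_0].
      apply Rle_trans with (2 := HM 0 ltac:(lra)). apply Cmod_ge_0.
    + assert (P := Cmod_ge_0 D). apply Rmult_le_reg_l with (Cmod D); lra.
  - replace (Cmod D * Cmod D) with (Cmod D ^ 2) by ring. rewrite Cmod2_alt.
    unfold D, Re, Im; simpl. ring.
Qed.

Lemma cderiv_ctaylor2 (f f' : C -> C) (z l : C) (d : R) : 0 < d ->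
  (forall h, Cmod h < d -> cderiv f (z + h)%C (f' (z + h)%C)) ->
  cderiv f' z l -> ctaylor2 f z (f' z) (l / 2)%C.
Proof.
  intros Hd Hf Hf' eps He.
  destruct (Hf' eps He) as [e [He1 He2]].
  exists (Rmin d e). split. { now apply Rmin_pos. }
  intros h Hh. rewrite Rabs_pos_eq by apply Cmod_ge_0.
  assert (Hhd : Cmod h < d) by (apply Rlt_le_trans with (1 := Hh); apply Rmin_l).
  assert (Hhe : Cmod h < e) by (apply Rlt_le_trans with (1 := Hh); apply Rmin_r).
  assert (Hh0 := Cmod_ge_0 h).
  set (g := fun w => (f w + (- f' z * (w - z) + (- (l / 2)) * ((w - z) * (w - z))))%C).
  set (g' := fun w => (f' w + (- f' z + (- l) * (w - z)))%C).
  assert (Small : forall t, 0 <= t <= 1 -> Cmod (t * h) <= Cmod h).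
  { intros t Ht. rewrite Cmod_mult, Cmod_R, Rabs_pos_eq by lra. nra. }
  assert (B : Cmod (g (z + h)%C - g z) <= eps * Cmod h * Cmod h).
  { apply (complex_mvt g g').
    - intros t Ht. specialize (Small t Ht).
      set (w := (z + t * h)%C).
      unfold g, g'. apply cderiv_plus. apply Hf. lra.
      replace (- f' z + - l * (w - z))%C with
        ((0 * (w - z) + (- f' z) * 1) + (0 * ((w - z) * (w - z)) + (- (l / 2)) * (1 * (w - z) + (w - z) * 1)))%C
        by (field; intros Z; apply RtoC_inj in Z; lra).
      assert (D : cderiv (fun w => w - z)%C w 1).
      { replace (RtoC 1) with (1 + 0)%C by ring.
        apply (cderiv_plus (fun w => w) (fun _ => - z)%C). apply cderiv_id. apply cderiv_const. }
      apply (cderiv_plus (fun w => - f' z * (w - z))%C).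
      + apply (cderiv_mult (fun _ => - f' z)%C (fun w => w - z)%C). apply cderiv_const. exact D.
      + apply (cderiv_mult (fun _ => - (l / 2))%C (fun w => (w - z) * (w - z))%C). apply cderiv_const.
        apply (cderiv_mult (fun w => w - z)%C (fun w => w - z)%C); exact D.
    - intros t Ht. specialize (Small t Ht). specialize (He2 (t * h)%C ltac:(lra)).
      rewrite Rabs_pos_eq, pow_1 in He2 by apply Cmod_ge_0.
      unfold g'. replace (f' (z + t * h) + (- f' z + - l * (z + t * h - z)))%C with
        (f' (z + t * h)%C - f' z - l * (t * h))%C by ring.
      apply Rle_trans with (1 := He2). apply Rmult_le_compat_l; lra. }
  replace (f (z + h)%C - f z - f' z * h - l / 2 * (h * h))%C with (g (z + h)%C - g z)%C
    by (unfold g; ring).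
  apply Rle_trans with (1 := B). right. ring.
Qed.

(** * Second-order expansions of functions of class C^2 *)

Lemma is_derive_line (g : R -> R) (x h t l : R) :
  is_derive g (x + t * h) l -> is_derive (fun t => g (x + t * h)) t (h * l).
Proof.
  intros H. apply (is_derive_comp g (fun t => x + t * h)). exact H.
  auto_derive. exact I. ring.
Qed.

Lemma is_derive_minus_poly (g : R -> R) (t l c1 c2 : R) :
  is_derive g t l -> is_derive (fun t => g t - c1 * t - c2 * t ^ 2) t (l - c1 - 2 * c2 * t).
Proof.
  intros H.
  apply (is_derive_minus (V := R_NormedModule) (fun t => g t - c1 * t) (fun t => c2 * t ^ 2)).
  - apply (is_derive_minus (V := R_NormedModule) g (fun t => c1 * t)). exact H.
    auto_derive. exact I. ring.
  - auto_derive. exact I. ring.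
Qed.

(** Mean value theorem applied to b minus its second-order polynomial. *)
Lemma first_order_bound (b db : R -> R) (x h m M : R) :
  (forall t, 0 <= t <= 1 -> is_derive b (x + t * h) (db (x + t * h))) ->
  (forall t, 0 <= t <= 1 -> Rabs (db (x + t * h) - db x - m * (t * h)) <= M) ->
  Rabs (b (x + h) - b x - db x * h - m / 2 * h ^ 2) <= M * Rabs h.
Proof.
  intros H1 H2.
  assert (X := mvt_bound (fun t => b (x + t * h) - (db x * h) * t - (m / 2 * h ^ 2) * t ^ 2)
    (fun t => h * db (x + t * h) - db x * h - 2 * (m / 2 * h ^ 2) * t) (M * Rabs h)).
  cbv beta in X. rewrite Rmult_1_l, Rmult_0_l, Rplus_0_r in X.
  replace (b (x + h) - b x - db x * h - m / 2 * h ^ 2) with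
    (b (x + h) - db x * h * 1 - m / 2 * h ^ 2 * 1 ^ 2 - (b x - db x * h * 0 - m / 2 * h ^ 2 * 0 ^ 2))
    by ring.
  apply X.
  - intros t Ht. apply is_derive_minus_poly. apply is_derive_line. now apply H1.
  - intros t Ht.
    replace (h * db (x + t * h) - db x * h - 2 * (m / 2 * h ^ 2) * t)
      with ((db (x + t * h) - db x - m * (t * h)) * h) by field.
    rewrite Rabs_mult. apply Rmult_le_compat_r. apply Rabs_pos. now apply H2.
Qed.

Lemma taylor2_R_derive (b db : R -> R) (x m d : R) : 0 < d ->
  (forall s, Rabs s < d -> is_derive b (x + s) (db (x + s))) ->
  is_derive db x m -> taylor2_R b x (db x) m.
Proof.
  intros Hd Hb Hdb eps He.
  apply is_derive_Reals in Hdb. destruct (Hdb eps He) as [e He2].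
  exists (Rmin d e). split. { apply Rmin_pos; [exact Hd | apply cond_pos]. }
  intros h Hh.
  assert (Hh1 : Rabs h < d) by (apply Rlt_le_trans with (1 := Hh); apply Rmin_l).
  assert (Hh2 : Rabs h < e) by (apply Rlt_le_trans with (1 := Hh); apply Rmin_r).
  assert (Hh0 := Rabs_pos h).
  assert (Small : forall t, 0 <= t <= 1 -> Rabs (t * h) <= Rabs h).
  { intros t Ht. rewrite Rabs_mult, Rabs_pos_eq by lra. nra. }
  replace (eps * h ^ 2) with (eps * Rabs h * Rabs h).
  2:{ rewrite <- (pow2_abs h). ring. }
  apply first_order_bound.
  - intros t Ht. apply Hb. specialize (Small t Ht). lra.
  - intros t Ht. specialize (Small t Ht).
    destruct (Req_dec (t * h) 0) as [E | N].
    + rewrite E. replace (db (x + 0) - db x - m * 0) with 0 by (rewrite Rplus_0_r; ring).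
      rewrite Rabs_R0. apply Rmult_le_pos; lra.
    + specialize (He2 (t * h) N ltac:(lra)).
      replace (db (x + t * h) - db x - m * (t * h))
        with (((db (x + t * h) - db x) / (t * h) - m) * (t * h)) by (field; split; intros Z; apply N; rewrite Z; ring).
      apply Rabs_mult_le; lra.
Qed.

Lemma second_order_bound (b db ddb : R -> R) (x h m eps : R) :
  (forall t, 0 <= t <= 1 -> is_derive b (x + t * h) (db (x + t * h))) ->
  (forall t, 0 <= t <= 1 -> is_derive db (x + t * h) (ddb (x + t * h))) ->
  (forall t, 0 <= t <= 1 -> Rabs (ddb (x + t * h) - m) <= eps) ->
  Rabs (b (x + h) - b x - db x * h - m / 2 * h ^ 2) <= eps * h ^ 2.
Proof.
  intros H1 H2 H3.
  replace (eps * h ^ 2) with (eps * Rabs h * Rabs h).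
  2:{ rewrite <- (pow2_abs h). ring. }
  apply first_order_bound; [exact H1|].
  intros t Ht.
  assert (He : 0 <= eps) by (apply Rle_trans with (2 := H3 t Ht); apply Rabs_pos).
  assert (X := mvt_bound (fun s => db (x + s * (t * h)) - (m * (t * h)) * s - 0 * s ^ 2)
    (fun s => (t * h) * ddb (x + s * (t * h)) - m * (t * h) - 2 * 0 * s) (eps * Rabs h)).
  cbv beta in X. replace (x + 1 * (t * h)) with (x + t * h) in X by ring.
  replace (x + 0 * (t * h)) with x in X by ring.
  replace (db (x + t * h) - db x - m * (t * h)) with
    (db (x + t * h) - m * (t * h) * 1 - 0 * 1 ^ 2 - (db x - m * (t * h) * 0 - 0 * 0 ^ 2)) by ring.
  assert (Q : forall s, 0 <= s <= 1 -> 0 <= s * t <= 1) by (intros s Hs; nra).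
  apply X.
  - intros s Hs. apply is_derive_minus_poly. apply is_derive_line.
    replace (s * (t * h)) with (s * t * h) by ring. apply H2. auto.
  - intros s Hs. specialize (H3 (s * t) (Q s Hs)). replace (s * (t * h)) with (s * t * h) by ring.
    replace (t * h * ddb (x + s * t * h) - m * (t * h) - 2 * 0 * s)
      with ((ddb (x + s * t * h) - m) * (t * h)) by ring.
    apply Rabs_mult_le; [exact H3|]. rewrite Rabs_mult, Rabs_pos_eq by lra. generalize (Rabs_pos h); nra.
Qed.

Lemma Cmod_le_coords (s t x y : R) : Rabs s <= Rabs x -> Rabs t <= Rabs y ->
  Cmod (s, t) <= Cmod (x, y).
Proof.
  intros Hs Ht. unfold Cmod; simpl. apply sqrt_le_1_alt.
  assert (Rsqr s <= Rsqr x) by now apply Rsqr_le_abs_1.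
  assert (Rsqr t <= Rsqr y) by now apply Rsqr_le_abs_1. unfold Rsqr in *. lra.
Qed.

Lemma continuous_R_bound (f : C -> R) (z : C) (eps : R) : 0 < eps -> continuous f z ->
  exists d, 0 < d /\ forall h, Cmod h < d -> Rabs (f (z + h)%C - f z) < eps.
Proof.
  intros He Hf. apply (proj1 (locally_Cmod z (fun w => Rabs (f w - f z) < eps))).
  exact (Hf _ (locally_ball (f z) (mkposreal eps He))).
Qed.

(** Expand first in x on the horizontal line through the end point, then in y on the vertical line
    through z; the first expansion involves d_dx f at a point above z, which is expanded in y as
    well. *)
Lemma class_C2_taylor2 (U : C -> Prop) (f : C -> R) (z : C) :
  open U -> U z -> class_C 2 U f ->
  taylor2 f z (d_dx f z, - d_dy f z)
    ((d_dx (d_dx f) z - d_dy (d_dy f) z) / 4, - d_dy (d_dx f) z / 2) (laplacian f z).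
Proof.
  intros HU Uz (D1 & (D2 & Cxx & Cxy) & (D3 & _ & Cyy)) eps He.
  destruct (proj1 (locally_Cmod z U) (HU z Uz)) as [d0 [Hd0 HU0]].
  assert (He3 : 0 < eps / 3) by lra.
  destruct (continuous_R_bound _ z _ He3 (Cxx z Uz)) as [d1 [Hd1 B1]].
  destruct (continuous_R_bound _ z _ He3 (Cxy z Uz)) as [d2 [Hd2 B2]].
  destruct (continuous_R_bound _ z _ He3 (Cyy z Uz)) as [d3 [Hd3 B3]].
  set (d := Rmin (Rmin d0 d1) (Rmin d2 d3)).
  assert (Hd : 0 < d) by (unfold d; repeat apply Rmin_pos; assumption).
  exists d. split; [exact Hd|]. intros [x y] Hh.
  assert (Hd' : d <= d0 /\ d <= d1 /\ d <= d2 /\ d <= d3).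
  { unfold d. generalize (Rmin_l (Rmin d0 d1) (Rmin d2 d3)) (Rmin_r (Rmin d0 d1) (Rmin d2 d3))
      (Rmin_l d0 d1) (Rmin_r d0 d1) (Rmin_l d2 d3) (Rmin_r d2 d3). lra. }
  destruct z as [x0 y0].
  assert (N : forall s t, Rabs s <= Rabs x -> Rabs t <= Rabs y ->
    let w := (x0 + s, y0 + t) : C in U w /\
    Rabs (d_dx (d_dx f) w - d_dx (d_dx f) (x0, y0)) <= eps / 3 /\
    Rabs (d_dy (d_dx f) w - d_dy (d_dx f) (x0, y0)) <= eps / 3 /\
    Rabs (d_dy (d_dy f) w - d_dy (d_dy f) (x0, y0)) <= eps / 3).
  { intros s t Hs Ht w. assert (Hc := Cmod_le_coords s t x y Hs Ht).
    assert (E : w = ((x0, y0) + (s, t))%C) by reflexivity. rewrite E.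
    split; [apply HU0; lra|]. repeat split; left; [apply B1 | apply B2 | apply B3]; lra. }
  assert (S : forall t h, 0 <= t <= 1 -> Rabs (t * h) <= Rabs h).
  { intros t h Ht. rewrite Rabs_mult, Rabs_pos_eq by lra. generalize (Rabs_pos h); nra. }
  assert (Z : forall h, Rabs 0 <= Rabs h) by (intros h; rewrite Rabs_R0; apply Rabs_pos).
  assert (X1 := second_order_bound (fun s => f (s, y0 + y)) (fun s => d_dx f (s, y0 + y))
    (fun s => d_dx (d_dx f) (s, y0 + y)) x0 x (d_dx (d_dx f) (x0, y0)) (eps / 3)).
  assert (X2 := second_order_bound (fun s => f (x0, s)) (fun s => d_dy f (x0, s))
    (fun s => d_dy (d_dy f) (x0, s)) y0 y (d_dy (d_dy f) (x0, y0)) (eps / 3)).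
  assert (X3 := mvt_bound (fun t => d_dx f (x0, y0 + t * y) - (d_dy (d_dx f) (x0, y0) * y) * t - 0 * t ^ 2)
    (fun t => y * d_dy (d_dx f) (x0, y0 + t * y) - d_dy (d_dx f) (x0, y0) * y - 2 * 0 * t) (eps / 3 * Rabs y)).
  assert (Y1 : Rabs (f (x0 + x, y0 + y) - f (x0, y0 + y) - d_dx f (x0, y0 + y) * x
                 - d_dx (d_dx f) (x0, y0) / 2 * x ^ 2) <= eps / 3 * x ^ 2).
  { apply X1; intros t Ht; destruct (N (t * x) y (S t x Ht) (Rle_refl _)) as [Uw [Bw _]].
    - exact (Derive_correct _ _ (proj1 (D1 _ Uw))).
    - exact (Derive_correct _ _ (proj1 (D2 _ Uw))).
    - exact Bw. }
  assert (Y2 : Rabs (f (x0, y0 + y) - f (x0, y0) - d_dy f (x0, y0) * y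
                 - d_dy (d_dy f) (x0, y0) / 2 * y ^ 2) <= eps / 3 * y ^ 2).
  { apply X2; intros t Ht; destruct (N 0 (t * y) (Z x) (S t y Ht)) as [Uw [_ [_ Bw]]];
    rewrite Rplus_0_r in *.
    - exact (Derive_correct _ _ (proj2 (D1 _ Uw))).
    - exact (Derive_correct _ _ (proj2 (D3 _ Uw))).
    - exact Bw. }
  assert (Y3 : Rabs (d_dx f (x0, y0 + y) - d_dx f (x0, y0) - d_dy (d_dx f) (x0, y0) * y) <= eps / 3 * Rabs y).
  { cbv beta in X3. replace (y0 + 1 * y) with (y0 + y) in X3 by ring.
    replace (y0 + 0 * y) with y0 in X3 by ring.
    replace (d_dx f (x0, y0 + y) - d_dx f (x0, y0) - d_dy (d_dx f) (x0, y0) * y) with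
      (d_dx f (x0, y0 + y) - d_dy (d_dx f) (x0, y0) * y * 1 - 0 * 1 ^ 2 -
       (d_dx f (x0, y0) - d_dy (d_dx f) (x0, y0) * y * 0 - 0 * 0 ^ 2)) by ring.
    apply X3; intros t Ht; destruct (N 0 (t * y) (Z x) (S t y Ht)) as [Uw [_ [Bw _]]];
    rewrite Rplus_0_r in *.
    - apply is_derive_minus_poly. apply (is_derive_line (fun s => d_dx f (x0, s))).
      exact (Derive_correct _ _ (proj2 (D2 _ Uw))).
    - replace (y * d_dy (d_dx f) (x0, y0 + t * y) - d_dy (d_dx f) (x0, y0) * y - 2 * 0 * t)
        with ((d_dy (d_dx f) (x0, y0 + t * y) - d_dy (d_dx f) (x0, y0)) * y) by ring.
      apply Rabs_mult_le; [exact Bw | lra]. }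
  unfold laplacian. rewrite Cmod2_alt. unfold Re, Im; simpl fst; simpl snd.
  change ((x0, y0) + (x, y))%C with ((x0 + x, y0 + y) : C).
  match goal with |- Rabs ?e <= _ => replace e with
    ((f (x0 + x, y0 + y) - f (x0, y0 + y) - d_dx f (x0, y0 + y) * x - d_dx (d_dx f) (x0, y0) / 2 * x ^ 2)
    + (f (x0, y0 + y) - f (x0, y0) - d_dy f (x0, y0) * y - d_dy (d_dy f) (x0, y0) / 2 * y ^ 2)
    + (d_dx f (x0, y0 + y) - d_dx f (x0, y0) - d_dy (d_dx f) (x0, y0) * y) * x) by (simpl; field) end.
  assert (Y4 : Rabs ((d_dx f (x0, y0 + y) - d_dx f (x0, y0) - d_dy (d_dx f) (x0, y0) * y) * x)
    <= eps / 3 * Rabs y * Rabs x) by (apply Rabs_mult_le; [exact Y3 | lra]).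
  apply Rle_trans with (1 := Rabs_triang _ _).
  apply Rle_trans with ((eps / 3 * x ^ 2 + eps / 3 * y ^ 2) + eps / 3 * Rabs y * Rabs x).
  { apply Rplus_le_compat; [|exact Y4]. apply Rle_trans with (1 := Rabs_triang _ _). lra. }
  rewrite <- (pow2_abs x), <- (pow2_abs y).
  generalize (Rabs_pos x) (Rabs_pos y). set (X := Rabs x). set (Y := Rabs y). intros PX PY.
  assert (0 <= (X - Y) ^ 2) by apply pow2_ge_0.
  assert (Q : Y * X <= X ^ 2 + Y ^ 2) by nra.
  replace (eps / 3 * Y * X) with (eps / 3 * (Y * X)) by ring.
  assert (eps / 3 * (Y * X) <= eps / 3 * (X ^ 2 + Y ^ 2)) by (apply Rmult_le_compat_l; lra).
  assert (0 <= X ^ 2) by apply pow2_ge_0. assert (0 <= Y ^ 2) by apply pow2_ge_0.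
  assert (0 <= eps / 3 * (X ^ 2 + Y ^ 2)) by (apply Rmult_le_pos; lra). nra.
Qed.

Lemma taylor2_R_ln (x : R) : 0 < x -> taylor2_R ln x (/ x) (- / x ^ 2).
Proof.
  intros Hx. apply (taylor2_R_derive ln Rinv x _ x Hx).
  - intros s Hs. apply is_derive_Reals, derivable_pt_lim_ln.
    apply Rabs_def2 in Hs. lra.
  - auto_derive. lra. field. lra.
Qed.

Lemma is_derive_ln_comp (g : R -> R) (t l : R) : 0 < g t -> is_derive g t l ->
  is_derive (fun t => ln (g t)) t (l / g t).
Proof.
  intros Hg H. apply (is_derive_comp ln g t (/ g t) l); [|exact H].
  apply is_derive_Reals, derivable_pt_lim_ln, Hg.
Qed.

Lemma Derive2_ln_comp (g : R -> R) (x d : R) : 0 < d ->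
  (forall s, Rabs (s - x) < d -> 0 < g s /\ ex_derive g s) -> ex_derive (Derive g) x ->
  Derive (Derive (fun s => ln (g s))) x = Derive (Derive g) x / g x - Derive g x ^ 2 / g x ^ 2.
Proof.
  intros Hd Hg Hdg.
  destruct (Hg x) as [P Q]. { rewrite Rminus_diag, Rabs_R0. exact Hd. }
  rewrite (Derive_ext_loc _ (fun s => Derive g s / g s)).
  2:{ exists (mkposreal d Hd). intros s Hs. destruct (Hg s Hs) as [Ps Qs].
      apply is_derive_unique, is_derive_ln_comp; [exact Ps | exact (Derive_correct _ _ Qs)]. }
  assert (NZ : g x <> 0) by lra.
  replace (Derive (Derive g) x / g x - Derive g x ^ 2 / g x ^ 2) with
    ((Derive (Derive g) x * g x - Derive g x * Derive g x) / g x ^ 2) by (field; exact NZ).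
  apply is_derive_unique.
  exact (is_derive_div _ _ x _ _ (Derive_correct _ _ Hdg) (Derive_correct _ _ Q) NZ).
Qed.

Lemma has_lap_ln (U : C -> Prop) (f : C -> R) (z : C) :
  open U -> U z -> (forall w, U w -> 0 < f w) -> class_C 2 U f ->
  has_lap (fun w => ln (f w)) z (laplacian (fun w => ln (f w)) z).
Proof.
  intros HU Uz Hpos Hf.
  assert (T := taylor2_comp1 ln f z _ _ _ _ _ (taylor2_R_ln _ (Hpos z Uz)) (class_C2_taylor2 U f z HU Uz Hf)).
  do 2 eexists.
  replace (laplacian (fun w => ln (f w)) z) with
    (/ f z * laplacian f z + - / f z ^ 2 * Cmod (d_dx f z, - d_dy f z) ^ 2); [exact T|]. clear T.
  destruct Hf as (D1 & (D2 & _) & (D3 & _)).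
  destruct (proj1 (locally_Cmod z U) (HU z Uz)) as [d [Hd HU0]].
  destruct z as [x y]. assert (Hz := Hpos _ Uz).
  assert (L1 : Derive (Derive (fun s => ln (f (s, y)))) x =
    d_dx (d_dx f) (x, y) / f (x, y) - d_dx f (x, y) ^ 2 / f (x, y) ^ 2).
  { apply (Derive2_ln_comp (fun s => f (s, y)) x d Hd); [|exact (proj1 (D2 _ Uz))].
    intros s Hs. assert (Us : U (s, y)).
    { replace (s, y) with (Cplus (x, y) (s - x, 0)) by (unfold Cplus; simpl; f_equal; ring).
      apply HU0. apply Rle_lt_trans with (2 := Hs). apply Rle_trans with (1 := Cmod_le_sum _).
      unfold Re, Im; simpl. rewrite Rabs_R0. lra. }
    split; [now apply Hpos | exact (proj1 (D1 _ Us))]. }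
  assert (L2 : Derive (Derive (fun s => ln (f (x, s)))) y =
    d_dy (d_dy f) (x, y) / f (x, y) - d_dy f (x, y) ^ 2 / f (x, y) ^ 2).
  { apply (Derive2_ln_comp (fun s => f (x, s)) y d Hd); [|exact (proj2 (D3 _ Uz))].
    intros s Hs. assert (Us : U (x, s)).
    { replace (x, s) with (Cplus (x, y) (0, s - y)) by (unfold Cplus; simpl; f_equal; ring).
      apply HU0. apply Rle_lt_trans with (2 := Hs). apply Rle_trans with (1 := Cmod_le_sum _).
      unfold Re, Im; simpl. rewrite Rabs_R0. lra. }
    split; [now apply Hpos | exact (proj2 (D1 _ Us))]. }
  change (laplacian (fun w => ln (f w)) (x, y)) with
    (Derive (Derive (fun s => ln (f (s, y)))) x + Derive (Derive (fun s => ln (f (x, s)))) y).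
  rewrite L1, L2, Cmod2_alt. unfold laplacian, Re, Im; simpl fst; simpl snd. field. lra.
Qed.

(** * Maxima on compact plane sets *)

Lemma list_argmax (A : Type) (P : A -> Prop) (F : A -> R) (l : list A) :
  (exists t, List.In t l /\ P t) ->
  exists m, P m /\ forall t, List.In t l -> P t -> F t <= F m.
Proof.
  induction l as [|a l IH].
  - intros [t [[] _]].
  - intros [t [Ht Pt]].
    destruct (classic (exists t, List.In t l /\ P t)) as [H | H].
    + destruct (IH H) as [m [Pm Hm]].
      destruct (classic (P a /\ F m < F a)) as [[Pa La] | N].
      * exists a. split; [exact Pa|]. intros s [<- | Hs] Ps; [lra|]. specialize (Hm s Hs Ps). lra.
      * exists m. split; [exact Pm|]. intros s [<- | Hs] Ps; [|auto].
        apply Rnot_lt_le. tauto.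
    + exists t. split; [exact Pt|]. intros s Hs Ps.
      destruct Ht as [<- | Ht]; [|exfalso; eauto].
      destruct Hs as [<- | Hs]; [lra | exfalso; eauto].
Qed.

(** If every value on K were exceeded, a finite cover of a bounding square by neighbourhoods on
    which F is dominated by a single larger value would give a largest dominating value, itself
    dominated. *)
Lemma extreme_value (K : C -> Prop) (F : C -> R) (M : R) :
  (exists z, K z) -> (forall z, K z -> Cmod z <= M) -> closedC K ->
  (forall z, K z -> continuous F z) ->
  exists m, K m /\ forall z, K z -> F z <= F m.
Proof.
  intros [z0 Kz0] HM HC HF. apply NNPP. intros Hno.
  assert (Hbig : forall z, K z -> exists z', K z' /\ F z < F z').
  { intros z Kz. apply NNPP. intros N. apply Hno. exists z. split; [exact Kz|].
    intros w Kw. apply Rnot_lt_le. intros L. apply N. eauto. }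
  assert (Hloc : forall t : C, exists p : posreal * C,
    (K t -> K (snd p) /\ forall z, Cmod (z - t) < 2 * fst p -> F z < F (snd p)) /\
    (~ K t -> forall z, Cmod (z - t) < 2 * fst p -> ~ K z)).
  { intros t. destruct (classic (K t)) as [Kt | Nt].
    - destruct (Hbig t Kt) as [t' [Kt' Lt]].
      destruct (continuous_R_bound F t (F t' - F t) ltac:(lra) (HF t Kt)) as [d [Hd B]].
      exists (mkposreal (d / 2) ltac:(lra), t'). split; [|tauto]. intros _. simpl. split; [exact Kt'|].
      intros z Hz. specialize (B (z - t)%C ltac:(lra)).
      replace (t + (z - t))%C with z in B by ring. apply Rabs_def2 in B. lra.
    - assert (X : exists eps, 0 < eps /\ forall y, Cmod (y - t) < eps -> ~ K y).
      { apply NNPP. intros N. apply Nt, HC. intros eps He. apply NNPP. intros N'.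
        apply N. exists eps. split; [exact He|]. intros y Hy Ky. apply N'. eauto. }
      destruct X as [d [Hd B]].
      exists (mkposreal (d / 2) ltac:(lra), t). split; [tauto|]. intros _ z. simpl. intros Hz. apply B. lra. }
  destruct (functional_choice _ Hloc) as [p Hp].
  apply (compactness_list 2 (- M, (- M, tt)) (M, (M, tt))
    (fun t => fst (p (fst t, fst (snd t))))).
  intros [l Hl].
  set (tr := fun t : R * (R * unit) => (fst t, fst (snd t)) : C).
  assert (Hl' : forall z, K z -> exists t, List.In t l /\ K (tr t) /\ F z < F (snd (p (tr t)))).
  { intros [x y] Kz. assert (Hxy := HM _ Kz).
    assert (Hx := re_le_Cmod (x, y)). assert (Hy := im_le_Cmod (x, y)).
    change (Re (x, y)) with x in Hx. change (Im (x, y)) with y in Hy.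
    apply Rle_trans with (2 := Hxy) in Hx. apply Rle_trans with (2 := Hxy) in Hy.
    apply Rabs_le_between in Hx. apply Rabs_le_between in Hy.
    destruct (Hl (x, (y, tt))) as [[t1 [t2 u]] [Hin [_ Hcl]]].
    { simpl. tauto. }
    simpl in Hcl. destruct Hcl as [C1 [C2 _]].
    exists (t1, (t2, u)). split; [exact Hin|].
    unfold tr; simpl. destruct (Hp (t1, t2)) as [P1 P2].
    assert (D : Cmod ((x, y) - (t1, t2)) < 2 * fst (p (t1, t2))).
    { apply Rle_lt_trans with (1 := Cmod_le_sum _).
      change (Rabs (x - t1) + Rabs (y - t2) < 2 * fst (p (t1, t2))). lra. }
    assert (Kt : K (t1, t2)).
    { apply NNPP. intros N. exact (P2 N _ D Kz). }
    split; [exact Kt|]. now apply P1. }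
  destruct (list_argmax _ (fun t => K (tr t)) (fun t => F (snd (p (tr t)))) l) as [m [Km Hm]].
  { destruct (Hl' z0 Kz0) as [t [T1 [T2 _]]]. eauto. }
  destruct (Hp (tr m)) as [P1 _]. destruct (P1 Km) as [Kw _].
  destruct (Hl' _ Kw) as [t [T1 [T2 T3]]]. specialize (Hm t T1 T2). lra.
Qed.

(** * The hyperbolic metric solves the curvature equation *)

Lemma continuous_Cmod_sub (q z : C) : continuous (fun z => Cmod (z - q)) z.
Proof.
  apply (continuous_comp (fun z => z - q)%C Cmod). 2: apply continuous_Cmod.
  apply (cderiv_continuous _ _ 1).
  apply (cderiv_ext _ (fun z => z + - q)%C z _ 1 Rlt_0_1). reflexivity.
  replace (RtoC 1) with (1 + 0)%C by ring. apply cderiv_plus. apply cderiv_id. apply cderiv_const.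
Qed.

Lemma continuous_mult_R (f g : C -> R) (z : C) :
  continuous f z -> continuous g z -> continuous (fun z => f z * g z) z.
Proof. apply (continuous_mult (K := R_AbsRing)). Qed.

Lemma continuous_comp_R (g : R -> R) (f : C -> R) (z : C) (l : R) :
  continuous f z -> is_derive g (f z) l -> continuous (fun z => g (f z)) z.
Proof.
  intros Hf Hg. apply (continuous_comp f g). exact Hf.
  apply (ex_derive_continuous (V := R_NormedModule)). exists l. exact Hg.
Qed.

Lemma continuous_inv_R (f : C -> R) (z : C) :
  continuous f z -> f z <> 0 -> continuous (fun z => / f z) z.
Proof.
  intros Hf Hz. apply (continuous_comp_R Rinv f z (- / (f z) ^ 2)). exact Hf.
  auto_derive. exact Hz. field. exact Hz.
Qed.

Lemma continuous_pos (f : C -> R) (z : C) : continuous f z -> 0 < f z ->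
  exists d, 0 < d /\ forall h, Cmod h < d -> 0 < f (z + h)%C.
Proof.
  intros Hf Hz. destruct (continuous_R_bound f z (f z) Hz Hf) as [d [Hd B]].
  exists d. split; [exact Hd|]. intros h Hh. specialize (B h Hh). apply Rabs_def2 in B. lra.
Qed.

(** The covering map with a fixed derivative, and the regularity of the density that the covering
    property provides. All local computations with [lamO] are done in the disk through this data. *)
Definition disk_uniformization (Omega : C -> Prop) (lamO : C -> R) (pi dpi : C -> C) : Prop :=
  (forall z, unit_disk z -> Omega (pi z)) /\
  (forall w, Omega w -> exists z, unit_disk z /\ pi z = w) /\
  (forall z, unit_disk z -> cderiv pi z (dpi z)) /\
  (forall z, unit_disk z -> lamO (pi z) * Cmod (dpi z) = lambda_disk z) /\
  (forall w, Omega w -> continuous lamO w).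

Lemma unit_disk_open (z : C) : unit_disk z -> exists d, 0 < d /\
  forall h, Cmod h < d -> unit_disk (z + h)%C.
Proof.
  unfold unit_disk. intros Hz. exists (1 - Cmod z). split; [lra|].
  intros h Hh. apply Rle_lt_trans with (1 := Cmod_triangle _ _). lra.
Qed.

Lemma lambda_disk_pos (z : C) : unit_disk z -> 0 < 1 - Cmod z ^ 2 /\ 0 < lambda_disk z.
Proof.
  unfold unit_disk, lambda_disk. intros Hz. assert (H := Cmod_ge_0 z).
  assert (X : 0 < 1 - Cmod z ^ 2) by nra. split; [exact X|]. now apply Rinv_0_lt_compat.
Qed.

Lemma unit_disk_cderiv_cderiv (f df : C -> C) :
  (forall z, unit_disk z -> cderiv f z (df z)) ->
  forall z, unit_disk z -> exists l, cderiv df z l.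
Proof.
  intros H z Hz. destruct (unit_disk_open z Hz) as [d [Hd B]].
  apply (cderiv_cderiv f df z d Hd). intros w Hw. apply H.
  replace w with (z + (w - z))%C by ring. now apply B.
Qed.

(** Continuity of the density: on an evenly covered set it is lambda_D / |pi'| composed with a
    continuous local section of pi. *)
Lemma hyperbolic_metric_uniformization (Omega : C -> Prop) (lamO : C -> R) :
  hyperbolic_metric Omega lamO -> exists pi dpi, disk_uniformization Omega lamO pi dpi.
Proof.
  intros (pi & (Hhol & Hc & Hsurj & Hcov) & Hlam).
  assert (D : forall z, unit_disk z -> cderiv pi z (C_derive pi z)).
  { intros z Hz. apply is_derive_cderiv. apply C_derive_correct. exact z. now apply Hhol. }
  exists pi, (C_derive pi). split; [|split; [|split; [|split]]]; auto.
  - intros z Hz. now apply Hc.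
  - intros w Hw. destruct (Hsurj w Hw) as [z0 [Hz0 Ez0]].
    destruct (Hcov w Hw) as (U & HU & Uw & _ & J & V & _ & Hiff & _ & Hhom).
    destruct (proj1 (Hiff z0)) as [i Vi]. { split; [exact Hz0|]. now rewrite Ez0. }
    destruct (Hhom i) as (_ & g & Hg & _ & Hpg).
    assert (G : forall u, U u -> unit_disk (g u)).
    { intros u Uu. apply (proj2 (Hiff (g u))). exists i. now apply Hg. }
    set (F := fun z => / (1 - Cmod z ^ 2) * / Cmod (C_derive pi z)).
    assert (E : forall u, U u -> F (g u) = lamO u).
    { intros u Uu. unfold F. fold (lambda_disk (g u)).
      rewrite <- (Hlam (g u) (G u Uu)), (Hpg u Uu).
      field. intros Z. assert (X := Hlam (g u) (G u Uu)). rewrite Z, Rmult_0_r in X.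
      destruct (lambda_disk_pos _ (G u Uu)). lra. }
    assert (CF : continuous F (g w)).
    { assert (Dg := G w Uw). destruct (lambda_disk_pos _ Dg) as [P1 P2].
      apply continuous_mult_R; apply continuous_inv_R.
      - apply (continuous_comp_R (fun x => 1 - x ^ 2) Cmod _ (- 2 * Cmod (g w))).
        apply continuous_Cmod. auto_derive. exact I. ring.
      - lra.
      - destruct (unit_disk_cderiv_cderiv _ _ D _ Dg) as [l Hl].
        apply (continuous_comp (C_derive pi) Cmod). exact (cderiv_continuous _ _ _ Hl).
        apply continuous_Cmod.
      - intros Z. assert (X := Hlam (g w) Dg). rewrite Z, Rmult_0_r in X. lra. }
    apply (continuous_ext_loc _ (fun u => F (g u))).
    + destruct (proj1 (locally_Cmod w U) (HU w Uw)) as [d [Hd B]].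
      apply (proj2 (locally_Cmod w _)). exists d. split; [exact Hd|]. intros h Hh. apply E, B, Hh.
    + apply (continuous_comp g F); [|exact CF]. now apply Hg.
Qed.

Lemma uniformization_pos (Omega : C -> Prop) (lamO : C -> R) (pi dpi : C -> C) (z : C) :
  disk_uniformization Omega lamO pi dpi -> unit_disk z ->
  0 < lamO (pi z) /\ 0 < Cmod (dpi z).
Proof.
  intros (_ & _ & _ & H & _) Hz. specialize (H z Hz).
  destruct (lambda_disk_pos z Hz) as [_ P]. rewrite <- H in P.
  assert (N := Cmod_ge_0 (dpi z)).
  destruct (Req_dec (Cmod (dpi z)) 0) as [E | E]; [rewrite E in P; lra|].
  assert (0 < Cmod (dpi z)) by lra. split; [|assumption].
  apply Rmult_lt_reg_r with (Cmod (dpi z)); lra.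
Qed.

Lemma has_lap_ln_one_minus (z : C) (r2 : R) : Cmod z ^ 2 < r2 ->
  has_lap (fun z => ln (r2 - Cmod z ^ 2)) z (- 4 * r2 / (r2 - Cmod z ^ 2) ^ 2).
Proof.
  intros Hz. set (t0 := Cmod z ^ 2) in *.
  assert (P : taylor2_R (fun t => ln (r2 - t)) (Cmod (z - 0) ^ 2) (- / (r2 - t0)) (- / (r2 - t0) ^ 2)).
  { replace (z - 0)%C with z by ring. fold t0.
    apply (taylor2_R_derive _ (fun t => - / (r2 - t)) t0 _ (r2 - t0)); [lra| |].
    - intros s Hs. apply Rabs_def2 in Hs. auto_derive. lra. field. lra.
    - auto_derive. lra. field. lra. }
  assert (H := has_lap_radial _ (RtoC 0) z _ _ P).
  replace (z - 0)%C with z in H by ring. fold t0 in H.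
  replace (- 4 * r2 / (r2 - t0) ^ 2) with (4 * - / (r2 - t0) + 4 * - / (r2 - t0) ^ 2 * t0) by (field; lra).
  apply (has_lap_ext _ _ z _ 1 Rlt_0_1) with (2 := H).
  intros h _. replace (z + h - 0)%C with (z + h)%C by ring. reflexivity.
Qed.

Lemma has_lap_ln_Cmod (z : C) : z <> 0 -> has_lap (fun z => ln (Cmod z)) z 0.
Proof.
  intros Hz. apply Cmod_gt_0 in Hz. set (t0 := Cmod z ^ 2).
  assert (Ht : 0 < t0) by (unfold t0; nra).
  assert (P : taylor2_R (fun t => / 2 * ln t) (Cmod (z - 0) ^ 2) (/ (2 * t0)) (- / (2 * t0 ^ 2))).
  { replace (z - 0)%C with z by ring. fold t0.
    apply (taylor2_R_derive _ (fun t => / (2 * t)) t0 _ t0); [lra| |].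
    - intros s Hs. apply Rabs_def2 in Hs. auto_derive. lra. field. lra.
    - auto_derive. lra. field. lra. }
  assert (H := has_lap_radial _ (RtoC 0) z _ _ P).
  replace (z - 0)%C with z in H by ring. fold t0 in H.
  replace (4 * / (2 * t0) + 4 * - / (2 * t0 ^ 2) * t0) with 0 in H by (field; lra).
  apply (has_lap_ext _ _ z _ (Cmod z) Hz) with (2 := H).
  intros h Hh. replace (z + h - 0)%C with (z + h)%C by ring.
  assert (X : 0 < Cmod (z + h)).
  { generalize (Cmod_rev_triangle z (z + h)). replace (z - (z + h))%C with (- h)%C by ring.
    rewrite Cmod_opp. lra. }
  rewrite ln_pow by exact X. simpl. field.
Qed.

(** In the disk, ln (lamO o pi) = - ln (1 - |z|^2) - ln |pi'|, and ln |pi'| is harmonic because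
    pi' is holomorphic without zeros. *)
Lemma has_lap_pullback (Omega : C -> Prop) (lamO : C -> R) (pi dpi : C -> C) (z : C) :
  disk_uniformization Omega lamO pi dpi -> unit_disk z ->
  has_lap (fun z => ln (lamO (pi z))) z (4 * (lamO (pi z) * Cmod (dpi z)) ^ 2).
Proof.
  intros Hu Hz. assert (Hpos := fun z => uniformization_pos _ _ _ _ z Hu).
  destruct Hu as (_ & _ & D & Hlam & _).
  assert (X : forall z, exists l, unit_disk z -> cderiv dpi z l).
  { intros w. destruct (classic (unit_disk w)) as [Hw | Hw].
    - destruct (unit_disk_cderiv_cderiv _ _ D w Hw) as [l Hl]. exists l. auto.
    - exists 0. tauto. }
  destruct (functional_choice _ X) as [ddpi D2].
  destruct (unit_disk_cderiv_cderiv _ _ D2 z Hz) as [l Hl].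
  destruct (unit_disk_open z Hz) as [d [Hd B]].
  assert (E2 : ctaylor2 dpi z (ddpi z) (l / 2)%C).
  { apply (cderiv_ctaylor2 dpi ddpi z l d Hd); [|exact Hl]. intros h Hh. apply D2, B, Hh. }
  assert (N : dpi z <> 0) by (apply Cmod_gt_0; now apply Hpos).
  assert (H1 := has_lap_comp _ dpi z _ _ _ E2 (has_lap_ln_Cmod _ N)).
  assert (P := lambda_disk_pos z Hz).
  assert (H2 := has_lap_ln_one_minus z 1 ltac:(lra)).
  assert (H := has_lap_plus _ _ _ _ _ (has_lap_scal (-1) _ _ _ H1) (has_lap_scal (-1) _ _ _ H2)).
  cbv beta in H.
  rewrite (Hlam z Hz). unfold lambda_disk.
  replace (4 * (/ (1 - Cmod z ^ 2)) ^ 2) with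
    (-1 * (Cmod (ddpi z) ^ 2 * 0) + -1 * (-4 * 1 / (1 - Cmod z ^ 2) ^ 2)) by (field; lra).
  apply (has_lap_ext _ _ z _ d Hd) with (2 := H).
  intros h Hh. assert (Hw := B h Hh). set (w := (z + h)%C) in *.
  destruct (Hpos w Hw) as [P1 P2]. destruct (lambda_disk_pos w Hw) as [P3 P4].
  replace (lamO (pi w)) with (/ (1 - Cmod w ^ 2) * / Cmod (dpi w)).
  - rewrite ln_mult, !ln_Rinv by (try apply Rinv_0_lt_compat; assumption). ring.
  - fold (lambda_disk w). rewrite <- (Hlam w Hw). field. lra.
Qed.

Lemma uniformization_ctaylor2 (Omega : C -> Prop) (lamO : C -> R) (pi dpi : C -> C) (z : C) :
  disk_uniformization Omega lamO pi dpi -> unit_disk z -> exists B, ctaylor2 pi z (dpi z) B.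
Proof.
  intros (_ & _ & D & _) Hz.
  destruct (unit_disk_cderiv_cderiv _ _ D z Hz) as [l Hl].
  destruct (unit_disk_open z Hz) as [d [Hd B]].
  exists (l / 2)%C. apply (cderiv_ctaylor2 pi dpi z l d Hd); [|exact Hl]. intros h Hh. apply D, B, Hh.
Qed.

(** The equation Lap (ln lamO) = 4 lamO^2 in a form that needs no derivatives of [lamO] itself: at
    a local extremum of ln lamO - phi the comparison is carried out after pulling back by pi, and
    the factor |pi'|^2 cancels. The sign c selects maximum or minimum. *)
Lemma hyperbolic_extremum_test (Omega : C -> Prop) (lamO : C -> R) (phi : C -> R) (w : C) (c l d : R) :
  hyperbolic_metric Omega lamO -> Omega w -> 0 < d -> has_lap phi w l ->
  (forall h, Cmod h < d ->
     c * (ln (lamO (w + h)%C) - phi (w + h)%C) <= c * (ln (lamO w) - phi w)) ->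
  c * (4 * lamO w ^ 2 - l) <= 0.
Proof.
  intros Hhyp Hw Hd Hphi Hmax.
  destruct (hyperbolic_metric_uniformization _ _ Hhyp) as (pi & dpi & Hu).
  destruct (proj1 (proj2 Hu) w Hw) as [z [Hz Ez]]. subst w.
  destruct (uniformization_ctaylor2 _ _ _ _ z Hu Hz) as [B HB].
  destruct (uniformization_pos _ _ _ _ z Hu Hz) as [P1 P2].
  assert (H1 := has_lap_comp phi pi z _ _ _ HB Hphi).
  assert (H2 := has_lap_pullback _ _ _ _ z Hu Hz).
  assert (H := has_lap_scal c _ _ _ (has_lap_plus _ _ _ _ _ H2 (has_lap_scal (-1) _ _ _ H1))).
  cbv beta in H.
  destruct (proj1 (continuous_C_iff pi z) (cderiv_continuous _ _ _ (proj1 (proj2 (proj2 Hu)) z Hz)) d Hd)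
    as [e [He Be]].
  assert (Y : c * (4 * (lamO (pi z) * Cmod (dpi z)) ^ 2 + -1 * (Cmod (dpi z) ^ 2 * l)) <= 0).
  { apply (has_lap_max _ z _ e He) with (2 := H). intros h Hh. specialize (Hmax _ (Be h Hh)).
    replace (pi z + (pi (z + h)%C - pi z))%C with (pi (z + h)%C) in Hmax by ring. lra. }
  apply Rmult_le_reg_r with (Cmod (dpi z) ^ 2); [nra|]. rewrite Rmult_0_l. lra.
Qed.

Lemma hyperbolic_pos (Omega : C -> Prop) (lamO : C -> R) (w : C) :
  hyperbolic_metric Omega lamO -> Omega w -> 0 < lamO w /\ continuous lamO w.
Proof.
  intros Hhyp Hw. destruct (hyperbolic_metric_uniformization _ _ Hhyp) as (pi & dpi & Hu).
  split.
  - destruct (proj1 (proj2 Hu) w Hw) as [z [Hz <-]]. now apply (uniformization_pos _ _ _ _ z Hu).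
  - now apply Hu.
Qed.

Lemma positive_part_open (Omega : C -> Prop) (lam : C -> R) :
  open Omega -> conformal_pseudometric Omega lam -> open (positive_part Omega lam).
Proof.
  intros HO (_ & Hc & _) z [Hz Hp].
  destruct (proj1 (locally_Cmod z Omega) (HO z Hz)) as [d [Hd B]].
  destruct (continuous_pos lam z (Hc z Hz) Hp) as [e [He B']].
  apply (proj2 (locally_Cmod z _)). exists (Rmin d e). split; [now apply Rmin_pos|].
  intros h Hh. split; [apply B | apply B'].
  apply Rlt_le_trans with (1 := Hh), Rmin_l. apply Rlt_le_trans with (1 := Hh), Rmin_r.
Qed.

Lemma curvature_has_lap (Omega : C -> Prop) (lam : C -> R) (w : C) :
  open Omega -> conformal_pseudometric Omega lam -> curvature_le Omega lam (-4) ->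
  Omega w -> 0 < lam w ->
  exists l, has_lap (fun w => ln (lam w)) w l /\ 4 * lam w ^ 2 <= l.
Proof.
  intros HO Hlam Hcurv Hw Hp. assert (Uw : positive_part Omega lam w) by now split.
  exists (laplacian (fun w => ln (lam w)) w). split.
  - apply (has_lap_ln (positive_part Omega lam)); auto.
    + now apply positive_part_open.
    + intros z [_ Hz]. exact Hz.
    + apply Hlam.
  - specialize (Hcurv w Uw). unfold gauss_curvature in Hcurv.
    assert (P : 0 < lam w ^ 2) by now apply pow_lt.
    apply Rmult_le_compat_r with (r := lam w ^ 2) in Hcurv; [|lra].
    unfold Rdiv in Hcurv. rewrite Rmult_assoc, Rinv_l in Hcurv by lra. lra.
Qed.

(** * Ahlfors' lemma and the strong maximum principle *)

Lemma closedC_le (G : C -> R) (c : R) : (forall z, continuous G z) -> closedC (fun z => G z <= c).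
Proof.
  intros HG z H. apply Rnot_lt_le. intros L.
  destruct (continuous_R_bound G z (G z - c) ltac:(lra) (HG z)) as [d [Hd B]].
  destruct (H d Hd) as [y [Hy1 Hy2]]. specialize (B (y - z)%C Hy2).
  replace (z + (y - z))%C with y in B by ring. apply Rabs_def2 in B. lra.
Qed.

Lemma closedC_ge (G : C -> R) (c : R) : (forall z, continuous G z) -> closedC (fun z => c <= G z).
Proof.
  intros HG z H.
  assert (X := closedC_le (fun z => - G z) (- c)). cbv beta in X.
  apply Ropp_le_cancel, X.
  - intros w. apply (continuous_opp (V := R_NormedModule)), HG.
  - intros e He. destruct (H e He) as [y [Hy1 Hy2]]. exists y. split; [lra | exact Hy2].
Qed.

Lemma closedC_and (P Q : C -> Prop) : closedC P -> closedC Q -> closedC (fun z => P z /\ Q z).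
Proof.
  intros HP HQ z H. split; [apply HP | apply HQ]; intros e He; destruct (H e He) as [y [[Py Qy] Hy]]; eauto.
Qed.

Lemma pseudometric_continuous (Omega : C -> Prop) (lam : C -> R) (w : C) :
  conformal_pseudometric Omega lam -> Omega w -> 0 <= lam w /\ continuous lam w.
Proof. intros (H1 & H2 & _) Hw. auto. Qed.

Lemma exp_le_mono (x y : R) : x <= y -> exp x <= exp y.
Proof. intros [H | ->]; [left; now apply exp_increasing | apply Rle_refl]. Qed.

(** Ahlfors' argument. In the disk, compare lam (pi z) |pi' z| with the density r / (r^2 - |z|^2)
    of a smaller concentric disk, which blows up on the boundary, so that the quotient has an
    interior maximum; there the curvature bounds force the quotient to be at most 1. Up to the
    factor r, F below is this quotient. *)
Theorem ahlfors_lemma (Omega : C -> Prop) (lam lamO : C -> R) (w : C) :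
  open Omega -> hyperbolic_metric Omega lamO ->
  conformal_pseudometric Omega lam -> curvature_le Omega lam (-4) ->
  Omega w -> lam w <= lamO w.
Proof.
  intros HO Hhyp Hlam Hcurv Hw. apply Rnot_lt_le. intros Hlt.
  destruct (hyperbolic_metric_uniformization _ _ Hhyp) as (pi & dpi & Hu).
  destruct (proj1 (proj2 Hu) w Hw) as [z0 [Hz0 E0]]. subst w.
  assert (Upos := fun z => uniformization_pos _ _ _ _ z Hu).
  assert (HD := proj1 (proj2 (proj2 Hu))). assert (Hid := proj1 (proj2 (proj2 (proj2 Hu)))).
  assert (HO' := proj1 Hu).
  assert (Cpi : forall z, unit_disk z -> continuous pi z).
  { intros z Hz. exact (cderiv_continuous _ _ _ (HD z Hz)). }
  assert (Cdpi : forall z, unit_disk z -> continuous (fun z => Cmod (dpi z)) z).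
  { intros z Hz. destruct (unit_disk_cderiv_cderiv _ _ HD z Hz) as [l Hl].
    apply (continuous_comp dpi Cmod). exact (cderiv_continuous _ _ _ Hl). apply continuous_Cmod. }
  assert (Clam : forall z, unit_disk z -> continuous (fun z => lam (pi z)) z).
  { intros z Hz. apply (continuous_comp pi lam). now apply Cpi. apply (pseudometric_continuous Omega lam _ Hlam). now apply HO'. }
  set (mu0 := lam (pi z0) * Cmod (dpi z0)). set (t0 := Cmod z0 ^ 2).
  destruct (Upos z0 Hz0) as [P1 P2]. destruct (lambda_disk_pos z0 Hz0) as [P3 P4]. fold t0 in P3.
  assert (Hmu : / (1 - t0) < mu0).
  { unfold mu0, t0. fold (lambda_disk z0). rewrite <- Hid by exact Hz0. apply Rmult_lt_compat_r; assumption. }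
  assert (Hi : 0 < / (1 - t0)) by now apply Rinv_0_lt_compat.
  (* with this squared radius F z0 = 1; it is below 1 because lam exceeds lamO at pi z0 *)
  set (r2 := t0 + / mu0).
  assert (Hr1 : r2 < 1).
  { unfold r2. assert (/ mu0 < / / (1 - t0)) by (apply Rinv_lt_contravar; [apply Rmult_lt_0_compat; lra | exact Hmu]).
    rewrite Rinv_inv in H. lra. }
  assert (Ht0 : t0 < r2) by (unfold r2; assert (0 < / mu0) by (apply Rinv_0_lt_compat; lra); lra).
  assert (Ht00 : 0 <= t0) by (unfold t0; apply pow2_ge_0).
  set (K := fun z => Cmod z ^ 2 <= r2).
  assert (Csq : forall z, continuous (fun z => Cmod z ^ 2) z).
  { intros z. apply (continuous_comp_R (fun x => x ^ 2) Cmod _ (2 * Cmod z)).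
    apply continuous_Cmod. auto_derive. exact I. ring. }
  assert (KD : forall z, K z -> unit_disk z).
  { intros z Hz. unfold K in Hz. unfold unit_disk. assert (N := Cmod_ge_0 z). nra. }
  set (F := fun z => lam (pi z) * Cmod (dpi z) * (r2 - Cmod z ^ 2)).
  assert (CG : forall z, continuous (fun z => r2 - Cmod z ^ 2) z).
  { intros z. apply (continuous_minus (V := R_NormedModule)). apply continuous_const. apply Csq. }
  destruct (extreme_value K F 1) as [m [Km Hm]].
  - exists z0. unfold K. fold t0. lra.
  - intros z Hz. left. now apply KD.
  - now apply closedC_le.
  - intros z Hz. apply KD in Hz. apply continuous_mult_R; [|apply CG].
    apply continuous_mult_R; auto.
  - assert (F0 : F z0 = 1). { unfold F. fold mu0 t0. unfold r2. field. lra. }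
    assert (Fm : 1 <= F m). { rewrite <- F0. apply Hm. unfold K. fold t0. lra. }
    assert (Hmd := KD m Km). destruct (Upos m Hmd) as [Q1 Q2].
    destruct (pseudometric_continuous _ _ _ Hlam (HO' m Hmd)) as [Q3 _].
    set (t := Cmod m ^ 2).
    assert (Hrt : 0 < r2 - t /\ 0 < lam (pi m)).
    { unfold K in Km. fold t in Km. unfold F in Fm. fold t in Fm.
      assert (N : 0 <= lam (pi m) * Cmod (dpi m)) by (apply Rmult_le_pos; lra).
      destruct (Req_dec (r2 - t) 0) as [E | E]; [rewrite E in Fm; lra|].
      destruct (Req_dec (lam (pi m)) 0) as [E' | E']; [rewrite E' in Fm; lra|]. lra. }
    destruct Hrt as [Hrt Hl].
    destruct (curvature_has_lap _ _ _ HO Hlam Hcurv (HO' m Hmd) Hl) as [L [HL1 HL2]].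
    destruct (uniformization_ctaylor2 _ _ _ _ m Hu Hmd) as [B HB].
    assert (L1 := has_lap_comp _ pi m _ _ _ HB HL1).
    assert (L2 := has_lap_pullback _ _ _ _ m Hu Hmd).
    destruct (lambda_disk_pos m Hmd) as [Q4 Q5]. fold t in Q4.
    assert (L3 := has_lap_ln_one_minus m 1 ltac:(fold t; lra)).
    assert (L4 := has_lap_ln_one_minus m r2 ltac:(fold t; lra)).
    assert (LL := has_lap_plus _ _ _ _ _ (has_lap_plus _ _ _ _ _ L1 (has_lap_scal (-1) _ _ _ L2))
                    (has_lap_plus _ _ _ _ _ (has_lap_scal (-1) _ _ _ L3) L4)).
    cbv beta in LL. rewrite (Hid m Hmd) in LL. fold t in LL.
    destruct (continuous_pos _ m (CG m) Hrt) as [d1 [Hd1 B1]].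
    destruct (continuous_pos _ m (Clam m Hmd) Hl) as [d2 [Hd2 B2]].
    assert (Ineq : Cmod (dpi m) ^ 2 * L + -1 * (4 * lambda_disk m ^ 2) +
      (-1 * (-4 * 1 / (1 - t) ^ 2) + -4 * r2 / (r2 - t) ^ 2) <= 0).
    { apply (has_lap_max _ m _ (Rmin d1 d2) (Rmin_pos _ _ Hd1 Hd2)) with (2 := LL). intros h Hh.
      assert (Hh1 : 0 < r2 - Cmod (m + h) ^ 2) by (apply B1, Rlt_le_trans with (1 := Hh), Rmin_l).
      assert (Hh2 : 0 < lam (pi (m + h)%C)) by (apply B2, Rlt_le_trans with (1 := Hh), Rmin_r).
      assert (E : forall z, 0 < r2 - Cmod z ^ 2 -> 0 < lam (pi z) ->
        ln (lam (pi z)) + -1 * ln (lamO (pi z)) + (-1 * ln (1 - Cmod z ^ 2) + ln (r2 - Cmod z ^ 2)) = ln (F z)).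
      { intros z Z1 Z2. assert (Dz : unit_disk z) by (apply KD; unfold K; lra).
        destruct (Upos z Dz) as [U1 U2]. destruct (lambda_disk_pos z Dz) as [U3 _].
        assert (I := Hid z Dz). unfold F.
        assert (E : Cmod (dpi z) = / (1 - Cmod z ^ 2) * / lamO (pi z)).
        { fold (lambda_disk z). rewrite <- I. field. lra. }
        rewrite E. assert (V1 := Rinv_0_lt_compat _ U3). assert (V2 := Rinv_0_lt_compat _ U1).
        assert (V3 := Rmult_lt_0_compat _ _ V1 V2). assert (V4 := Rmult_lt_0_compat _ _ Z2 V3).
        rewrite !ln_mult, !ln_Rinv by assumption. ring. }
      rewrite (E _ Hh1 Hh2), (E m Hrt Hl).
      assert (Kmh : K (m + h)%C) by (unfold K; lra).
      apply ln_le; [|exact (Hm _ Kmh)].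
      unfold F. apply Rmult_lt_0_compat; [|exact Hh1]. apply Rmult_lt_0_compat; [exact Hh2|].
      apply (Upos (m + h)%C). now apply KD. }
    unfold lambda_disk in Ineq. fold t in Ineq.
    replace (Cmod (dpi m) ^ 2 * L + -1 * (4 * (/ (1 - t)) ^ 2) +
      (-1 * (-4 * 1 / (1 - t) ^ 2) + -4 * r2 / (r2 - t) ^ 2)) with
      (Cmod (dpi m) ^ 2 * L - 4 * r2 / (r2 - t) ^ 2) in Ineq by (field; split; lra).
    assert (P6 : 0 <= Cmod (dpi m) ^ 2) by apply pow2_ge_0.
    assert (Q : Cmod (dpi m) ^ 2 * (4 * lam (pi m) ^ 2) <= Cmod (dpi m) ^ 2 * L)
      by (apply Rmult_le_compat_l; assumption).
    assert (P7 : 0 < (r2 - t) ^ 2) by now apply pow_lt.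
    assert (S : Cmod (dpi m) ^ 2 * (4 * lam (pi m) ^ 2) * (r2 - t) ^ 2 <= 4 * r2 / (r2 - t) ^ 2 * (r2 - t) ^ 2)
      by (apply Rmult_le_compat_r; lra).
    replace (4 * r2 / (r2 - t) ^ 2 * (r2 - t) ^ 2) with (4 * r2) in S by (field; lra).
    replace (Cmod (dpi m) ^ 2 * (4 * lam (pi m) ^ 2) * (r2 - t) ^ 2) with (4 * F m ^ 2) in S
      by (unfold F; fold t; ring).
    nra.
Qed.

(** Put w = ln (lamO / lam), which is nonnegative by Ahlfors' lemma. Its Laplacian is at most 4
    lamO^2 (1 - exp (- 2 w)) <= 8 lamO^2 w, so w is a supersolution of the linear equation Lap b =
    8 lamO^2 b and dominates every subsolution that it dominates on the boundary. The conclusion w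
    >= b is stated in exponential form, which is meaningful where [lam] vanishes. *)
Lemma comparison_principle (Omega : C -> Prop) (lam lamO b : C -> R) (K : C -> Prop) (M : R) :
  open Omega -> hyperbolic_metric Omega lamO ->
  conformal_pseudometric Omega lam -> curvature_le Omega lam (-4) ->
  (forall z, K z -> Omega z) -> (forall z, K z -> Cmod z <= M) -> closedC K ->
  (forall z, K z -> continuous b z) ->
  (forall z, K z -> lam z * exp (b z) <= lamO z \/
     exists d l, 0 < d /\ (forall h, Cmod h < d -> K (z + h)%C) /\ has_lap b z l /\
       (0 < b z -> 8 * lamO z ^ 2 * b z <= l)) ->
  forall z, K z -> lam z * exp (b z) <= lamO z.
Proof.
  intros HO Hhyp Hlam Hcurv HK HM HC Hb Hbd z Kz.
  assert (Pos := fun w => hyperbolic_pos _ _ w Hhyp).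
  set (F := fun z => lam z * exp (b z) * / lamO z).
  assert (CF : forall z, K z -> continuous F z).
  { intros y Ky. destruct (Pos y (HK y Ky)) as [P1 P2].
    apply continuous_mult_R. apply continuous_mult_R.
    - apply (pseudometric_continuous Omega lam _ Hlam). now apply HK.
    - apply (continuous_comp_R exp b y (exp (b y))). now apply Hb.
      apply is_derive_Reals, derivable_pt_lim_exp.
    - apply continuous_inv_R; [exact P2 | lra]. }
  destruct (extreme_value K F M) as [m [Km Hm]]; auto. { eauto. }
  assert (Om := HK m Km). destruct (Pos m Om) as [P1 P2].
  assert (Fz : F m <= 1 -> lam z * exp (b z) <= lamO z).
  { intros H. assert (X := Rle_trans _ _ _ (Hm z Kz) H). unfold F in X.
    destruct (Pos z (HK z Kz)) as [Q1 _].
    apply Rmult_le_reg_r with (/ lamO z). now apply Rinv_0_lt_compat. rewrite Rinv_r by lra. exact X. }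
  apply Fz. apply Rnot_lt_le. intros HF.
  assert (HF' : lamO m < lam m * exp (b m)).
  { unfold F in HF. apply Rmult_lt_reg_r with (/ lamO m). now apply Rinv_0_lt_compat.
    rewrite Rinv_r by lra. exact HF. }
  destruct (Hbd m Km) as [H | (d & l & Hd & HKd & Hl & Hbl)]; [lra|].
  assert (Hle := ahlfors_lemma _ _ _ m HO Hhyp Hlam Hcurv Om).
  destruct (pseudometric_continuous _ _ _ Hlam Om) as [Q1 Q2].
  assert (Hlm : 0 < lam m).
  { destruct Q1 as [Q1 | Q1]; [exact Q1|]. rewrite <- Q1 in HF'. lra. }
  assert (Hb0 : 0 < b m).
  { apply Rnot_le_lt. intros N. assert (exp (b m) <= 1).
    { rewrite <- exp_0. now apply exp_le_mono. }
    nra. }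
  specialize (Hbl Hb0).
  destruct (curvature_has_lap _ _ _ HO Hlam Hcurv Om Hlm) as [L [HL1 HL2]].
  destruct (continuous_pos lam m Q2 Hlm) as [e [He B]].
  assert (T := hyperbolic_extremum_test Omega lamO _ m (-1) _ (Rmin d e) Hhyp Om (Rmin_pos _ _ Hd He)
    (has_lap_plus _ _ _ _ _ HL1 Hl)). cbv beta in T.
  assert (T' : -1 * (4 * lamO m ^ 2 - (L + l)) <= 0).
  { apply T. intros h Hh.
    assert (Kh : K (m + h)%C) by (apply HKd, Rlt_le_trans with (1 := Hh), Rmin_l).
    assert (Ph : 0 < lam (m + h)%C) by (apply B, Rlt_le_trans with (1 := Hh), Rmin_r).
    assert (E : forall y, K y -> 0 < lam y -> ln (lam y) + b y - ln (lamO y) = ln (F y)).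
    { intros y Ky Py. destruct (Pos y (HK y Ky)) as [R1 _]. unfold F.
      assert (R2 := exp_pos (b y)). assert (R3 := Rinv_0_lt_compat _ R1).
      rewrite !ln_mult, ln_Rinv, ln_exp by (try apply Rmult_lt_0_compat; assumption). ring. }
    assert (E1 := E m Km Hlm). assert (E2 := E _ Kh Ph).
    assert (X : ln (F (m + h)%C) <= ln (F m)).
    { apply ln_le; [|exact (Hm _ Kh)]. unfold F.
      destruct (Pos _ (HK _ Kh)) as [R1 _].
      apply Rmult_lt_0_compat; [|now apply Rinv_0_lt_compat].
      apply Rmult_lt_0_compat; [exact Ph | apply exp_pos]. }
    lra. }
  (* lam > lamO e^{-b} gives lam^2 > lamO^2 (1 - 2 b) *)
  assert (Hsq : lamO m ^ 2 * (1 - 2 * b m) < lam m ^ 2).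
  { assert (R : lamO m * exp (- b m) < lam m).
    { apply Rmult_lt_reg_r with (exp (b m)). apply exp_pos.
      rewrite Rmult_assoc, <- exp_plus. replace (- b m + b m) with 0 by ring.
      rewrite exp_0. lra. }
    assert (R2 : 0 < lamO m * exp (- b m)) by (apply Rmult_lt_0_compat; [lra | apply exp_pos]).
    assert (R3 : (lamO m * exp (- b m)) ^ 2 < lam m ^ 2) by nra.
    assert (R4 : (lamO m * exp (- b m)) ^ 2 = lamO m ^ 2 * exp (- 2 * b m)).
    { replace (- 2 * b m) with (- b m + - b m) by ring. rewrite exp_plus. ring. }
    assert (R5 := exp_ineq1_le (- 2 * b m)).
    assert (R6 : 0 < lamO m ^ 2) by now apply pow_lt.
    rewrite R4 in R3. apply Rle_lt_trans with (2 := R3). apply Rmult_le_compat_l; lra. }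
  nra.
Qed.

Lemma has_lap_gauss (q z : C) (c al k : R) :
  has_lap (fun z => c * (exp (- al * Cmod (z - q) ^ 2) - k)) z
    (4 * c * al * exp (- al * Cmod (z - q) ^ 2) * (al * Cmod (z - q) ^ 2 - 1)).
Proof.
  set (t0 := Cmod (z - q) ^ 2).
  assert (P : taylor2_R (fun t => c * (exp (- al * t) - k)) t0 (- al * c * exp (- al * t0)) (al ^ 2 * c * exp (- al * t0))).
  { apply (taylor2_R_derive _ (fun t => - al * c * exp (- al * t)) t0 _ 1); [lra| |].
    - intros s _. auto_derive. exact I. ring.
    - auto_derive. exact I. ring. }
  assert (H := has_lap_radial _ q z _ _ P). fold t0 in H.
  replace (4 * c * al * exp (- al * t0) * (al * t0 - 1)) with
    (4 * (- al * c * exp (- al * t0)) + 4 * (al ^ 2 * c * exp (- al * t0)) * t0) by ring.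
  exact H.
Qed.

(** Strong maximum principle. Around q, where the inequality is strict, the gap is at least a
    constant on a small disk; on the surrounding annulus the radial function c (exp (- al |z-q|^2)
    - exp (- al r^2)) is, for al large, a subsolution for [comparison_principle] vanishing on the
    outer circle and positive inside. *)
Lemma strict_inequality_spreads (Omega : C -> Prop) (lam lamO : C -> R) (q p : C) (r : R) :
  open Omega -> hyperbolic_metric Omega lamO ->
  conformal_pseudometric Omega lam -> curvature_le Omega lam (-4) ->
  (forall z, Cmod (z - q) <= r -> Omega z) ->
  lam q < lamO q -> Cmod (p - q) < r -> lam p < lamO p.
Proof.
  intros HO Hhyp Hlam Hcurv HB Hq Hp.
  assert (Hr : 0 < r) by (generalize (Cmod_ge_0 (p - q)); lra).
  assert (Oq : Omega q).
  { apply HB. replace (q - q)%C with (RtoC 0) by ring. rewrite Cmod_0. lra. }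
  assert (Pos := fun w => hyperbolic_pos _ _ w Hhyp).
  destruct (Pos q Oq) as [P1 P2].
  destruct (pseudometric_continuous _ _ _ Hlam Oq) as [Q1 Q2].
  (* the ratio stays below some k < 1 on a small disk *)
  set (k := (1 + lam q / lamO q) / 2).
  assert (Rq : 0 <= lam q / lamO q < 1).
  { split. apply Rmult_le_pos; [lra|]. left; now apply Rinv_0_lt_compat.
    apply Rmult_lt_reg_r with (lamO q); [lra|]. unfold Rdiv. rewrite Rmult_assoc, Rinv_l; lra. }
  assert (Hk : / 2 <= k < 1) by (unfold k; lra).
  assert (Hcont : continuous (fun z => k * lamO z - lam z) q).
  { apply (continuous_minus (V := R_NormedModule) (fun z => k * lamO z) lam).
    apply (continuous_mult_R (fun _ => k)). apply continuous_const. exact P2. exact Q2. }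
  assert (Hk1 : 0 < k * lamO q - lam q).
  { replace (lam q) with (lam q / lamO q * lamO q) by (field; lra). unfold k. nra. }
  destruct (continuous_pos _ q Hcont Hk1) as [d [Hd Bd]].
  set (rho := Rmin d r / 2).
  assert (Hrho : 0 < rho /\ rho < d /\ rho < r).
  { unfold rho. generalize (Rmin_pos d r Hd Hr) (Rmin_l d r) (Rmin_r d r). lra. }
  assert (Near : forall z, Cmod (z - q) <= rho -> lam z <= k * lamO z).
  { intros z Hz. specialize (Bd (z - q)%C ltac:(lra)). replace (q + (z - q))%C with z in Bd by ring. lra. }
  destruct (Rle_or_lt (Cmod (p - q)) rho) as [Hp1 | Hp1].
  { specialize (Near p Hp1). assert (Op : Omega p) by (apply HB; lra).
    destruct (Pos p Op) as [P3 _]. nra. }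
  set (K := fun z => rho <= Cmod (z - q) /\ Cmod (z - q) <= r).
  assert (KO : forall z, K z -> Omega z) by (intros z [_ Hz]; now apply HB).
  assert (Kc : closedC K).
  { apply closedC_and. apply closedC_ge. apply continuous_Cmod_sub. apply closedC_le. apply continuous_Cmod_sub. }
  assert (Kb : forall z, K z -> Cmod z <= r + Cmod q).
  { intros z [_ Hz]. replace z with ((z - q) + q)%C by ring. apply Rle_trans with (1 := Cmod_triangle _ _). lra. }
  assert (Kp : K p) by (split; lra).
  destruct (extreme_value K lamO (r + Cmod q)) as [m [Km Hm]]; eauto.
  { intros z Kz. apply Pos. now apply KO. }
  set (La := lamO m) in *.
  (* al (al |z-q|^2 - 1) >= 2 La^2 outside the disk of radius rho *)
  set (al := (1 + 2 * La ^ 2) / rho ^ 2 + 1).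
  assert (HL2 : 0 <= La ^ 2) by apply pow2_ge_0.
  assert (Hrho2 : 0 < rho ^ 2) by (apply pow_lt; lra).
  assert (Hal : 1 <= al).
  { unfold al. assert (0 <= (1 + 2 * La ^ 2) / rho ^ 2); [|lra].
    apply Rmult_le_pos; [lra|]. left. now apply Rinv_0_lt_compat. }
  assert (Halr : al * rho ^ 2 = 1 + 2 * La ^ 2 + rho ^ 2) by (unfold al; field; lra).
  set (c := - ln k).
  assert (Hc : 0 < c). { unfold c. assert (ln k < 0) by (rewrite <- ln_1; apply ln_increasing; lra). lra. }
  set (b := fun z => c * (exp (- al * Cmod (z - q) ^ 2) - exp (- al * r ^ 2))).
  assert (Cb : forall z, continuous b z).
  { intros z. apply (continuous_comp_R (fun t => c * (exp (- al * t ^ 2) - exp (- al * r ^ 2)))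
      (fun z => Cmod (z - q)) z (c * (- al * (2 * Cmod (z - q)) * exp (- al * Cmod (z - q) ^ 2)))).
    apply continuous_Cmod_sub. auto_derive. exact I. simpl. ring. }
  assert (Hbc : forall z, b z <= c * exp (- al * Cmod (z - q) ^ 2)).
  { intros z. unfold b. generalize (exp_pos (- al * r ^ 2)). nra. }
  assert (Main : lam p * exp (b p) <= lamO p).
  { apply (comparison_principle Omega lam lamO b K (r + Cmod q)); auto.
    intros z Kz. assert (Kz' := Kz). destruct Kz as [[Kz1 | Kz1] [Kz2 | Kz2]].
    - right. set (e := Rmin (Cmod (z - q) - rho) (r - Cmod (z - q))).
      assert (He : 0 < e) by (apply Rmin_pos; lra).
      exists e. eexists. split; [exact He|]. split.
      { intros h Hh.
        destruct (Rmin_Rgt_l _ _ _ Hh) as [Hh1 Hh2].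
        replace (z + h)%C with (q + (z - q + h))%C by ring. unfold K.
        replace (q + (z - q + h) - q)%C with (z - q + h)%C by ring.
        assert (T1 := Cmod_triangle (z - q) h). assert (T2 := Cmod_rev_triangle (z - q) (z - q + h)).
        replace (z - q - (z - q + h))%C with (- h)%C in T2 by ring. rewrite Cmod_opp in T2. lra. }
      split; [apply has_lap_gauss|]. intros Hb0.
      specialize (Hbc z). specialize (Hm z Kz').
      destruct (Pos z (KO z Kz')) as [P3 _].
      set (E := exp (- al * Cmod (z - q) ^ 2)) in *. assert (HE : 0 < E) by apply exp_pos.
      assert (Hz2 : rho ^ 2 <= Cmod (z - q) ^ 2) by (apply pow_incr; lra).
      assert (S1 : lamO z ^ 2 <= La ^ 2) by (apply pow_incr; lra).
      assert (S2 : 2 * La ^ 2 <= al * Cmod (z - q) ^ 2 - 1) by nra.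
      assert (S3 : 8 * lamO z ^ 2 * b z <= 8 * La ^ 2 * (c * E)).
      { assert (0 <= lamO z ^ 2) by apply pow2_ge_0.
        rewrite !Rmult_assoc. apply Rmult_le_compat_l; [lra|].
        apply Rmult_le_compat; lra. }
      apply Rle_trans with (1 := S3).
      assert (HcE : 0 < c * E) by now apply Rmult_lt_0_compat.
      replace (4 * c * al * E * (al * Cmod (z - q) ^ 2 - 1)) with
        ((c * E) * (4 * (al * (al * Cmod (z - q) ^ 2 - 1)))) by ring.
      replace (8 * La ^ 2 * (c * E)) with ((c * E) * (4 * (1 * (2 * La ^ 2)))) by ring.
      apply Rmult_le_compat_l; [lra|]. apply Rmult_le_compat_l; [lra|]. apply Rmult_le_compat; lra.
    - left. unfold b. rewrite Kz2. rewrite Rminus_diag, Rmult_0_r, exp_0, Rmult_1_r.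
      apply (ahlfors_lemma Omega); auto.
    - left. specialize (Near z ltac:(lra)).
      assert (exp (b z) <= / k).
      { replace (/ k) with (exp c) by (unfold c; rewrite exp_Ropp, exp_ln by lra; reflexivity).
        specialize (Hbc z).
        assert (exp (- al * Cmod (z - q) ^ 2) <= 1).
        { rewrite <- exp_0. left. apply exp_increasing. rewrite <- Kz1. nra. }
        assert (b z <= c) by nra.
        now apply exp_le_mono. }
      destruct (Pos z (KO z Kz')) as [P3 _].
      destruct (pseudometric_continuous _ _ _ Hlam (KO z Kz')) as [P4 _].
      apply Rle_trans with (lam z * / k). now apply Rmult_le_compat_l.
      apply Rmult_le_reg_r with k; [lra|]. rewrite Rmult_assoc, Rinv_l; lra.
    - lra. }
  assert (Hbp : 0 < b p).
  { unfold b. apply Rmult_lt_0_compat; [exact Hc|].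
    assert (exp (- al * r ^ 2) < exp (- al * Cmod (p - q) ^ 2)); [|lra].
    apply exp_increasing. assert (Cmod (p - q) ^ 2 < r ^ 2) by nra. nra. }
  assert (Op : Omega p) by now apply KO. destruct (Pos p Op) as [P3 _].
  destruct (pseudometric_continuous _ _ _ Hlam Op) as [P4 _].
  assert (1 < exp (b p)) by (rewrite <- exp_0; now apply exp_increasing).
  destruct P4 as [P4 | P4]; nra.
Qed.

(** By [strict_inequality_spreads], applied from and towards a point, the sets of strict
    inequality and of equality are both open. *)
Theorem ahlfors_dichotomy (Omega : C -> Prop) (lam lamO : C -> R) :
  open Omega -> connected Omega -> hyperbolic_metric Omega lamO ->
  conformal_pseudometric Omega lam -> curvature_le Omega lam (-4) ->
  (forall z, Omega z -> lam z = lamO z) \/ (forall z, Omega z -> lam z < lamO z).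
Proof.
  intros HO HC Hhyp Hlam Hcurv.
  destruct (classic (forall z, Omega z -> lam z = lamO z)) as [H | H]; [now left | right].
  intros z Oz. apply NNPP. intros Nz.
  assert (Le := fun w => ahlfors_lemma _ _ _ w HO Hhyp Hlam Hcurv).
  assert (Pos := fun w => hyperbolic_pos _ _ w Hhyp).
  assert (Ball : forall w, Omega w -> exists d, 0 < d /\ forall v, Cmod (v - w) < d -> Omega v).
  { intros w Ow. destruct (proj1 (locally_Cmod w Omega) (HO w Ow)) as [d [Hd B]].
    exists d. split; [exact Hd|]. intros v Hv. replace v with (w + (v - w))%C by ring. now apply B. }
  destruct (HC (fun w => Omega w /\ lam w < lamO w) (fun w => Omega w /\ lam w = lamO w)) as
    [w [_ [[_ W1] [_ W2]]]]; [| | | | |lra].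
  - intros w [Ow Lw]. destruct (Ball w Ow) as [d [Hd B]].
    apply (proj2 (locally_Cmod w _)). exists (d / 2). split; [lra|]. intros h Hh.
    split. { apply B. replace (w + h - w)%C with h by ring. lra. }
    apply (strict_inequality_spreads Omega lam lamO w _ (d / 2)); auto.
    + intros v Hv. apply B. lra.
    + replace (w + h - w)%C with h by ring. lra.
  - intros w [Ow Lw]. destruct (Ball w Ow) as [d [Hd B]].
    apply (proj2 (locally_Cmod w _)). exists (d / 4). split; [lra|]. intros h Hh.
    assert (Oh : Omega (w + h)%C) by (apply B; replace (w + h - w)%C with h by ring; lra).
    split; [exact Oh|].
    destruct (Le _ Oh) as [L | L]; [|exact L]. exfalso.
    assert (X : lam w < lamO w); [|lra].
    apply (strict_inequality_spreads Omega lam lamO (w + h)%C w (d / 2)); auto.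
    + intros v Hv. apply B. replace (v - w)%C with ((v - (w + h)) + h)%C by ring.
      apply Rle_lt_trans with (1 := Cmod_triangle _ _). lra.
    + replace (w - (w + h))%C with (- h)%C by ring. rewrite Cmod_opp. lra.
  - intros w Ow. destruct (Le w Ow); [left | right]; tauto.
  - apply not_all_ex_not in H. destruct H as [w Hw]. apply imply_to_and in Hw. destruct Hw as [Ow Nw].
    exists w. split; [exact Ow|]. split; [exact Ow|]. destruct (Le w Ow); tauto.
  - exists z. split; [exact Oz|]. split; [exact Oz|]. destruct (Le z Oz); tauto.
Qed.

(** * Behaviour at the puncture *)

(** Off the boundary, membership in Omega is locally constant; a function equal to -1 inside and 1
    outside is then continuous along the segment and cannot change sign. *)
Lemma segment_not_boundary (Omega : C -> Prop) (a b : C) :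
  (forall t, 0 <= t <= 1 -> ~ boundary Omega (a + RtoC t * (b - a))%C) -> Omega a -> Omega b.
Proof.
  intros Hnb Oa. apply NNPP. intros Nb.
  set (g := fun t : R => (a + RtoC t * (b - a))%C).
  set (f := fun t => if excluded_middle_informative (Omega (g t)) then -1 else 1).
  destruct (Ranalysis5.IVT_interv f 0 1) as [t [Ht Ft]].
  - intros t Ht. specialize (Hnb t Ht). fold (g t) in Hnb.
    apply not_all_ex_not in Hnb. destruct Hnb as [U HU]. apply imply_to_and in HU. destruct HU as [LU HU].
    assert (Lt : locally t (fun s => U (g s))) by exact (cont01_line a (b - a) t U LU).
    apply continuity_pt_filterlim.
    apply (continuous_ext_loc _ (fun _ => f t)); [|apply continuous_const].
    destruct Lt as [e He]. exists e. intros s Hs.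
    assert (Us := He s Hs). assert (Ut := He t (ball_center t e)).
    unfold f. destruct (excluded_middle_informative (Omega (g t)));
      destruct (excluded_middle_informative (Omega (g s))); try reflexivity; exfalso; apply HU; split; eauto.
  - lra.
  - unfold f. destruct (excluded_middle_informative (Omega (g 0))) as [_ | N]; [lra|].
    exfalso. apply N. unfold g. replace (a + 0 * (b - a))%C with a by ring. exact Oa.
  - unfold f. destruct (excluded_middle_informative (Omega (g 1))) as [Y | _]; [|lra].
    exfalso. apply Nb. unfold g in Y. replace (a + 1 * (b - a))%C with b in Y by ring. exact Y.
  - unfold f in Ft. destruct (excluded_middle_informative _); lra.
Qed.

Lemma boundary_open_notin (Omega : C -> Prop) (z : C) : open Omega -> boundary Omega z -> ~ Omega z.
Proof.
  intros HO Hb Oz. destruct (Hb Omega (HO z Oz)) as [_ [w [W1 W2]]]. exact (W2 W1).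
Qed.

Lemma isolated_boundary_punctured_disk (Omega : C -> Prop) :
  open Omega -> isolated_boundary_point Omega 0 ->
  exists r, 0 < r /\ forall z, 0 < Cmod z <= r -> Omega z.
Proof.
  intros HO [Hb Hi].
  destruct (proj1 (locally_Cmod 0 _) Hi) as [d [Hd B]].
  assert (NB : forall z : C, z <> 0 -> Cmod z < d -> ~ boundary Omega z).
  { intros z Hz Hzd. specialize (B z Hzd). rewrite Cplus_0_l in B. exact (B Hz). }
  assert (L : locally (RtoC 0) (fun z => Cmod z < d)).
  { apply (proj2 (locally_Cmod 0 _)). exists d. split; [exact Hd|]. intros h Hh.
    now rewrite Cplus_0_l. }
  destruct (Hb _ L) as [[w [Wd Ow]] _].
  assert (Hw : w <> 0) by (intros ->; exact (boundary_open_notin _ _ HO Hb Ow)).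
  assert (Step : forall a b, Cmod a < d -> Cmod b < d ->
     (forall t, 0 <= t <= 1 -> (a + RtoC t * (b - a))%C <> 0) -> Omega a -> Omega b).
  { intros a b Ha Hbd Hab. apply segment_not_boundary. intros t Ht. apply NB; [now apply Hab|].
    apply Rle_lt_trans with (Rmax (Cmod a) (Cmod b)); [|now apply Rmax_lub_lt].
    replace (a + t * (b - a))%C with (a + t * (b - a) - 0)%C by ring.
    apply Cmod_convex; [exact Ht | |].
    - replace (a - 0)%C with a by ring. apply Rmax_l.
    - replace (b - 0)%C with b by ring. apply Rmax_r. }
  assert (Indep : forall x y : R, (w * (x + y * Ci))%C = 0 -> x = 0 /\ y = 0).
  { intros x y E. destruct (classic ((x + y * Ci)%C = 0)) as [Z | Z].
    - assert (Z1 := f_equal fst Z). assert (Z2 := f_equal snd Z). simpl in Z1, Z2. lra.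
    - exfalso. revert E. now apply Cmult_neq_0. }
  exists (d / 2). split; [lra|]. intros z [Hz0 Hz1].
  assert (Hz : z <> 0) by now apply Cmod_gt_0.
  destruct (classic (forall t, 0 <= t <= 1 -> (w + RtoC t * (z - w))%C <> 0)) as [H | H].
  { apply (Step w z); auto; lra. }
  (* if the segment [w, z] meets 0, the detour through i w does not *)
  apply not_all_ex_not in H. destruct H as [t H]. apply imply_to_and in H. destruct H as [Ht E].
  apply NNPP in E.
  assert (Diw : Cmod (Ci * w) < d) by (rewrite Cmod_mult, Cmod_Ci, Rmult_1_l; exact Wd).
  apply (Step (Ci * w)%C); [exact Diw | lra | |].
  - intros s Hs E'. destruct (Indep (s * (1 - t)) (- (t * (1 - s)))) as [I1 I2].
    { rewrite RtoC_opp, !RtoC_mult, !RtoC_minus.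
      transitivity (s * (w + t * (z - w)) - t * (Ci * w + s * (z - Ci * w)))%C; [ring|].
      rewrite E, E'. ring. }
    destruct (Req_dec t 0) as [-> | N].
    + apply Hw. rewrite <- E. ring.
    + assert (s = 1) by nra. subst s. replace t with 1 in E by lra. apply Hz. rewrite <- E. ring.
  - apply (Step w); auto. intros s Hs E'. destruct (Indep (1 - s) s) as [I1 I2]; [|lra].
    rewrite RtoC_minus, <- E'. ring.
Qed.

(** The distance of ln |z| from ln r: the logarithm turns the punctured disk of radius r into a
    half-strip and annuli into finite strips. *)
Definition logdist (r : R) (z : C) : R := ln r - ln (Cmod z).

(** In the coordinate ln z the Laplacian of a radial function is its second derivative, and the
    change of coordinate contributes the factor 1 / |z|^2. *)
Lemma has_lap_logradial (g dg : R -> R) (r : R) (z : C) (g2 : R) : z <> 0 ->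
  locally (logdist r z) (fun s => is_derive g s (dg s)) -> is_derive dg (logdist r z) g2 ->
  has_lap (fun z => g (logdist r z)) z (g2 / Cmod z ^ 2).
Proof.
  intros Hz Hg Hdg. apply Cmod_gt_0 in Hz. set (t0 := Cmod z ^ 2).
  assert (Ht : 0 < t0) by (unfold t0; nra).
  set (S := fun t => ln r - / 2 * ln t).
  assert (ES : forall w, 0 < Cmod w -> S (Cmod w ^ 2) = logdist r w).
  { intros w Hw. unfold S, logdist. rewrite ln_pow by exact Hw. simpl. field. }
  assert (DS : forall t, 0 < t -> is_derive S t (- / (2 * t))).
  { intros t Htp. unfold S. auto_derive. exact Htp. field. lra. }
  assert (ES0 := ES z Hz). fold t0 in ES0. rewrite <- ES0 in Hg, Hdg.
  assert (L : locally t0 (fun t => is_derive g (S t) (dg (S t)))).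
  { assert (CS : continuous S t0).
    { apply (ex_derive_continuous (V := R_NormedModule)). eexists. now apply DS. }
    exact (CS _ Hg). }
  destruct L as [d Hd].
  assert (P : taylor2_R (fun t => g (S t)) (Cmod (z - 0) ^ 2) (- / (2 * t0) * dg (S t0))
     (/ (2 * t0 ^ 2) * dg (S t0) + - / (2 * t0) * (- / (2 * t0) * g2))).
  { replace (z - 0)%C with z by ring. fold t0.
    apply (taylor2_R_derive _ (fun t => - / (2 * t) * dg (S t)) t0 _ (Rmin d t0)).
    - apply Rmin_pos; [apply cond_pos | exact Ht].
    - intros s Hs. destruct (Rmin_Rgt_l _ _ _ Hs) as [Hs1 Hs2]. apply Rabs_def2 in Hs2.
      apply (is_derive_comp g S). 2: apply DS; lra.
      apply Hd. unfold ball; simpl. unfold AbsRing_ball, abs, minus, plus, opp; simpl.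
      replace (t0 + s + - t0) with s by ring. exact Hs1.
    - apply (is_derive_mult (fun t => - / (2 * t)) (fun t => dg (S t)) t0).
      + auto_derive. lra. field. lra.
      + apply (is_derive_comp dg S). exact Hdg. now apply DS.
      + intros; apply Rmult_comm. }
  assert (H := has_lap_radial _ (RtoC 0) z _ _ P).
  replace (z - 0)%C with z in H by ring. fold t0 in H.
  replace (4 * (- / (2 * t0) * dg (S t0)) + 4 * (/ (2 * t0 ^ 2) * dg (S t0) + - / (2 * t0) * (- / (2 * t0) * g2)) * t0)
    with (g2 / t0) in H by (field; lra).
  apply (has_lap_ext _ _ z _ (Cmod z) Hz) with (2 := H).
  intros h Hh. replace (z + h - 0)%C with (z + h)%C by ring.
  rewrite ES; [reflexivity|].
  generalize (Cmod_rev_triangle z (z + h)). replace (z - (z + h))%C with (- h)%C by ring.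
  rewrite Cmod_opp. lra.
Qed.

Lemma logdist_bounds (r a b : R) (z : C) : 0 < r ->
  r * exp (- b) <= Cmod z <= r * exp (- a) -> 0 < Cmod z /\ a <= logdist r z <= b.
Proof.
  intros Hr [H1 H2]. assert (P := exp_pos (- b)).
  assert (Hz : 0 < Cmod z) by nra. split; [exact Hz|].
  unfold logdist. apply ln_le in H1; [|nra]. apply ln_le in H2; [|exact Hz].
  rewrite ln_mult, ln_exp in * by (try apply exp_pos; exact Hr). lra.
Qed.

Lemma logdist_bounds_inv (r a b : R) (z : C) : 0 < r -> 0 < Cmod z -> a <= logdist r z <= b ->
  r * exp (- b) <= Cmod z <= r * exp (- a).
Proof.
  intros Hr Hz [H1 H2]. unfold logdist in *.
  assert (E : Cmod z = exp (ln (Cmod z))) by (now rewrite exp_ln).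
  assert (Er : r = exp (ln r)) by (now rewrite exp_ln).
  rewrite E, Er, <- !exp_plus. split; apply exp_le_mono; lra.
Qed.

Definition annulus (r a b : R) (z : C) : Prop := r * exp (- b) <= Cmod z <= r * exp (- a).

Lemma annulus_closed (r a b : R) : closedC (annulus r a b).
Proof. apply closedC_and; [apply closedC_ge | apply closedC_le]; apply continuous_Cmod. Qed.

Lemma continuous_logdist_comp (g dg : R -> R) (r : R) (z : C) : 0 < Cmod z ->
  is_derive g (logdist r z) (dg (logdist r z)) -> continuous (fun z => g (logdist r z)) z.
Proof.
  intros Hz Hg.
  apply (continuous_comp_R g (logdist r) z (dg (logdist r z))); [|exact Hg].
  apply (continuous_comp_R (fun t => ln r - ln t) Cmod z (- / Cmod z)). apply continuous_Cmod.
  auto_derive. exact Hz. field. lra.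
Qed.

Lemma annulus_interior (r a b : R) (z : C) : 0 < r -> z <> 0 -> a < logdist r z < b ->
  exists d, 0 < d /\ forall h, Cmod h < d ->
    annulus r a b (z + h)%C /\ a < logdist r (z + h)%C < b.
Proof.
  intros Hr Hz Hs. apply Cmod_gt_0 in Hz.
  set (e := Rmin (logdist r z - a) (b - logdist r z)).
  assert (He : 0 < e) by (apply Rmin_pos; lra).
  assert (Hc : continuous (fun z => logdist r z) z).
  { apply (continuous_logdist_comp (fun s => s) (fun _ => 1)); [exact Hz|]. auto_derive; reflexivity. }
  destruct (continuous_R_bound _ z e He Hc) as [d1 [Hd1 B1]].
  destruct (continuous_pos Cmod z (continuous_Cmod z) Hz) as [d2 [Hd2 B2]].
  exists (Rmin d1 d2). split; [now apply Rmin_pos|]. intros h Hh.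
  destruct (Rmin_Rgt_l _ _ _ Hh) as [Hh1 Hh2]. specialize (B1 h Hh1). specialize (B2 h Hh2).
  apply Rmin_Rgt_l in B1. destruct B1 as [L1 L2]. apply Rabs_def2 in L1. apply Rabs_def2 in L2.
  assert (a < logdist r (z + h)%C < b) by lra.
  split; [apply logdist_bounds_inv; auto; lra | assumption].
Qed.

(** Ahlfors' argument with the density M / (2 |z| s (M - s)), s = logdist r z, which blows up on
    both circles of the annulus. The second derivative of its logarithm with respect to s is 1 /
    s^2 + 1 / (M - s)^2 <= (1 / s + 1 / (M - s))^2, that is, its curvature is at least -4. *)
Lemma hyperbolic_upper_annulus (Omega : C -> Prop) (lamO : C -> R) (r M : R) (z : C) :
  hyperbolic_metric Omega lamO -> 0 < r -> (forall z, 0 < Cmod z <= r -> Omega z) ->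
  0 < Cmod z -> 0 < logdist r z < M ->
  lamO z * (2 * Cmod z * logdist r z * (M - logdist r z)) <= M.
Proof.
  intros Hhyp Hr HO Hz Hs.
  assert (Pos := fun w => hyperbolic_pos _ _ w Hhyp).
  set (K := annulus r 0 M).
  assert (KO : forall w, K w -> 0 < Cmod w <= r).
  { intros w Kw. destruct (logdist_bounds _ _ _ _ Hr Kw) as [W1 _]. split; [exact W1|].
    destruct Kw as [_ Kw]. rewrite Ropp_0, exp_0, Rmult_1_r in Kw. exact Kw. }
  set (F := fun w => lamO w * (2 * Cmod w * (logdist r w * (M - logdist r w)))).
  destruct (extreme_value K F r) as [m [Km Hm]].
  - exists z. apply logdist_bounds_inv; auto. lra.
  - intros w Kw. now apply KO.
  - apply annulus_closed.
  - intros w Kw. destruct (KO w Kw) as [W1 W2].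
    apply continuous_mult_R; [apply Pos, HO; lra|].
    apply continuous_mult_R. apply (continuous_mult_R (fun _ => 2)). apply continuous_const. apply continuous_Cmod.
    apply (continuous_logdist_comp (fun s => s * (M - s)) (fun s => M - 2 * s)). exact W1.
    auto_derive. exact I. ring.
  - assert (Kz : K z) by (apply logdist_bounds_inv; auto; lra).
    assert (X := Hm z Kz).
    assert (FM : F m <= M).
    { destruct (logdist_bounds _ _ _ _ Hr Km) as [M1 [M2 M3]].
      assert (Om : Omega m) by now apply HO, KO. destruct (Pos m Om) as [P1 P2].
      set (s := logdist r m) in *.
      assert (HM : 0 < M) by lra.
      destruct (Req_dec s 0) as [E | N0].
      { unfold F. fold s. rewrite E. lra. }
      destruct (Req_dec s M) as [E | N1].
      { unfold F. fold s. rewrite E. replace (M - M) with 0 by ring. lra. }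
      assert (Hs1 : 0 < s < M) by lra.
      assert (Hm0 : m <> 0) by now apply Cmod_gt_0.
      set (g := fun s => s - ln s - ln (M - s)). set (dg := fun s => 1 - / s + / (M - s)).
      assert (Dg : forall u, 0 < u < M -> is_derive g u (dg u)).
      { intros u Hu. unfold g, dg. auto_derive. repeat split; lra. field. lra. }
      assert (Lg : locally s (fun u => is_derive g u (dg u))).
      { apply (locally_interval _ s 0 M); simpl; [lra | lra |]. intros u Hu1 Hu2. now apply Dg. }
      assert (Ddg : is_derive dg s (/ s ^ 2 + / (M - s) ^ 2)).
      { unfold dg. auto_derive. repeat split; lra. field. lra. }
      assert (HL := has_lap_logradial g dg r m _ Hm0 Lg Ddg).
      destruct (annulus_interior r 0 M m Hr Hm0 Hs1) as [d [Hd Bd]].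
      assert (T := hyperbolic_extremum_test Omega lamO _ m 1 _ d Hhyp Om Hd HL).
      assert (LF : forall w, K w -> 0 < logdist r w < M ->
        ln (lamO w) - g (logdist r w) = ln (F w) - ln 2 - ln r).
      { intros w Kw Hw. destruct (KO w Kw) as [W1 W2]. destruct (Pos w (HO w (KO w Kw))) as [W3 _].
        assert (V1 : 0 < logdist r w * (M - logdist r w)) by (apply Rmult_lt_0_compat; lra).
        assert (V2 : 0 < 2 * Cmod w) by lra.
        unfold F, g. rewrite (ln_mult (lamO w)), (ln_mult (2 * Cmod w)), (ln_mult 2), (ln_mult (logdist r w))
          by (try apply Rmult_lt_0_compat; lra).
        unfold logdist at 1. ring. }
      assert (T' : 1 * (4 * lamO m ^ 2 - (/ s ^ 2 + / (M - s) ^ 2) / Cmod m ^ 2) <= 0).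
      { apply T. intros h Hh. rewrite !Rmult_1_l.
        destruct (Bd h Hh) as [Kh Sh]. rewrite (LF m Km Hs1), (LF _ Kh Sh).
        assert (ln (F (m + h)%C) <= ln (F m)); [|lra].
        apply ln_le; [|exact (Hm _ Kh)].
        destruct (KO _ Kh) as [W1 _]. destruct (Pos _ (HO _ (KO _ Kh))) as [W3 _].
        unfold F. repeat apply Rmult_lt_0_compat; lra. }
      set (x := Cmod m) in *.
      assert (Fe : F m = 2 * lamO m * x * (s * (M - s))) by (unfold F; fold x s; ring).
      assert (V1 : 0 < s * (M - s)) by (apply Rmult_lt_0_compat; lra).
      assert (Sq : (2 * lamO m * x * (s * (M - s))) ^ 2 <= M ^ 2).
      { assert (A : 4 * lamO m ^ 2 <= (/ s ^ 2 + / (M - s) ^ 2) / x ^ 2) by lra.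
        assert (V2 : 0 < (x * (s * (M - s))) ^ 2) by (apply pow_lt, Rmult_lt_0_compat; lra).
        apply Rmult_le_compat_r with (r := (x * (s * (M - s))) ^ 2) in A; [|lra].
        replace ((/ s ^ 2 + / (M - s) ^ 2) / x ^ 2 * (x * (s * (M - s))) ^ 2)
          with ((M - s) ^ 2 + s ^ 2) in A by (field; lra).
        replace ((2 * lamO m * x * (s * (M - s))) ^ 2) with (4 * lamO m ^ 2 * (x * (s * (M - s))) ^ 2) by ring.
        nra. }
      rewrite Fe. apply Rnot_lt_le. intros HH. nra. }
    replace (lamO z * (2 * Cmod z * logdist r z * (M - logdist r z))) with (F z) by (unfold F; ring). lra.
Qed.

(** Let M tend to infinity in [hyperbolic_upper_annulus]. The bound is the hyperbolic density of
    the punctured disk of radius r, and the sharp constant matters: it yields the coefficient 2 /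
    s^2 in [puncture_decay]. *)
Lemma hyperbolic_upper_punctured (Omega : C -> Prop) (lamO : C -> R) (r : R) (z : C) :
  hyperbolic_metric Omega lamO -> 0 < r -> (forall z, 0 < Cmod z <= r -> Omega z) ->
  0 < Cmod z -> 0 < logdist r z -> 2 * lamO z * Cmod z * logdist r z <= 1.
Proof.
  intros Hhyp Hr HO Hz Hs. set (s := logdist r z) in *. set (X := 2 * lamO z * Cmod z * s).
  apply Rnot_lt_le. intros HX.
  (* the annulus bound reads X (M - s) <= M, and this M violates it *)
  set (M := (X * s + 1) / (X - 1)).
  assert (HM : (X - 1) * M = X * s + 1) by (unfold M; field; lra).
  assert (HsM : s < M) by nra.
  assert (H := hyperbolic_upper_annulus Omega lamO r M z Hhyp Hr HO Hz (conj Hs HsM)). fold s in H.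
  replace (lamO z * (2 * Cmod z * s * (M - s))) with (X * (M - s)) in H by (unfold X; ring). nra.
Qed.

(** With s = logdist r z, the bound on [lamO] gives 8 lamO^2 <= 2 / (|z|^2 s^2), and in the
    coordinate s the equation b'' = 2 b / s^2 has the solutions 1 / s and s^2. The solution c / s
    - de s^2 is at most c on the circle s = 1 and negative close to the puncture, so
    [comparison_principle] applies on an annulus; then de tends to 0. *)
Lemma puncture_decay (Omega : C -> Prop) (lam lamO : C -> R) (r : R) :
  open Omega -> hyperbolic_metric Omega lamO ->
  conformal_pseudometric Omega lam -> curvature_le Omega lam (-4) ->
  0 < r -> (forall z, 0 < Cmod z <= r -> Omega z) ->
  (forall z, Omega z -> lam z < lamO z) ->
  exists c, 0 < c /\ forall z, 0 < Cmod z -> 1 <= logdist r z ->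
    lam z * exp (c / logdist r z) <= lamO z.
Proof.
  intros HO Hhyp Hlam Hcurv Hr HD Hlt.
  assert (Pos := fun w => hyperbolic_pos _ _ w Hhyp).
  assert (Dist : forall w a b, 0 <= a -> annulus r a b w -> 0 < Cmod w <= r).
  { intros w a b Ha Kw. destruct (logdist_bounds _ _ _ _ Hr Kw) as [W1 _]. split; [exact W1|].
    destruct Kw as [_ Kw]. apply Rle_trans with (1 := Kw).
    rewrite <- (Rmult_1_r r) at 2. apply Rmult_le_compat_l; [lra|]. rewrite <- exp_0.
    apply exp_le_mono. lra. }
  (* on the circle logdist = 1 the ratio is at most k < 1 *)
  assert (Hk : exists k, 0 < k < 1 /\ forall z, annulus r 1 1 z -> lam z <= k * lamO z).
  { destruct (extreme_value (annulus r 1 1) (fun z => lam z * / lamO z) r) as [m [Km Hm]].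
    - exists (RtoC (r * exp (- (1)))). unfold annulus. rewrite Cmod_R, Rabs_pos_eq.
      lra. apply Rmult_le_pos; [lra|]. left. apply exp_pos.
    - intros w Kw. apply (Dist w 1 1); [lra | exact Kw].
    - apply annulus_closed.
    - intros w Kw. assert (Ow : Omega w) by (apply HD, (Dist w 1 1); [lra | exact Kw]).
      destruct (Pos w Ow). apply continuous_mult_R. now apply (pseudometric_continuous Omega).
      apply continuous_inv_R; [assumption | lra].
    - assert (Om : Omega m) by (apply HD, (Dist m 1 1); [lra | exact Km]).
      destruct (Pos m Om) as [P1 _].
      assert (L1 : lam m * / lamO m < 1).
      { apply Rmult_lt_reg_r with (lamO m); [lra|]. rewrite Rmult_assoc, Rinv_l, Rmult_1_l by lra.
        rewrite Rmult_1_r. now apply Hlt. }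
      exists (Rmax (lam m * / lamO m) (/ 2)). split.
      + split. apply Rlt_le_trans with (/ 2); [lra | apply Rmax_r]. apply Rmax_lub_lt; lra.
      + intros z Kz. specialize (Hm z Kz).
        assert (Oz : Omega z) by (apply HD, (Dist z 1 1); [lra | exact Kz]).
        destruct (Pos z Oz) as [P2 _].
        apply Rmult_le_reg_r with (/ lamO z). now apply Rinv_0_lt_compat.
        rewrite Rmult_assoc, Rinv_r, Rmult_1_r by lra. apply Rle_trans with (1 := Hm). apply Rmax_l. }
  destruct Hk as [k [Hk HK1]].
  set (c := - ln k).
  assert (Hc : 0 < c). { unfold c. assert (ln k < 0) by (rewrite <- ln_1; apply ln_increasing; lra). lra. }
  exists c. split; [exact Hc|]. intros z Hz Hs.
  assert (Oz : Omega z).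
  { apply HD, (Dist z 1 (logdist r z)); [lra|]. apply logdist_bounds_inv; auto. lra. }
  destruct (Pos z Oz) as [Pz _].
  destruct (pseudometric_continuous _ _ _ Hlam Oz) as [[Lz | Lz] _]; [|rewrite <- Lz; lra].
  assert (Main : forall de, 0 < de ->
    lam z * exp (c / logdist r z - de * logdist r z ^ 2) <= lamO z).
  { intros de Hde.
    (* M is so large that the subsolution is nonpositive on the circle s = M *)
    set (M := Rmax (logdist r z + 1) (c / de)).
    assert (HM1 : logdist r z + 1 <= M) by apply Rmax_l.
    assert (HM2 : c / de <= M) by apply Rmax_r.
    assert (HM3 : c <= de * M).
    { apply Rle_trans with (de * (c / de)). right; field; lra. apply Rmult_le_compat_l; lra. }
    set (g := fun s => c / s - de * s ^ 2). set (dg := fun s => - c / s ^ 2 - 2 * de * s).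
    assert (Dg : forall u, 0 < u -> is_derive g u (dg u)).
    { intros u Hu. unfold g, dg. auto_derive. lra. field. lra. }
    assert (Ddg : forall u, 0 < u -> is_derive dg u (2 / u ^ 2 * g u)).
    { intros u Hu. unfold g, dg. auto_derive.
      assert (0 < u * (u * 1)) by nra. lra. field. lra. }
    apply (comparison_principle Omega lam lamO (fun z => g (logdist r z)) (annulus r 1 M) r); auto.
    - intros w Kw. apply HD, (Dist w 1 M); [lra | exact Kw].
    - intros w Kw. apply (Dist w 1 M); [lra | exact Kw].
    - apply annulus_closed.
    - intros w Kw. destruct (logdist_bounds _ _ _ _ Hr Kw) as [W1 W2].
      apply (continuous_logdist_comp g dg). exact W1. apply Dg. lra.
    - intros w Kw. destruct (logdist_bounds _ _ _ _ Hr Kw) as [W1 W2].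
      assert (Dw := Dist w 1 M ltac:(lra) Kw). assert (Ow := HD w Dw). destruct (Pos w Ow) as [P1 _].
      destruct (pseudometric_continuous _ _ _ Hlam Ow) as [L0 _].
      assert (Lw := Hlt w Ow).
      set (s := logdist r w) in *.
      destruct (Req_dec s 1) as [E1 | N1].
      { left. assert (Kw1 : annulus r 1 1 w) by (apply logdist_bounds_inv; auto; fold s; lra).
        specialize (HK1 w Kw1).
        assert (B : exp (g s) <= / k).
        { replace (/ k) with (exp c) by (unfold c; rewrite exp_Ropp, exp_ln by lra; reflexivity).
          left. apply exp_increasing. unfold g. rewrite E1. rewrite Rdiv_1_r. lra. }
        apply Rle_trans with (lam w * / k). now apply Rmult_le_compat_l.
        apply Rmult_le_reg_r with k; [lra|]. rewrite Rmult_assoc, Rinv_l; lra. }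
      destruct (Req_dec s M) as [E2 | N2].
      { left. assert (B : exp (g s) <= 1).
        { rewrite <- exp_0.
          assert (g s <= 0).
          { unfold g. rewrite E2. assert (c / M <= de * M ^ 2); [|lra].
            apply Rmult_le_reg_r with M; [lra|]. unfold Rdiv. rewrite Rmult_assoc, Rinv_l by lra.
            rewrite Rmult_1_r. apply Rle_trans with (1 := HM3).
            assert (de * M * 1 <= de * M * M ^ 2); [|lra].
            apply Rmult_le_compat_l; [nra|]. nra. }
          now apply exp_le_mono. }
        nra. }
      right. assert (Hw0 : w <> 0) by now apply Cmod_gt_0.
      destruct (annulus_interior r 1 M w Hr Hw0) as [d [Hd Bd]]; [fold s; lra|].
      exists d. eexists. split; [exact Hd|]. split; [intros h Hh; now apply Bd|]. split.
      + apply (has_lap_logradial g dg r w (2 / s ^ 2 * g s) Hw0); [|apply Ddg; fold s; lra].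
        fold s. apply (locally_interval _ s 0 p_infty); simpl; [lra | exact I |].
        intros u Hu _. now apply Dg.
      + fold s. intros Hg.
        assert (U := hyperbolic_upper_punctured Omega lamO r w Hhyp Hr HD W1 ltac:(fold s; lra)).
        fold s in U. set (x := Cmod w) in *.
        assert (U2 : (2 * lamO w * x * s) ^ 2 <= 1).
        { assert (0 < 2 * lamO w * x * s) by (repeat apply Rmult_lt_0_compat; lra). nra. }
        assert (V : 0 < (x * s) ^ 2) by (apply pow_lt, Rmult_lt_0_compat; lra).
        replace (2 / s ^ 2 * g s / x ^ 2) with (2 * g s * / (x * s) ^ 2) by (field; lra).
        apply Rmult_le_reg_r with ((x * s) ^ 2); [exact V|].
        rewrite (Rmult_assoc (2 * g s)), Rinv_l by lra.
        replace (8 * lamO w ^ 2 * g s * (x * s) ^ 2) with (2 * g s * (2 * lamO w * x * s) ^ 2) by ring.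
        apply Rmult_le_compat_l; lra.
    - apply logdist_bounds_inv; auto. lra. }
  apply Rnot_lt_le. intros Hcon. set (s := logdist r z) in *.
  set (D := ln (lam z) + c / s - ln (lamO z)).
  assert (HD0 : 0 < D).
  { unfold D. apply ln_increasing in Hcon; [|exact Pz].
    rewrite ln_mult, ln_exp in Hcon by (try apply exp_pos; exact Lz). lra. }
  assert (Hs2 : 0 < s ^ 2) by (apply pow_lt; lra).
  (* this de uses up half of the excess D *)
  specialize (Main (D / (2 * s ^ 2)) ltac:(apply Rdiv_lt_0_compat; lra)).
  replace (D / (2 * s ^ 2) * s ^ 2) with (D / 2) in Main by (field; lra).
  apply ln_le in Main; [|apply Rmult_lt_0_compat; [exact Lz | apply exp_pos]].
  rewrite ln_mult, ln_exp in Main by (try apply exp_pos; exact Lz). unfold D in *. lra.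
Qed.

Lemma limsup_lt (T : Type) (F : (T -> Prop) -> Prop) (f : T -> Rbar) (V : T -> Prop) (b c : R) :
  F V -> (forall z, V z -> Rbar_le (f z) b) -> b < c -> Rbar_lt (limsup F f) c.
Proof.
  intros HV Hf Hbc. unfold limsup. apply Rbar_le_lt_trans with (Finite b); [|exact Hbc].
  set (E := fun s => exists V0 : T -> Prop, F V0 /\ s = Rbar_lub (fun y => exists z, V0 z /\ y = f z)).
  assert (H1 := proj1 (proj2_sig (Rbar_ex_glb E))). fold (Rbar_glb E) in H1.
  apply Rbar_le_trans with (Rbar_lub (fun y => exists z, V z /\ y = f z)).
  - apply H1. exists V. split; [exact HV | reflexivity].
  - assert (H2 := proj2 (proj2_sig (Rbar_ex_lub (fun y => exists z, V z /\ y = f z)))).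
    apply H2. intros y [z [Vz ->]]. now apply Hf.
Qed.

Theorem corollary4p3 (Omega : C -> Prop) (lam lamO : C -> R)
    (hOmega : hyperbolic_domain Omega)
    (h0 : isolated_boundary_point Omega (RtoC 0))
    (hlamO : hyperbolic_metric Omega lamO)
    (hlam : conformal_pseudometric Omega lam)
    (hcurv : curvature_le Omega lam (-4)) :
  (forall z, Omega z -> lam z = lamO z) \/
  Rbar_lt
    (limsup (within Omega (locally (RtoC 0)))
       (fun z => Rbar_mult (Rbar_ln (lam z / lamO z)) (Finite (ln (1 / Cmod z)))))
    (Finite 0).
Proof.
  destruct hOmega as (_ & HO & Hconn & _).
  destruct (ahlfors_dichotomy Omega lam lamO HO Hconn hlamO hlam hcurv) as [H | Hlt]; [now left | right].
  destruct (isolated_boundary_punctured_disk Omega HO h0) as [r [Hr HD]].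
  destruct (puncture_decay Omega lam lamO r HO hlamO hlam hcurv Hr HD Hlt) as [c [Hc Hdec]].
  assert (N0 := boundary_open_notin _ _ HO (proj1 h0)).
  (* within r0: logdist is at least 1, |z| < 1, and logdist is at most 2 ln (1 / |z|) *)
  set (r0 := Rmin (r * exp (- (1))) (Rmin (/ r) 1)).
  assert (Hr0 : 0 < r0).
  { unfold r0. repeat apply Rmin_pos; [|now apply Rinv_0_lt_compat | lra].
    apply Rmult_lt_0_compat; [exact Hr | apply exp_pos]. }
  apply (limsup_lt _ _ _ (fun z => Omega z /\ Cmod z < r0) (- c / 2)).
  - apply (proj2 (locally_Cmod 0 _)). exists r0. split; [exact Hr0|]. intros h Hh Oh.
    rewrite Cplus_0_l in *. now split.
  - intros z [Oz Hz].
    assert (Hz0 : 0 < Cmod z) by (apply Cmod_gt_0; intros ->; exact (N0 Oz)).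
    assert (Hz1 : Cmod z < r * exp (- (1))) by (apply Rlt_le_trans with (1 := Hz), Rmin_l).
    assert (Hz2 : Cmod z < / r).
    { apply Rlt_le_trans with (1 := Hz). unfold r0. apply Rle_trans with (1 := Rmin_r _ _), Rmin_l. }
    assert (Hz3 : Cmod z < 1).
    { apply Rlt_le_trans with (1 := Hz). unfold r0. apply Rle_trans with (1 := Rmin_r _ _), Rmin_r. }
    set (L := ln (1 / Cmod z)).
    assert (HL : L = - ln (Cmod z)) by (unfold L; rewrite Rdiv_1_l; now apply ln_Rinv).
    assert (HL0 : 0 < L).
    { rewrite HL. assert (ln (Cmod z) < 0) by (rewrite <- ln_1; now apply ln_increasing). lra. }
    assert (HS1 : 1 <= logdist r z).
    { destruct (logdist_bounds r 1 (logdist r z) z Hr); [|tauto].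
      split; [|lra]. unfold logdist. right. rewrite <- (exp_ln r Hr) at 1. rewrite <- exp_plus.
      rewrite <- (exp_ln (Cmod z) Hz0) at 2. f_equal. ring. }
    assert (HS2 : logdist r z <= 2 * L).
    { unfold logdist. rewrite HL. apply ln_increasing in Hz2; [|exact Hz0].
      rewrite ln_Rinv in Hz2 by exact Hr. lra. }
    specialize (Hdec z Hz0 HS1). set (S := logdist r z) in *.
    destruct (hyperbolic_pos _ _ z hlamO Oz) as [Pz _].
    destruct (pseudometric_continuous _ _ _ hlam Oz) as [Qz _].
    unfold Rbar_ln. destruct (Rlt_dec 0 (lam z / lamO z)) as [Hq | Hq].
    + assert (Lz : 0 < lam z).
      { replace (lam z) with (lam z / lamO z * lamO z) by (field; lra). now apply Rmult_lt_0_compat. }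
      simpl. apply ln_le in Hdec; [|apply Rmult_lt_0_compat; [exact Lz | apply exp_pos]].
      rewrite ln_mult, ln_exp in Hdec by (try apply exp_pos; exact Lz).
      unfold Rdiv at 1. rewrite ln_mult, ln_Rinv by (try apply Rinv_0_lt_compat; assumption).
      assert (HcS : c / (2 * L) <= c / S).
      { unfold Rdiv. apply Rmult_le_compat_l; [lra|]. apply Rinv_le_contravar; lra. }
      assert (E : c / (2 * L) * L = c / 2) by (field; lra).
      apply Rle_trans with (- (c / (2 * L)) * L); [apply Rmult_le_compat_r; lra | lra].
    + unfold Rbar_mult, Rbar_mult'. destruct (Rle_dec 0 L) as [h | h]; [|lra].
      destruct (Rle_lt_or_eq_dec 0 L h) as [h' | h']; [exact I | lra].
  - lra.
Qed.
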